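(* Let $-\infty<a<b<\infty$, $l\in\mathbb N$, let $\alpha\in\mathbb C$ and $\alpha_0,\dots,\alpha_l\in\mathbb C$ satisfy $0=\alpha_0<\operatorname{Re}\alpha_1<\cdots<\operatorname{Re}\alpha_l<\operatorname{Re}\alpha$, and let $n=[\operatorname{Re}\alpha]+1$ if $\alpha\notin\mathbb N$ and $n=\alpha$ if $\alpha\in\mathbb N$. Let $a_j\in C[a,b]$ $(j=0,\dots,l)$ be complex-valued, $g\in L(a,b)$, $b_1,\dots,b_n\in\mathbb C$, and let $k_0$ be the largest $k\in\{1,\dots,n\}$ such that $a_j(x)\frac{(x-a)^{\alpha-\alpha_j-k}}{\Gamma(\alpha-\alpha_j-k+1)}\in L(a,b)$ for all $j=0,\dots,l$. Then there exists a unique solution $y\in L^{\alpha}(a,b)$ of the Cauchy type problem $$(D_{a+}^{\alpha}y)(x)+\sum_{j=0}^{l}a_j(x)(D_{a+}^{\alpha_j}y)(x)=g(x),\qquad (D_{a+}^{\alpha-k}y)(a+)=b_kH(k_0-k)\quad(k=1,\dots,n).$$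
   Context: All equalities between functions hold almost everywhere. $L(a,b)$ is the space of complex-valued Lebesgue integrable functions on $(a,b)$. $H(k)=1$ for $k\ge 0$ and $H(k)=0$ for $k<0$. $[\cdot]$ is the integer part, and $1/\Gamma(z)=0$ at the poles $z=0,-1,-2,\dots$ of $\Gamma$. As the paper assumes, $n-1<\operatorname{Re}\alpha<n$ when $\alpha\notin\mathbb N$. For $\operatorname{Re}\beta>0$, $(I_{a+}^{\beta}f)(x)=\frac1{\Gamma(\beta)}\int_a^x(x-t)^{\beta-1}f(t)\,dt$, and $I_{a+}^0$ is the identity. The Riemann-Liouville derivative for $\operatorname{Re}\beta\ge 0$ is $(D_{a+}^{\beta}y)(x)=\left(\frac{d}{dx}\right)^{m}(I_{a+}^{m-\beta}y)(x)$ with $m=[\operatorname{Re}\beta]+1$; for $\beta=m$ a nonnegative integer, $D_{a+}^{m}y=y^{(m)}$ (so $D_{a+}^{0}y=y$). For $k=n$ and $\alpha\notin\mathbb N$, $D_{a+}^{\alpha-n}y:=I_{a+}^{n-\alpha}y$. The value at $a+$ denotes the limit as $x\to a+$. $AC^n[a,b]$ is the space of functions with continuous derivatives up to order $n-1$ on $[a,b]$ whose $(n-1)$-st derivative is absolutely continuous. $L^{\alpha}(a,b)=\{y\in L(a,b):D_{a+}^{\alpha}y\in L(a,b)\}$, where $D_{a+}^{\alpha}y\in L(a,b)$ is read as: $I_{a+}^{n-\alpha}y\in AC^n[a,b]$ (so $D_{a+}^{\alpha}y=\left(\frac{d}{dx}\right)^n I_{a+}^{n-\alpha}y$ exists a.e.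 and is integrable). *)

(* Defs.v *)
From HB Require Import structures.
From mathcomp Require Import all_boot all_order all_algebra.
From mathcomp Require Import complex.
From mathcomp Require Import all_classical all_reals all_analysis.

Set Implicit Arguments.
Unset Strict Implicit.
Unset Printing Implicit Defensive.

Import Order.TTheory GRing.Theory Num.Theory.
Import numFieldNormedType.Exports.

Local Open Scope classical_set_scope.
Local Open Scope ring_scope.
Local Open Scope complex_scope.

(* Limits in R[i] are taken in the regular module R[i]^o, which carries the
   topology given by the modulus. *)

(* x ^ z for real x > 0 and complex z, with the principal (real) logarithm. *)
Definition cpow (R : realType) (x : R) (z : R[i]) : R[i] :=
  (x `^ complex.Re z)%:C * (cos (complex.Im z * ln x) +i* sin (complex.Im z * ln x)).

Definition cintegral (R : realType) (A : set R) (f : R -> R[i]) : R[i] :=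
  (\int[lebesgue_measure]_(x in A) complex.Re (f x)) +i*
  (\int[lebesgue_measure]_(x in A) complex.Im (f x)).

Definition cintegrable (R : realType) (A : set R) (f : R -> R[i]) : Prop :=
  lebesgue_measure.-integrable A (EFin \o (fun x => complex.Re (f x))) /\
  lebesgue_measure.-integrable A (EFin \o (fun x => complex.Im (f x))).

Definition ae_eq_on (R : realType) (A : set R) (f g : R -> R[i]) : Prop :=
  ae_eq lebesgue_measure A f g.

(* Euler's integral for Re z > 0, extended to Re z <= 0 by
   Gamma z = Gamma (z + N) / (z (z + 1) ... (z + N - 1)).
   At the poles z = 0, -1, -2, ... one factor vanishes, so that Gamma z = 0 and
   (Gamma z)^-1 = 0 in R[i]: the convention 1 / Gamma z = 0 holds. *)
Definition Gamma_integral (R : realType) (z : R[i]) : R[i] :=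
  cintegral `]0, +oo[ (fun t => cpow t (z - 1) * (expR (- t))%:C).

Definition Gamma (R : realType) (z : R[i]) : R[i] :=
  let N := if 0 < complex.Re z then 0%N
           else absz (Num.floor (- complex.Re z) + 1) in
  Gamma_integral (z + N%:R) / \prod_(i < N) (z + i%:R).

Definition is_natc (R : realType) (z : R[i]) : Prop :=
  exists m : nat, z = m%:R.

(* beta if beta is a natural number, [Re beta] + 1 otherwise. When
   -1 < Re beta < 0 this is 0, which gives D^beta = I^(-beta) below. *)
Definition rl_order (R : realType) (beta : R[i]) : nat :=
  if `[< is_natc beta >] then Num.truncn (complex.Re beta)
  else absz (Num.floor (complex.Re beta) + 1).

Definition rl_integral (R : realType) (a : R) (beta : R[i]) (f : R -> R[i])
    (x : R) : R[i] :=
  if beta == 0 then f x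
  else (Gamma beta)^-1 *
       cintegral `]a, x[ (fun t => cpow (x - t) (beta - 1) * f t).

Definition diff_quotient (R : realType) (f : R -> R[i]) (x y : R) : R[i]^o :=
  (f y - f x) / (y - x)%:C.

(* Derivative along A; at an endpoint of a segment A it is one-sided. *)
Definition derivable_on (R : realType) (A : set R) (f : R -> R[i]) (x : R) :
    Prop :=
  cvg (diff_quotient f x y @[y --> within A x^']).

Definition derive_on (R : realType) (A : set R) (f : R -> R[i]) (x : R) :
    R[i] :=
  lim (diff_quotient f x y @[y --> within A x^']).

Definition deriven_on (R : realType) (A : set R) (m : nat) (f : R -> R[i]) :
    R -> R[i] :=
  iter m (derive_on A) f.

Definition continuous_on (R : realType) (A : set R) (f : R -> R[i]) : Prop :=
  {within A, continuous (f : R -> R[i]^o)}.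

Definition abs_continuous (R : realType) (a b : R) (f : R -> R[i]) : Prop :=
  forall e : R, 0 < e -> exists2 d : R, 0 < d &
    forall (N : nat) (s t : 'I_N -> R),
      (forall i, [/\ a <= s i, s i <= t i & t i <= b]) ->
      (forall i j, i != j -> t i <= s j \/ t j <= s i) ->
      \sum_(i < N) (t i - s i) < d ->
      \sum_(i < N) `|f (t i) - f (s i)| < e%:C.

(* AC^n[a, b], for n >= 1. *)
Definition ACn (R : realType) (n : nat) (a b : R) (f : R -> R[i]) : Prop :=
  [/\ forall i x, (i < n.-1)%N -> x \in `[a, b] ->
        derivable_on `[a, b] (deriven_on `[a, b] i f) x,
      forall i, (i < n)%N -> continuous_on `[a, b] (deriven_on `[a, b] i f)
    & abs_continuous a b (deriven_on `[a, b] n.-1 f)].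

(* Functions are identified when equal almost everywhere, while pointwise
   derivatives and limits are not invariant under this identification; they are
   therefore taken on the continuous representative (unique on ]a, b[), when
   there is one. Otherwise the function is left unchanged. *)
Definition cont_repr (R : realType) (a b : R) (f : R -> R[i]) : R -> R[i] :=
  xget f [set h | ae_eq_on `]a, b[ h f /\ continuous_on `]a, b[ h].

(* D_{a+}^beta y on ]a, b[, for Re beta >= 0 or -1 < Re beta < 0. *)
Definition rl_derive (R : realType) (a b : R) (beta : R[i]) (y : R -> R[i]) :
    R -> R[i] :=
  let m := rl_order beta in
  deriven_on `]a, b[ m (cont_repr a b (rl_integral a (m%:R - beta) y)).

Definition Lalpha (R : realType) (a b : R) (alpha : R[i]) (y : R -> R[i]) :
    Prop :=
  let n := rl_order alpha in
  cintegrable `]a, b[ y /\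
  exists2 h, ACn n a b h & ae_eq_on `]a, b[ h (rl_integral a (n%:R - alpha) y).

(* Main.v *)
(* With K_p(t) = t^(p-1) / Gamma p, every y in L^alpha is, almost everywhere,
   I^alpha phi + sum_k c_k K_(alpha-k+1)(x - a) with phi in L^1: the function
   I^(n-alpha) y is an n-fold primitive plus a Taylor polynomial, and the
   semigroup property of the fractional integrals lets one cancel I^(n-alpha).
   In this form D^alpha y = phi,
   D^beta y = I^(alpha-beta) phi + sum_k c_k K_(alpha-beta-k+1)(x - a), and c_k is
   the limit of D^(alpha-k) y at a+.  The initial conditions thus fix the c_k, and
   c_k = 0 for k > k0 makes all the a_j K_(alpha-alpha_j-k+1) that remain
   integrable.  The equation becomes the Volterra equation
   phi + sum_j a_j I^(alpha-alpha_j) phi = G with G in L^1, which has exactly one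
   solution, because conjugating I^p with exp(lam x) makes its norm on L^1 at most
   a constant times lam^(-Re p). *)
From HB Require Import structures.
Require Import Defs.
From mathcomp Require Import all_boot all_order all_algebra.
From mathcomp Require Import complex.
From mathcomp Require Import finmap.
From mathcomp Require Import all_classical all_reals all_analysis.
From mathcomp Require Import measurable_realfun.
From mathcomp Require Import ring lra zify.

Set Implicit Arguments.
Unset Strict Implicit.
Unset Printing Implicit Defensive.

Import Order.TTheory GRing.Theory Num.Theory.
Import numFieldNormedType.Exports.
Local Open Scope classical_set_scope.
Local Open Scope ring_scope.
Local Open Scope complex_scope.

Local Notation cRe := complex.Re.
Local Notation cIm := complex.Im.

(** * Complex-valued integrals *)

Section Modulus.
Context {R : realType}.
Implicit Types z w : R[i].

(** Dividing by Gamma p needs Gamma p <> 0 for Re p > 0: at a zero the convention 1 / 0 = 0 would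
    make the fractional integral of order p vanish identically and break the semigroup law.
    Non-vanishing comes from an explicit estimate for Re p large against (Im p)^2, carried back by
    Gamma (p + 1) = p Gamma p. The Beta integral is the constant that scaling leaves in the
    convolution of two powers; integrating the convolution of the Gamma integrands gives Gamma p
    Gamma q = B(p, q) Gamma (p + q). Integrals determine functions almost everywhere, whereas
    derivatives and limits at a are pointwise. Hence, for m > 0, I^(m - beta) y is matched almost
    everywhere with an explicit function continuous on ]a, b[, which must be the continuous
    representative, and derivatives are taken of that function. Absolute continuity is given in
    epsilon-delta form, so the density phi has to be constructed, by Radon-Nikodym. As 1 / Gamma
    vanishes at 0, -1, -2, ..., one formula K_p, for all complex p, covers the powers, the Taylor
    monomials and those of their derivatives that vanish. *)

Definition cmod z : R := Normc.normc z.

(** The norm of R[i] takes its values in R[i]; [cmod] is its real-valued form, which integrals, real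
    powers and real inequalities require. *)
Lemma normcE z : `|z| = (cmod z)%:C.
Proof. by []. Qed.

Lemma cmodE z : cmod z = Num.sqrt (cRe z ^+ 2 + cIm z ^+ 2).
Proof. by case: z. Qed.

Lemma cmod_ge0 z : 0 <= cmod z.
Proof. by rewrite cmodE sqrtr_ge0. Qed.

Lemma cmod0 : cmod 0 = 0.
Proof. exact: Normc.normc0. Qed.

Lemma cmodM z w : cmod (z * w) = cmod z * cmod w.
Proof. exact: Normc.normcM. Qed.

Lemma cmodV z : cmod z^-1 = (cmod z)^-1.
Proof. exact: Normc.normcV. Qed.

Lemma ler_cmodD z w : cmod (z + w) <= cmod z + cmod w.
Proof. by rewrite -lecR rmorphD /= -!normcE ler_normD. Qed.

Lemma cmodN z : cmod (- z) = cmod z.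
Proof. by apply: (@complexI R); rewrite -!normcE normrN. Qed.

Lemma cmodB z w : cmod (z - w) = cmod (w - z).
Proof. by rewrite -cmodN opprB. Qed.

Lemma cmodR (x : R) : cmod x%:C = `|x|.
Proof. by rewrite cmodE /= expr0n addr0 sqrtr_sqr. Qed.

Lemma cmod_eq0 z : (cmod z == 0) = (z == 0).
Proof.
apply/eqP/eqP => [|->]; last exact: cmod0.
exact: Normc.eq0_normc.
Qed.

Lemma ler_Re_cmod z : `|cRe z| <= cmod z.
Proof. by rewrite -lecR -normcE normc_ge_Re. Qed.

Lemma ler_Im_cmod z : `|cIm z| <= cmod z.
Proof. by rewrite cmodE -sqrtr_sqr ler_sqrt ?addr_ge0 ?sqr_ge0// lerDr sqr_ge0. Qed.

Lemma ler_cmod_ReIm z : cmod z <= `|cRe z| + `|cIm z|.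
Proof.
case: z => x y.
have e : x +i* y = x%:C + 'i * y%:C.
  by apply/eqP; rewrite eq_complex /=; apply/andP; split; apply/eqP; ring.
rewrite [X in cmod X]e; apply: (le_trans (ler_cmodD _ _)); rewrite cmodM !cmodR /= lerD2l.
by rewrite expr0n expr1n add0r sqrtr1 mul1r.
Qed.

Lemma ler_cmod_sum (I : Type) (s : seq I) (P : pred I) (F : I -> R[i]) :
  cmod (\sum_(i <- s | P i) F i) <= \sum_(i <- s | P i) cmod (F i).
Proof.
elim/big_ind2 : _ => [|x y u v xy uv|//]; first by rewrite cmod0.
by apply: (le_trans (ler_cmodD _ _)); exact: lerD.
Qed.

Lemma cReM z w : cRe (z * w) =
  cRe z * cRe w - cIm z * cIm w.
Proof. by case: z w => [? ?] [? ?]. Qed.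

Lemma cImM z w : cIm (z * w) =
  cRe z * cIm w + cIm z * cRe w.
Proof. by case: z w => [? ?] [? ?]. Qed.

Lemma cReD z w : cRe (z + w) = cRe z + cRe w.
Proof. by case: z w => [? ?] [? ?]. Qed.

Lemma cImD z w : cIm (z + w) = cIm z + cIm w.
Proof. by case: z w => [? ?] [? ?]. Qed.

Lemma cReN z : cRe (- z) = - cRe z.
Proof. by case: z. Qed.

Lemma cImN z : cIm (- z) = - cIm z.
Proof. by case: z. Qed.

Lemma cReB z w : cRe (z - w) = cRe z - cRe w.
Proof. by rewrite cReD cReN. Qed.

Lemma cImB z w : cIm (z - w) = cIm z - cIm w.
Proof. by rewrite cImD cImN. Qed.

Lemma complex_ext z w : cRe z = cRe w ->
  cIm z = cIm w -> z = w.
Proof. by case: z w => [? ?] [? ?] /= -> ->. Qed.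

Lemma cRe_nat (k : nat) : cRe (k%:R : R[i]) = k%:R.
Proof. by rewrite -(rmorph_nat (real_complex R)). Qed.

Lemma cIm_nat (k : nat) : cIm (k%:R : R[i]) = 0.
Proof. by rewrite -(rmorph_nat (real_complex R)). Qed.

(** A positive element of R[i] is real, so real radii suffice in the limits of the statement. *)
Lemma cvgC {T : Type} (F : set_system T) {FF : Filter F} (f : T -> R[i]) (l : R[i]) :
  ((f x : R[i]^o) @[x --> F] --> (l : R[i]^o)) <->
  (forall e : R, 0 < e -> \forall x \near F, cmod (f x - l) < e).
Proof.
split.
  move=> /(@cvgrPdist_lt (R[i]) (R[i]^o)) h e e0.
  have := h e%:C; rewrite ltcR => /(_ e0); apply: filterS => x.
  by rewrite -ltcR cmodB -normcE.
move=> h; apply/(@cvgrPdist_lt (R[i]) (R[i]^o)) => e e0.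
have eE : e = (cRe e)%:C.
  by move: e0; rewrite ltcE /= => /andP[/eqP ie _]; apply: complex_ext.
move: e0; rewrite eE ltcR => /h; apply: filterS => x.
by rewrite -ltcR cmodB -normcE.
Qed.

End Modulus.
Arguments cmod : simpl never.

(* R[i] carries no canonical pointed structure, hence no restriction [_ \_ _]. *)
Definition zext {T : Type} {R : realType} (D : set T) (f : T -> R[i]) : T -> R[i] :=
  patch (fun=> 0) D f.

Section ComplexIntegral.
Context {d : measure_display} {T : measurableType d} {R : realType}.
Variable mu : {measure set T -> \bar R}.
Implicit Types (D : set T) (f g : T -> R[i]).

Definition cmeas D f := measurable_fun D (fun x => cRe (f x)) /\
  measurable_fun D (fun x => cIm (f x)).

(** Stated for an arbitrary measure because Fubini's theorem needs product measures; for Lebesgue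
    measure, [cintble] and [cint] are convertible with [cintegrable] and [cintegral]. *)
Definition cintble D f := mu.-integrable D (EFin \o (fun x => cRe (f x))) /\
  mu.-integrable D (EFin \o (fun x => cIm (f x))).

Definition cint D f : R[i] :=
  (\int[mu]_(x in D) cRe (f x)) +i* (\int[mu]_(x in D) cIm (f x)).

Lemma Re_cint D f : cRe (cint D f) = \int[mu]_(x in D) cRe (f x).
Proof. by []. Qed.

Lemma Im_cint D f : cIm (cint D f) = \int[mu]_(x in D) cIm (f x).
Proof. by []. Qed.

Lemma eq_cint D f g : {in D, f =1 g} -> cint D f = cint D g.
Proof. by move=> fg; congr (_ +i* _); apply: eq_Rintegral => x xD; rewrite fg. Qed.

Lemma cmeas_cst D (c : R[i]) : cmeas D (fun=> c).
Proof. by split; exact: measurable_cst. Qed.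

Lemma cmeasD D f g : cmeas D f -> cmeas D g -> cmeas D (fun x => f x + g x).
Proof.
move=> [fr fi] [gr gi]; split.
- by under eq_fun do rewrite cReD; exact: measurable_funD.
- by under eq_fun do rewrite cImD; exact: measurable_funD.
Qed.

Lemma cmeasN D f : cmeas D f -> cmeas D (fun x => - f x).
Proof.
move=> [fr fi]; split.
- by under eq_fun do rewrite cReN; exact: measurableT_comp.
- by under eq_fun do rewrite cImN; exact: measurableT_comp.
Qed.

Lemma cmeasM D f g : cmeas D f -> cmeas D g -> cmeas D (fun x => f x * g x).
Proof.
move=> [fr fi] [gr gi]; split.
- by under eq_fun do rewrite cReM; apply: measurable_funB; exact: measurable_funM.
- by under eq_fun do rewrite cImM; apply: measurable_funD; exact: measurable_funM.
Qed.

Lemma cmeasS D E f : measurable E -> D `<=` E -> cmeas E f -> cmeas D f.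
Proof. by move=> mE DE [fr fi]; split; [exact: measurable_funS fr|exact: measurable_funS fi]. Qed.

Lemma cmeas_real D (f : T -> R) : measurable_fun D f -> cmeas D (fun x => (f x)%:C).
Proof. by move=> mf; split => //=; exact: measurable_cst. Qed.

Lemma cmeas_restrict D f : measurable D -> cmeas D f <-> cmeas [set: T] (zext D f).
Proof.
move=> mD.
have e1 : (fun x => cRe ((zext D f) x)) = (fun x => cRe (f x)) \_ D.
  by apply/funext => x; rewrite /zext /patch /=; case: ifPn => // _; reflexivity.
have e2 : (fun x => cIm ((zext D f) x)) = (fun x => cIm (f x)) \_ D.
  by apply/funext => x; rewrite /zext /patch /=; case: ifPn => // _; reflexivity.
rewrite /cmeas e1 e2; split=> -[h1 h2]; split.
- exact: (measurable_restrictT _ mD).1 h1.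
- exact: (measurable_restrictT _ mD).1 h2.
- exact: (measurable_restrictT _ mD).2 h1.
- exact: (measurable_restrictT _ mD).2 h2.
Qed.

Lemma measurable_cmod D f : cmeas D f -> measurable_fun D (fun x => cmod (f x)).
Proof.
move=> [fr fi]; under eq_fun do rewrite cmodE.
apply: (@measurableT_comp _ _ _ _ _ _ (@Num.sqrt R)).
  by apply: continuous_measurable_fun; exact: sqrt_continuous.
by apply: measurable_funD; exact: measurable_funX.
Qed.

Lemma cintble_meas D f : cintble D f -> cmeas D f.
Proof.
by move=> [/measurable_int/measurable_EFinP h1 /measurable_int/measurable_EFinP h2].
Qed.

(** Both directions rest on |Re z|, |Im z| <= |z| <= |Re z| + |Im z|. *)
Lemma cintbleP D f : measurable D -> cintble D f <->
  (cmeas D f /\ (\int[mu]_(x in D) (cmod (f x))%:E < +oo)%E).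
Proof.
move=> mD; split.
- move=> fi; have mf := cintble_meas fi; split => //.
  case: fi => f1 f2.
  have /integrableP[_] := integrableD mD (integrable_abse f1) (integrable_abse f2).
  apply: le_lt_trans; apply: ge0_le_integral => //.
  + by move=> x _; rewrite lee_fin cmod_ge0.
  + exact/measurable_EFinP/measurable_cmod.
  + apply: measurableT_comp => //; apply: emeasurable_funD; apply: measurableT_comp => //.
      by case: (f1) => /measurable_int.
    by case: (f2) => /measurable_int.
  + move=> x _ /=; rewrite lee_fin ger0_norm ?addr_ge0//.
    exact: ler_cmod_ReIm.
- move=> [mf ff]; have [m1 m2] := mf.
  split; apply/integrableP; split; try exact/measurable_EFinP.
  + apply: le_lt_trans ff; apply: ge0_le_integral => //.
    * by apply: measurableT_comp => //; exact/measurable_EFinP.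
    * exact/measurable_EFinP/measurable_cmod.
    * by move=> x _; rewrite lee_fin ler_Re_cmod.
  + apply: le_lt_trans ff; apply: ge0_le_integral => //.
    * by apply: measurableT_comp => //; exact/measurable_EFinP.
    * exact/measurable_EFinP/measurable_cmod.
    * by move=> x _; rewrite lee_fin ler_Im_cmod.
Qed.

Lemma cintble_cmod D f : measurable D -> cintble D f ->
  mu.-integrable D (EFin \o (fun x => cmod (f x))).
Proof.
move=> mD /(cintbleP f mD)[mf ff]; apply/integrableP; split.
  exact/measurable_EFinP/measurable_cmod.
by under eq_integral do rewrite /= ger0_norm ?cmod_ge0//.
Qed.

Lemma le_cintble D f (g : T -> R) : measurable D -> cmeas D f ->
  mu.-integrable D (EFin \o g) -> (forall x, D x -> cmod (f x) <= g x) ->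
  cintble D f.
Proof.
move=> mD mf /integrableP[mg ig] fg; apply/cintbleP => //; split => //.
apply: le_lt_trans ig; apply: ge0_le_integral => //.
- by move=> x _; rewrite lee_fin cmod_ge0.
- exact/measurable_EFinP/measurable_cmod.
- exact: measurableT_comp.
- by move=> x Dx; rewrite lee_fin (le_trans (fg _ Dx))// ler_norm.
Qed.

Lemma cintbleS D E f : measurable D -> measurable E -> D `<=` E ->
  cintble E f -> cintble D f.
Proof. by move=> mD mE DE [h1 h2]; split; [exact: integrableS h1|exact: integrableS h2]. Qed.

Lemma eq_cintble D f g : measurable D -> {in D, f =1 g} -> cintble D f -> cintble D g.
Proof.
move=> mD fg [h1 h2]; split.
- by apply: eq_integrable h1 => //= x xD; rewrite fg.
- by apply: eq_integrable h2 => //= x xD; rewrite fg.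
Qed.

Lemma cint_mkcond D f : cint D f = cint [set: T] (zext D f).
Proof.
congr (_ +i* _); rewrite Rintegral_mkcond; apply: eq_Rintegral => x _.
  by rewrite /zext /patch /=; case: ifPn => // _; reflexivity.
by rewrite /zext /patch /=; case: ifPn => // _; reflexivity.
Qed.

Lemma cintble_mkcond D f : measurable D -> cintble D f <-> cintble [set: T] (zext D f).
Proof.
move=> mD.
have e1 : EFin \o (fun x => cRe ((zext D f) x)) =
    (EFin \o (fun x => cRe (f x))) \_ D.
  by apply/funext => x; rewrite /zext /patch /=; case: ifPn => // _; reflexivity.
have e2 : EFin \o (fun x => cIm ((zext D f) x)) =
    (EFin \o (fun x => cIm (f x))) \_ D.
  by apply/funext => x; rewrite /zext /patch /=; case: ifPn => // _; reflexivity.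
rewrite /cintble e1 e2; split=> -[h1 h2]; split.
- exact: (integrable_mkcond _ mD).1 h1.
- exact: (integrable_mkcond _ mD).1 h2.
- exact: (integrable_mkcond _ mD).2 h1.
- exact: (integrable_mkcond _ mD).2 h2.
Qed.

Lemma cintble0 D : cintble D (fun=> 0).
Proof. by split; exact: integrable0. Qed.

Lemma cint0 D : cint D (fun=> 0) = 0.
Proof. by congr (_ +i* _); rewrite /Rintegral integral0. Qed.

Lemma cintbleD D f g : measurable D -> cintble D f -> cintble D g ->
  cintble D (fun x => f x + g x).
Proof.
move=> mD [f1 f2] [g1 g2]; split.
- by under eq_fun do rewrite cReD; exact: (integrableD mD f1 g1).
- by under eq_fun do rewrite cImD; exact: (integrableD mD f2 g2).
Qed.

Lemma cintD D f g : measurable D -> cintble D f -> cintble D g ->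
  cint D (fun x => f x + g x) = cint D f + cint D g.
Proof.
move=> mD [f1 f2] [g1 g2]; apply: complex_ext; rewrite ?cReD ?cImD /= -RintegralD//;
by apply: eq_Rintegral => x _; rewrite ?cReD ?cImD.
Qed.

Lemma cintbleZ D f (c : R[i]) : measurable D -> cintble D f ->
  cintble D (fun x => c * f x).
Proof.
move=> mD [f1 f2]; split.
- under eq_fun do rewrite cReM.
  by apply: (integrableB mD (integrableZl mD (cRe c) f1) (integrableZl mD (cIm c) f2)).
- under eq_fun do rewrite cImM.
  by apply: (integrableD mD (integrableZl mD (cRe c) f2) (integrableZl mD (cIm c) f1)).
Qed.

Lemma cintZ D f (c : R[i]) : measurable D -> cintble D f ->
  cint D (fun x => c * f x) = c * cint D f.
Proof.
move=> mD [f1 f2]; apply: complex_ext; rewrite ?cReM ?cImM /=.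
- rewrite -!RintegralZl// -RintegralB//.
  + by apply: eq_Rintegral => x _; rewrite cReM.
  + exact: (integrableZl mD (cRe c) f1).
  + exact: (integrableZl mD (cIm c) f2).
- rewrite -!RintegralZl// -RintegralD//.
  + by apply: eq_Rintegral => x _; rewrite cImM.
  + exact: (integrableZl mD (cRe c) f2).
  + exact: (integrableZl mD (cIm c) f1).
Qed.

Lemma cintbleN D f : measurable D -> cintble D f -> cintble D (fun x => - f x).
Proof. by move=> mD /(cintbleZ (-1) mD); under eq_fun do rewrite mulN1r. Qed.

Lemma cintN D f : measurable D -> cintble D f ->
  cint D (fun x => - f x) = - cint D f.
Proof.
move=> mD /(cintZ (-1) mD); rewrite mulN1r => <-.
by apply: eq_cint => x _; rewrite mulN1r.
Qed.

Lemma cintbleB D f g : measurable D -> cintble D f -> cintble D g ->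
  cintble D (fun x => f x - g x).
Proof. by move=> mD fi gi; apply: cintbleD => //; exact: cintbleN. Qed.

Lemma cintB D f g : measurable D -> cintble D f -> cintble D g ->
  cint D (fun x => f x - g x) = cint D f - cint D g.
Proof. by move=> mD fi gi; rewrite cintD// ?cintN//; exact: cintbleN. Qed.

Lemma cintble_sum D (I : Type) (s : seq I) (P : pred I) (f : I -> T -> R[i]) :
  measurable D -> (forall i, P i -> cintble D (f i)) ->
  cintble D (fun x => \sum_(i <- s | P i) f i x).
Proof.
move=> mD fi; elim: s => [|i s ih].
  by under eq_fun do rewrite big_nil; exact: cintble0.
under eq_fun do rewrite big_cons.
by case Pi : (P i) => //; apply: cintbleD => //; exact: fi.
Qed.

(* Rotating the integral onto the positive real axis. *)
Lemma le_cmod_cint D f : measurable D -> cintble D f ->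
  cmod (cint D f) <= \int[mu]_(x in D) cmod (f x).
Proof.
move=> mD fi; have [->|I0] := eqVneq (cint D f) 0.
  by rewrite cmod0; apply: Rintegral_ge0 => x _; exact: cmod_ge0.
have m0 : cmod (cint D f) != 0 by rewrite cmod_eq0.
pose c := (cmod (cint D f))%:C / cint D f.
have mc : cmod c = 1 by rewrite cmodM cmodV cmodR ger0_norm ?cmod_ge0// divff.
have -> : cmod (cint D f) = cRe (cint D (fun x => c * f x)).
  by rewrite cintZ// divfK.
rewrite Re_cint; apply: le_Rintegral => //.
- by case: (cintbleZ c mD fi).
- exact: cintble_cmod.
- move=> x _; apply: le_trans (ler_norm _) _.
  by apply: le_trans (ler_Re_cmod _) _; rewrite cmodM mc mul1r.
Qed.

Lemma le_cmod_cint_ge0 D f : measurable D -> cmeas D f ->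
  ((cmod (cint D f))%:E <= \int[mu]_(x in D) (cmod (f x))%:E)%E.
Proof.
move=> mD mf.
have [ff|] := ltP (\int[mu]_(x in D) (cmod (f x))%:E)%E +oo%E; last first.
  by rewrite leye_eq => /eqP ->; rewrite leey.
have fi : cintble D f by apply/cintbleP.
apply: (@le_trans _ _ (\int[mu]_(x in D) cmod (f x))%:E).
  by rewrite lee_fin le_cmod_cint.
rewrite /Rintegral fineK// ge0_fin_numE//.
by apply: integral_ge0 => x _; rewrite lee_fin cmod_ge0.
Qed.

Lemma ae_eq_cint D f g : measurable D -> cmeas D f -> cmeas D g ->
  ae_eq mu D f g -> cint D f = cint D g.
Proof.
move=> mD [f1 f2] [g1 g2] fg; congr (_ +i* _); congr fine; apply: ae_eq_integral => //.
- exact/measurable_EFinP.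
- exact/measurable_EFinP.
- by move: fg; apply: filterS => x h Dx; rewrite h.
- exact/measurable_EFinP.
- exact/measurable_EFinP.
- by move: fg; apply: filterS => x h Dx; rewrite h.
Qed.

End ComplexIntegral.

Section AlmostEverywhere.
Context {d : measure_display} {T : measurableType d} {R : realType}.
Variable mu : {measure set T -> \bar R}.
Implicit Types P Q S : T -> Prop.

Lemma ae_imp P Q : {ae mu, forall x, P x} -> (forall x, P x -> Q x) ->
  {ae mu, forall x, Q x}.
Proof.
by move=> h PQ; apply: filterS h => //; exact: (ae_filter_ringOfSetsType mu).
Qed.

Lemma ae_imp2 P Q S : {ae mu, forall x, P x} -> {ae mu, forall x, Q x} ->
  (forall x, P x -> Q x -> S x) -> {ae mu, forall x, S x}.
Proof.
by move=> h1 h2 PQS; apply: filterS2 h1 h2 => //; exact: (ae_filter_ringOfSetsType mu).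
Qed.

Lemma ae_forall (I : finType) (P : I -> T -> Prop) :
  (forall i, {ae mu, forall x, P i x}) -> {ae mu, forall x, forall i, P i x}.
Proof.
move=> h; have H := ae_filter_ringOfSetsType mu.
exact: (@filter_forall _ _ _ _ H).
Qed.

Lemma aeW P : (forall x, P x) -> {ae mu, forall x, P x}.
Proof. by move=> h; have H := ae_filter_ringOfSetsType mu; exact: nearW. Qed.

Lemma ae_conj P Q : {ae mu, forall x, P x} -> {ae mu, forall x, Q x} ->
  {ae mu, forall x, P x /\ Q x}.
Proof. by move=> h1 h2; apply: (ae_imp2 h1 h2). Qed.

End AlmostEverywhere.

(** * Fubini's theorem for complex-valued functions *)

Section FineIntegral.
Context {d : measure_display} {T : measurableType d} {R : realType}.
Variable mu : {measure set T -> \bar R}.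
Implicit Types (g : T -> \bar R).

(** Fubini's theorem speaks of the inner integral in the extended reals, [cint] of its [fine], which
    is 0 where that integral is infinite; for an integrable function this concerns a null set
    only. *)
Lemma integrable_fine g : mu.-integrable [set: T] g ->
  mu.-integrable [set: T] (EFin \o (fun x => fine (g x))).
Proof.
move=> gi; apply: (le_integrable _ _ _ gi) => //.
- apply/measurable_EFinP/measurableT_comp => //; exact: measurable_int gi.
- move=> x _; rewrite [X in (X <= _)%E]/=; case: (g x) => [r| |] //=; by rewrite normr0 leey.
Qed.

Lemma Rintegral_fine g : mu.-integrable [set: T] g ->
  \int[mu]_x fine (g x) = fine (\int[mu]_x g x)%E.
Proof.
move=> gi; congr fine; apply: ae_eq_integral => //.
- by have /measurable_int := integrable_fine gi.
- exact: measurable_int gi.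
- have := integrable_ae measurableT gi; apply: filterS => x gx _.
  by rewrite fineK// gx.
Qed.

End FineIntegral.

(** Counterpart of [integrable_fubini_F] for the other order of integration: the modulus of the
    inner integral is at most the inner integral of the modulus, which Tonelli controls. *)
Lemma integrable_fubini_G {d1 d2 : measure_display} {T1 : measurableType d1}
    {T2 : measurableType d2} {R : realType}
    (m1 : {sigma_finite_measure set T1 -> \bar R})
    (m2 : {sigma_finite_measure set T2 -> \bar R}) (f : T1 * T2 -> \bar R) :
  (m1 \x m2)%E.-integrable setT f -> m2.-integrable setT (fubini_G m1 f).
Proof.
move=> fi; have mf := measurable_int _ fi; apply/integrableP; split.
  exact: measurable_fubini_G fi.
have := (integrable21ltyP m1 m2 mf).1 fi; apply: le_lt_trans.
have maf : measurable_fun setT (fun z => `|f z|)%E by exact: measurableT_comp.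
apply: ge0_le_integral => //.
- by apply: measurableT_comp => //; exact: measurable_fubini_G fi.
- exact: (measurable_fun_fubini_tonelli_G (fun z => `|f z|)%E).
- move=> y _; apply: le_abse_integral => //.
  exact: (measurableT_comp mf (pair2_measurable y)).
Qed.

Section ComplexFubini.
Context {d1 d2 : measure_display} {T1 : measurableType d1} {T2 : measurableType d2}.
Context {R : realType}.
Variables (m1 : {sigma_finite_measure set T1 -> \bar R})
          (m2 : {sigma_finite_measure set T2 -> \bar R}).
Variable F : T1 * T2 -> R[i].
Hypothesis mF : cmeas setT F.
Hypothesis finF : (\int[m1]_x \int[m2]_y (cmod (F (x, y)))%:E < +oo)%E.

Lemma cintble_prod : cintble (m1 \x m2)%E setT F.
Proof.
apply/cintbleP => //; split => //; rewrite fubini_tonelli1//.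
- exact/measurable_EFinP/measurable_cmod.
- by move=> x; rewrite lee_fin cmod_ge0.
Qed.

Lemma ae_cintble1 : {ae m1, forall x, cintble m2 setT (fun y => F (x, y))}.
Proof.
have [h1 h2] := cintble_prod.
by have := ae_integrable1 h2; apply: filterS2 (ae_integrable1 h1) => x.
Qed.

Lemma cintble_fubini1 : cintble m1 setT (fun x => cint m2 setT (fun y => F (x, y))).
Proof.
have [h1 h2] := cintble_prod.
split.
- exact: integrable_fine (integrable_fubini_F h1).
- exact: integrable_fine (integrable_fubini_F h2).
Qed.

Lemma ae_cintble2 : {ae m2, forall y, cintble m1 setT (fun x => F (x, y))}.
Proof.
have [h1 h2] := cintble_prod.
by have := ae_integrable2 h2; apply: filterS2 (ae_integrable2 h1) => x.
Qed.

Lemma cintble_fubini2 : cintble m2 setT (fun y => cint m1 setT (fun x => F (x, y))).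
Proof.
have [h1 h2] := cintble_prod.
split.
- exact: integrable_fine (integrable_fubini_G h1).
- exact: integrable_fine (integrable_fubini_G h2).
Qed.

Lemma cint_prod1 : cint m1 setT (fun x => cint m2 setT (fun y => F (x, y))) =
  cint (m1 \x m2)%E setT F.
Proof.
have [h1 h2] := cintble_prod.
congr (_ +i* _).
- rewrite (Rintegral_fine (integrable_fubini_F h1)); congr fine.
  exact: integral12_prod_meas1.
- rewrite (Rintegral_fine (integrable_fubini_F h2)); congr fine.
  exact: integral12_prod_meas1.
Qed.

Lemma cint_prod2 : cint m2 setT (fun y => cint m1 setT (fun x => F (x, y))) =
  cint (m1 \x m2)%E setT F.
Proof.
have [h1 h2] := cintble_prod.
congr (_ +i* _).
- rewrite (Rintegral_fine (integrable_fubini_G h1)); congr fine.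
  exact: integral21_prod_meas1.
- rewrite (Rintegral_fine (integrable_fubini_G h2)); congr fine.
  exact: integral21_prod_meas1.
Qed.

Lemma cint_fubini : cint m1 setT (fun x => cint m2 setT (fun y => F (x, y))) =
  cint m2 setT (fun y => cint m1 setT (fun x => F (x, y))).
Proof. by rewrite cint_prod1 cint_prod2. Qed.

End ComplexFubini.

Lemma cmeas_comp {d1 d2 : measure_display} {T1 : measurableType d1}
    {T2 : measurableType d2} {R : realType} (f : T2 -> R[i]) (phi : T1 -> T2) :
  measurable_fun setT phi -> cmeas setT f -> cmeas setT (fun x => f (phi x)).
Proof.
move=> mphi [f1 f2]; split.
- exact: (measurableT_comp f1 mphi).
- exact: (measurableT_comp f2 mphi).
Qed.

(** * Affine substitutions in Lebesgue integrals *)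

Section Affine.
Context {R : realType}.
Local Notation mu := (@lebesgue_measure R).
Variables (c : R) (e : R).
Hypothesis c0 : 0 < c.

Let phi : measurableTypeR R -> measurableTypeR R := fun t => c * t + e.

Let mphi : measurable_fun setT phi.
Proof. by apply: measurable_funD => //; exact: measurable_funM. Qed.

Let c0' : 0 <= c. Proof. exact: ltW. Qed.

Let nu : {measure set (measurableTypeR R) -> \bar R} :=
  measure_function_pushforward__canonical__measure_function_Measure mu mphi.

(** The rescaled image measure agrees with interval length on half-open intervals, and this
    characterises Lebesgue measure. *)
Lemma lebesgue_measure_affine (A : set R) : measurable A ->
  mu A = mscale (NngNum c0') nu A.
Proof.
move=> mA; apply: lebesgue_measure_unique => //= _ [[a b]] _ <-.
rewrite /mscale /= /pushforward.
have -> : phi @^-1` `]a, b]%classic = `](a - e) / c, (b - e) / c]%classic.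
  apply/seteqP; split => x /=; rewrite /phi !in_itv /=;
  by rewrite ltr_pdivrMr// ler_pdivlMr// ltrBlDr lerBrDr mulrC.
rewrite !lebesgue_measure_itv /= !lte_fin ltr_pM2r ?invr_gt0// ltrD2r.
case: ifPn => _; rewrite ?mule0// -!EFinB -EFinM; congr EFin.
by field; rewrite gt_eqF.
Qed.

Lemma ge0_integral_affine (f : R -> \bar R) : measurable_fun [set: R] f ->
  (forall x, 0 <= f x)%E ->
  (\int[mu]_x f x = c%:E * \int[mu]_x f (c * x + e)%R)%E.
Proof.
move=> mf f0.
rewrite (eq_measure_integral (mscale (NngNum c0') nu)); last first.
  by move=> A mA _; exact: lebesgue_measure_affine.
by rewrite ge0_integral_mscale//= (ge0_integral_pushforward mphi).
Qed.

Lemma integral_affine (f : R -> \bar R) : measurable_fun [set: R] f ->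
  mu.-integrable setT (fun x => f (c * x + e)%R) ->
  (\int[mu]_x f x = c%:E * \int[mu]_x f (c * x + e)%R)%E.
Proof.
move=> mf fi; rewrite integralE.
rewrite (ge0_integral_affine (measurable_funepos mf))// (ge0_integral_affine (measurable_funeneg mf))//.
rewrite [X in _ = (c%:E * X)%E]integralE (muleBr (x := c%:E) _ (integrable_add_def measurableT fi))//.
congr (_ * _ - _ * _)%E; apply: eq_integral => x _; by rewrite ?funeposE ?funenegE.
Qed.

Lemma cintble_affine (f : R -> R[i]) : cmeas [set: R] f ->
  cintble mu setT (fun x => f (c * x + e)) <-> cintble mu setT f.
Proof.
move=> mf.
have mf' : cmeas [set: R] (fun x => f (c * x + e)) by exact: (cmeas_comp mphi mf).
have m1 : measurable_fun [set: R] (fun x => (cmod (f x))%:E).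
  exact/measurable_EFinP/measurable_cmod.
have := @ge0_integral_affine (fun x => (cmod (f x))%:E) m1.
move=> /(_ (fun x => cmod_ge0 _)) E.
split=> /(cintbleP _ _ measurableT)[_ fin]; apply/cintbleP => //; split => //.
- by rewrite E lte_mul_pinfty.
- move: fin; rewrite E; case: (\int[mu]_x _)%E => [r| |] //=; first by move=> _; rewrite ltry.
  by rewrite gt0_muley ?lte_fin.
Qed.

Lemma cint_affine (f : R -> R[i]) : cintble mu setT f ->
  cint mu setT f = c%:C * cint mu setT (fun x => f (c * x + e)).
Proof.
move=> fi; have [mf1 mf2] := cintble_meas fi.
have [f1 f2] := (cintble_affine (cintble_meas fi)).2 fi.
apply: complex_ext; rewrite ?cReM ?cImM /= mul0r ?subr0 ?addr0.
- rewrite {1}/Rintegral integral_affine//; first by rewrite fineM// integrable_fin_num.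
  exact/measurable_EFinP.
- rewrite {1}/Rintegral integral_affine//; first by rewrite fineM// integrable_fin_num.
  exact/measurable_EFinP.
Qed.

End Affine.

Section Translation.
Context {R : realType}.
Local Notation mu := (@lebesgue_measure R).

Lemma ge0_integral_shift (e : R) (f : R -> \bar R) : measurable_fun [set: R] f ->
  (forall x, 0 <= f x)%E -> (\int[mu]_x f (x - e)%R = \int[mu]_x f x)%E.
Proof.
move=> mf f0; rewrite [RHS](ge0_integral_affine (- e) ltr01)// mul1e.
by under [RHS]eq_integral do rewrite mul1r.
Qed.

Lemma cintble_shift (e : R) (f : R -> R[i]) : cmeas [set: R] f ->
  cintble mu setT (fun x => f (x - e)) <-> cintble mu setT f.
Proof.
by move=> /(cintble_affine (- e) ltr01); under eq_fun do rewrite mul1r.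
Qed.

Lemma cint_shift (e : R) (f : R -> R[i]) : cintble mu setT f ->
  cint mu setT (fun x => f (x - e)) = cint mu setT f.
Proof.
move=> /(cint_affine (- e) ltr01) ->; rewrite mul1r.
by apply: eq_cint => x _; rewrite mul1r.
Qed.

End Translation.

(** * Convolution on the real line *)

Section Convolution.
Context {R : realType}.
Local Notation mu := (@lebesgue_measure R).
Local Notation L1 := (cintble mu setT).
Local Notation RxR := (measurableTypeR R * measurableTypeR R)%type.
Implicit Types (k q f : R -> R[i]).

(** When x is integrated first, translation invariance makes the inner integral independent of t. *)
Lemma conv_tonelli (F G : R -> \bar R) : measurable_fun [set: R] F ->
  measurable_fun [set: R] G -> (forall x, 0 <= F x)%E -> (forall x, 0 <= G x)%E ->
  (\int[mu]_x \int[mu]_t (F (x - t)%R * G t) = (\int[mu]_x F x) * \int[mu]_x G x)%E.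
Proof.
move=> mF mG F0 G0.
have := @fubini_tonelli _ _ _ _ _ mu mu (fun z => F (z.1 - z.2)%R * G z.2)%E.
move=> /= ->.
- under eq_integral => t _.
    rewrite ge0_integralZr//; last first.
      by apply: (measurableT_comp mF); apply: measurable_funB.
    rewrite ge0_integral_shift//; over.
  by rewrite ge0_integralZl// integral_ge0.
- apply: emeasurable_funM.
    by apply: (measurableT_comp mF); apply: measurable_funB.
  exact: (measurableT_comp mG).
- by move=> x; rewrite mule_ge0.
Qed.

Definition conv k f (x : R) : R[i] := cint mu setT (fun t => k (x - t) * f t).

Lemma cmeas_conv2 k f : cmeas [set: R] k -> cmeas [set: R] f ->
  cmeas setT (fun z : RxR => k (z.1 - z.2) * f z.2).
Proof.
move=> mk mf; apply: cmeasM.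
- by apply: (cmeas_comp (phi := fun z : RxR => z.1 - z.2) _ mk); apply: measurable_funB.
- exact: (cmeas_comp _ mf).
Qed.

Lemma conv_fin k f : L1 k -> L1 f ->
  (\int[mu]_x \int[mu]_t (cmod (k (x - t) * f t))%:E < +oo)%E.
Proof.
move=> /(cintbleP _ _ measurableT)[mk kfin] /(cintbleP _ _ measurableT)[mf ffin].
under eq_integral do under eq_integral do rewrite cmodM EFinM.
rewrite (conv_tonelli (F := fun x => (cmod (k x))%:E) (G := fun x => (cmod (f x))%:E)).
- by rewrite lte_mul_pinfty ?integral_ge0 ?ge0_fin_numE ?integral_ge0// => x _; rewrite lee_fin cmod_ge0.
- exact/measurable_EFinP/measurable_cmod.
- exact/measurable_EFinP/measurable_cmod.
- by move=> x; rewrite lee_fin cmod_ge0.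
- by move=> x; rewrite lee_fin cmod_ge0.
Qed.

Lemma ae_cintble_conv k f : L1 k -> L1 f ->
  {ae mu, forall x, L1 (fun t => k (x - t) * f t)}.
Proof.
move=> ki fi.
exact: (ae_cintble1 (cmeas_conv2 (cintble_meas ki) (cintble_meas fi)) (conv_fin ki fi)).
Qed.

Lemma cintble_conv k f : L1 k -> L1 f -> L1 (conv k f).
Proof.
move=> ki fi.
exact: (cintble_fubini1 (cmeas_conv2 (cintble_meas ki) (cintble_meas fi)) (conv_fin ki fi)).
Qed.

Lemma cint_conv k f : L1 k -> L1 f -> cint mu setT (conv k f) = cint mu setT k * cint mu setT f.
Proof.
move=> ki fi.
rewrite /conv (cint_fubini (cmeas_conv2 (cintble_meas ki) (cintble_meas fi)) (conv_fin ki fi)) /=.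
transitivity (cint mu setT (fun t => cint mu setT k * f t)); last by rewrite cintZ.
apply: eq_cint => t _.
rewrite -(cint_shift t ki) mulrC -cintZ//; last exact: (cintble_shift t (cintble_meas ki)).2.
by apply: eq_cint => x _; rewrite mulrC.
Qed.

(** Fubini is applied in (t, s) at a fixed x, which needs absolute integrability of the product of
    the three factors at that x. By Tonelli the convolution of |k| with |q| conv |f| has a finite
    integral, so it is finite at almost every x, and only there is equality claimed. *)
Lemma conv_assoc k q f : L1 k -> L1 q -> L1 f ->
  {ae mu, forall x, conv k (conv q f) x = conv (conv k q) f x}.
Proof.
move=> ki qi fi.
have mk := cintble_meas ki; have mq := cintble_meas qi; have mf := cintble_meas fi.
pose A (h : R -> R[i]) (x : R) := (cmod (h x))%:E : \bar R.
have mA (h : R -> R[i]) : cmeas [set: R] h -> measurable_fun [set: R] (A h).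
  by move=> mh; exact/measurable_EFinP/measurable_cmod.
have A0 (h : R -> R[i]) x : (0 <= A h x)%E by rewrite lee_fin cmod_ge0.
pose H t := (\int[mu]_s (A q (t - s)%R * A f s))%E.
have mH : measurable_fun [set: R] H.
  apply: (measurable_fun_fubini_tonelli_F (fun z : RxR => (A q (z.1 - z.2)%R * A f z.2)%E)).
    apply: emeasurable_funM.
      by apply: (measurableT_comp (mA _ mq)); apply: measurable_funB.
    exact: (measurableT_comp (mA _ mf)).
  by move=> x; rewrite mule_ge0.
have H0 t : (0 <= H t)%E by apply: integral_ge0 => s _; rewrite mule_ge0.
have Hfin : (\int[mu]_t H t < +oo)%E.
  have := conv_fin qi fi.
  by under eq_integral do under eq_integral do rewrite cmodM EFinM.
have fin : (\int[mu]_x \int[mu]_t (A k (x - t)%R * H t) < +oo)%E.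
  rewrite conv_tonelli//; last exact: mA.
  have [_ kfin] := (cintbleP _ _ measurableT).1 ki.
  by rewrite lte_mul_pinfty// ?integral_ge0// ge0_fin_numE// integral_ge0.
have : {ae mu, forall x, (\int[mu]_t (A k (x - t)%R * H t) \is a fin_num)%E}.
  have [|] := @integrable_ae _ _ _ mu setT measurableT (fun x => \int[mu]_t (A k (x - t)%R * H t))%E; last first.
    by move=> N [mN N0 h]; exists N; split => // x hx; apply: h => /= h; apply: hx; exact: h.
  apply/integrableP; split.
    apply: (measurable_fun_fubini_tonelli_F (fun z : RxR => (A k (z.1 - z.2)%R * H z.2)%E)).
      apply: emeasurable_funM.
        by apply: (measurableT_comp (mA _ mk)); apply: measurable_funB.
      exact: (measurableT_comp mH).
    by move=> x; rewrite mule_ge0.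
  move: fin; congr (_ < _)%E; apply: eq_integral => x _.
  by rewrite gee0_abs// integral_ge0// => t _; rewrite mule_ge0.
move=> /ae_imp; apply => x xfin.
pose G (z : RxR) := k (x - z.1) * (q (z.1 - z.2) * f z.2).
have mG : cmeas setT G.
  apply: cmeasM; last exact: cmeas_conv2.
  by apply: (cmeas_comp (phi := fun z : RxR => x - z.1) _ mk); apply: measurable_funB.
have Gfin : (\int[mu]_t \int[mu]_s (cmod (G (t, s)))%:E < +oo)%E.
  apply: le_lt_trans (_ : \int[mu]_t (A k (x - t)%R * H t) < +oo)%E.
    apply: ge0_le_integral => //.
    - by move=> t _; apply: integral_ge0 => s _; rewrite lee_fin cmod_ge0.
    - apply: (measurable_fun_fubini_tonelli_F (fun z => (cmod (G z))%:E)).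
        exact/measurable_EFinP/measurable_cmod.
      by move=> z; rewrite lee_fin cmod_ge0.
    - apply: emeasurable_funM => //.
      by apply: (measurableT_comp (mA _ mk)); apply: measurable_funB.
    - move=> t _; rewrite /H -ge0_integralZl//.
      + by rewrite le_eqVlt; apply/orP; left; apply/eqP/eq_integral => s _; rewrite /G /= !cmodM !EFinM.
      + apply: emeasurable_funM; last exact: mA.
        by apply: (measurableT_comp (mA _ mq)); apply: measurable_funB.
      + by move=> s _; rewrite mule_ge0.
  by rewrite -ge0_fin_numE// integral_ge0// => t _; rewrite mule_ge0.
have eq1 : {ae mu, forall t, cint mu setT (fun s => G (t, s)) = k (x - t) * conv q f t}.
  apply: (ae_imp (ae_cintble_conv qi fi)) => t qt.
  by rewrite /G /= cintZ.
have e1 : cint mu setT (fun t => cint mu setT (fun s => G (t, s))) = conv k (conv q f) x.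
  apply: ae_eq_cint => //.
  - exact: cintble_meas (cintble_fubini1 mG Gfin).
  - apply: cmeasM; last exact: (cintble_meas (cintble_conv qi fi)).
    by apply: (cmeas_comp (phi := fun z : measurableTypeR R => x - z) _ mk); apply: measurable_funB.
  - by apply: (ae_imp eq1) => t ->.
rewrite -e1 (cint_fubini mG Gfin).
apply: ae_eq_cint => //.
- have := cintble_fubini2 mG Gfin; exact: cintble_meas.
- apply: cmeasM => //; have mkq := cintble_meas (cintble_conv ki qi).
  by apply: (cmeas_comp (phi := fun z : measurableTypeR R => x - z) _ mkq); apply: measurable_funB.
apply: (ae_imp (ae_cintble2 mG Gfin)) => s Gs _.
(* Integrability of [G] in t says nothing about k and q where f s = 0; both sides vanish there, and
   elsewhere division by f s is possible. *)
have [fs0|fs0] := eqVneq (f s) 0.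
  by rewrite fs0 mulr0 -[RHS](cint0 mu setT); apply: eq_cint => t _; rewrite /G /= fs0 !mulr0.
have kqs : L1 (fun t => k (x - t) * q (t - s)).
  have := cintbleZ (f s)^-1 measurableT Gs; apply: eq_cintble => // t _.
  by rewrite /G /=; field.
have kqi : L1 (fun t => k (x - s - t) * q t).
  apply/(cintble_shift s); first last.
    by under eq_fun do rewrite opprB addrA subrK.
  apply: cmeasM => //.
  by apply: (cmeas_comp (phi := fun z : measurableTypeR R => x - s - z) _ mk); apply: measurable_funB.
transitivity (cint mu setT (fun t => f s * (k (x - t) * q (t - s)))).
  by apply: eq_cint => t _; rewrite /G /=; ring.
rewrite cintZ// mulrC; congr (_ * _); rewrite /conv -(cint_shift s kqi).
by apply: eq_cint => t _; rewrite opprB addrA subrK.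
Qed.

End Convolution.

(** * The Gamma function *)

Section ComplexPower.
Context {R : realType}.
Implicit Types (x y : R) (z w : R[i]).

Lemma cmod_cpow x z : cmod (cpow x z) = x `^ cRe z.
Proof.
rewrite /cpow cmodM cmodR ger0_norm ?powR_ge0// cmodE /=.
by rewrite cos2Dsin2 sqrtr1 mulr1.
Qed.

Lemma cpowD x z w : 0 < x -> cpow x (z + w) = cpow x z * cpow x w.
Proof.
move=> x0; rewrite /cpow cReD cImD powRD; last by rewrite (gt_eqF x0) implybT.
rewrite mulrDl cosD sinD.
by apply: complex_ext; rewrite ?(cReM, cImM) /=; ring.
Qed.

Lemma cpowM x y z : 0 < x -> 0 < y -> cpow (x * y) z = cpow x z * cpow y z.
Proof.
move=> x0 y0; rewrite /cpow powRM ?ltW// lnM ?posrE// mulrDr cosD sinD.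
by apply: complex_ext; rewrite ?(cReM, cImM) /=; ring.
Qed.

Lemma cpowr0 x : cpow x 0 = 1.
Proof.
rewrite /cpow /= powRr0 mul0r cos0 sin0.
by apply: complex_ext; rewrite ?cReM ?cImM /=; ring.
Qed.

Lemma cpowR x (r : R) : cpow x r%:C = (x `^ r)%:C.
Proof.
rewrite /cpow /= mul0r cos0 sin0.
by apply: complex_ext; rewrite ?cReM ?cImM /=; ring.
Qed.

Lemma cpow_nat x (k : nat) : 0 <= x -> cpow x k%:R = (x ^+ k)%:C.
Proof.
move=> x0; rewrite -(rmorph_nat (real_complex R)) /=.
by rewrite cpowR powR_mulrn.
Qed.

Lemma cpowS x z : 0 < x -> cpow x (z + 1) = x%:C * cpow x z.
Proof.
by move=> x0; rewrite cpowD// mulrC -[1]/(1%:R) cpow_nat ?ltW// expr1.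
Qed.

Lemma cpow1 z : cpow 1 z = 1.
Proof.
rewrite /cpow ln1 mulr0 cos0 sin0 powR1.
by apply: complex_ext; rewrite ?cReM ?cImM /=; ring.
Qed.

Lemma measurable_cpow z : cmeas [set: R] (fun x : R => cpow x z).
Proof.
have ml : measurable_fun [set: R] (fun x : R => cIm z * @ln R x).
  by apply: measurable_funM => //; exact: measurable_ln.
apply: cmeasM.
  by apply: cmeas_real; exact: measurable_powR.
split=> /=.
- apply: (@measurableT_comp _ _ _ _ _ _ (@cos R)) => //.
  by apply: continuous_measurable_fun; exact: continuous_cos.
- apply: (@measurableT_comp _ _ _ _ _ _ (@sin R)) => //.
  by apply: continuous_measurable_fun; exact: continuous_sin.
Qed.

End ComplexPower.

Section PowerIntegral.
Context {R : realType}.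
Local Notation mu := (@lebesgue_measure R).

(** The integrand is unbounded at 0 when r < 1, so the fundamental theorem of calculus is applied on
    [x / (k + 1), x] and monotone convergence yields the limit. *)
Lemma integral_powR (r x : R) : 0 < r -> 0 < x ->
  (\int[mu]_(t in `]0%R, x]) (t `^ (r - 1))%:E = (x `^ r / r)%:E)%E.
Proof.
move=> r0 x0.
pose F (k : nat) : set (measurableTypeR R) := `[x / k.+1%:R, x]%classic.
have F0 (k : nat) : 0 < x / k.+1%:R by rewrite divr_gt0.
have FE : \bigcup_k F k = `]0, x]%classic.
  apply/seteqP; split=> t.
    by move=> [k _] /=; rewrite /F/= !in_itv/= => /andP[h ->]; rewrite (lt_le_trans (F0 k) h).
  rewrite /= in_itv/= => /andP[t0 tx]; exists (Num.truncn (x / t)) => //.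
  rewrite /F/= in_itv/= tx andbT ler_pdivrMr// mulrC -ler_pdivrMr//.
  by rewrite ltW// truncnS_gt.
have nd : {homo F : n m / (n <= m)%N >-> (n <= m)%O}.
  move=> p q pq; apply/subsetPset => t; rewrite /F/= !in_itv/= => /andP[h ->]; rewrite andbT.
  by apply: le_trans h; rewrite ler_pM2l// lef_pV2 ?posrE// ler_nat ltnS.
have := @ge0_nondecreasing_set_cvg_integral _ (measurableTypeR R) _ F (fun t => (t `^ (r - 1))%:E) mu nd.
rewrite FE => h.
apply: (cvg_unique _ (h _ _ _)) => //.
- by move=> i; exact: measurable_itv.
- by move=> i; apply/measurable_EFinP/measurable_funTS; exact: measurable_powR.
- by move=> i t _; rewrite lee_fin powR_ge0.
clear h.
have e k : (\int[mu]_(t in F k) (t `^ (r - 1))%:E = (x `^ r / r)%:E - ((x / k.+1%:R) `^ r / r)%:E)%E.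
  (* [F 0] is the single point x, a degenerate interval to which the fundamental theorem does not
     apply. *)
  case: k => [|k].
    by rewrite /F divr1 set_itv1 integral_set1 subee.
  have lt : x / k.+2%:R < x by rewrite ltr_pdivrMr// ltr_pMr// ltr1n.
  have der (t : R) : 0 < t -> is_derive t (1:R) (fun t : R => t `^ r / r) (t `^ (r - 1)).
    move=> t0; have := is_derive1_powR r t0 => D.
    have := is_deriveZ r^-1 D.
    rewrite /GRing.scale /= mulrA mulVf ?gt_eqF// mul1r.
    by congr is_derive; apply/funext => u /=; rewrite mulrC.
  rewrite (@continuous_FTC2 _ _ (fun t => t `^ r / r))//.
  - apply: continuous_in_subspaceT => t; rewrite inE/= in_itv/= => /andP[h _].
    have t0 : 0 < t by apply: lt_le_trans h; exact: F0.
    apply: differentiable_continuous; apply/derivable1_diffP.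
    by have [] := is_derive1_powR (r - 1) t0.
  - have cont (t : R) : 0 < t -> {for t, continuous (fun t : R => t `^ r / r)}.
      move=> t0; apply: differentiable_continuous; apply/derivable1_diffP.
      by have [] := der _ t0.
    split.
    + move=> t; rewrite in_itv/= => /andP[h _].
      by have [] := der _ (lt_trans (F0 _) h).
    + exact/cvg_at_right_filter/cont.
    + exact/cvg_at_left_filter/cont.
  - move=> t; rewrite in_itv/= => /andP[h _].
    by rewrite derive1E; have [_] := der _ (lt_trans (F0 _) h).
rewrite /mkset (_ : (fun i => _) = (fun k => (x `^ r / r)%:E - ((x / k.+1%:R) `^ r / r)%:E)%E); last exact/funext.
rewrite -[X in _ --> X]sube0; apply: cvgeB => //; first exact: cvg_cst.
apply: cvg_EFin; first exact: nearW.
rewrite -[X in _ --> X](mul0r r^-1); apply: cvgM; last exact: cvg_cst.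
have /cvg_at_rightP := powR_cvg0 r0.
apply; split => //; rewrite -[X in _ --> X](mulr0 x).
by apply: cvgM; [exact: cvg_cst|exact: cvg_harmonic].
Qed.

End PowerIntegral.

(** * The Gamma integral and the convolution of power kernels *)

Section GammaKernel.
Context {R : realType}.
Local Notation mu := (@lebesgue_measure R).
Local Notation L1 := (cintble mu setT).

(** The modulus of [ker]. One family, extended by 0 to t <= 0, contains the Riemann-Liouville kernel
    (lam = 0), the Gamma integrand (lam = 1) and the kernel conjugated by an exponential weight (lam
    > 0). *)
Definition rker (lam r t : R) : R :=
  if 0 < t then t `^ (r - 1) * expR (- (lam * t)) else 0.

Definition ker (lam : R) (p : R[i]) (t : R) : R[i] :=
  if 0 < t then cpow t (p - 1) * (expR (- (lam * t)))%:C else 0.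

Lemma cmod_ker lam p t : cmod (ker lam p t) = rker lam (cRe p) t.
Proof.
rewrite /ker /rker; case: ifP => _; last exact: cmod0.
by rewrite cmodM cmod_cpow cmodR ger0_norm ?expR_ge0// cReB.
Qed.

Lemma rker_ge0 lam r t : 0 <= rker lam r t.
Proof. by rewrite /rker; case: ifP => // _; rewrite mulr_ge0 ?powR_ge0 ?expR_ge0. Qed.

Lemma measurable_rker lam r : measurable_fun [set: R] (rker lam r).
Proof.
apply: measurable_fun_ifT.
- by apply: measurable_fun_ltr.
- apply: measurable_funM; first exact: measurable_powR.
  apply: measurableT_comp; first exact: measurable_expR.
  by apply: measurableT_comp => //; exact: measurable_funM.
- exact: measurable_cst.
Qed.

Lemma cmeas_ifT {d : measure_display} {T : measurableType d} (b : T -> bool) (f g : T -> R[i]) :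
  measurable_fun setT b -> cmeas setT f -> cmeas setT g ->
  cmeas setT (fun x => if b x then f x else g x).
Proof.
move=> mb [f1 f2] [g1 g2]; split.
- rewrite (_ : (fun x => _) = fun x => if b x then cRe (f x) else cRe (g x)).
    exact: measurable_fun_ifT.
  by apply/funext => x; case: ifP.
- rewrite (_ : (fun x => _) = fun x => if b x then cIm (f x) else cIm (g x)).
    exact: measurable_fun_ifT.
  by apply/funext => x; case: ifP.
Qed.

Lemma measurable_ker lam p : cmeas [set: R] (ker lam p).
Proof.
apply: cmeas_ifT; [by apply: measurable_fun_ltr| |exact: cmeas_cst].
apply: cmeasM; first exact: measurable_cpow.
apply: cmeas_real; apply: measurableT_comp; first exact: measurable_expR.
by apply: measurableT_comp => //; exact: measurable_funM.
Qed.

(** The real Gamma function, kept in the extended reals so that its recursion can be proved before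
    its finiteness and then used for it. *)
Definition rgamma (r : R) : \bar R := (\int[mu]_t (rker 1 r t)%:E)%E.

Lemma rgamma_ge0 r : (0 <= rgamma r)%E.
Proof. by apply: integral_ge0 => t _; rewrite lee_fin rker_ge0. Qed.

(** Except at 0, the kernel is the density of the exponential law of rate 1. *)
Lemma rgamma1 : rgamma 1 = 1%E.
Proof.
rewrite -(@integral_exponential_pdf R 1 ltr01); apply: ae_eq_integral => //.
- by apply/measurable_EFinP; exact: measurable_rker.
- by apply/measurable_EFinP; exact: measurable_exponential_pdf.
- exists [set 0]; split; [exact: measurable_set1|exact: lebesgue_measure_set1|].
  move=> t /= h; apply: contrapT => t0; apply: h => _; congr EFin.
  rewrite /rker; case: ifPn => [tp|].
    by rewrite exponential_pdfE ?ltW// subrr powRr0 !mul1r mulN1r.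
  rewrite -leNgt le_eqVlt => /orP[/eqP //|tn].
  by rewrite lt0_exponential_pdf.
Qed.

(** The exponentials multiply to e^(-x), which leaves the integral of t^(s-1) over ]0, x]. *)
Lemma integral_rker_conv (s x : R) : 0 < s ->
  (\int[mu]_t ((rker 1 1 (x - t))%:E * (rker 1 s t)%:E) = (s^-1 * rker 1 (s + 1) x)%:E)%E.
Proof.
move=> s0; have [x0|x0] := ltP 0 x; last first.
  rewrite {3}/rker ltNge x0 /= mulr0.
  apply: integral0_eq => t _; rewrite /rker; case: ifPn => h1; last by rewrite mul0e.
  case: ifPn => h2; last by rewrite mule0.
  by exfalso; lra.
transitivity (\int[mu]_(t in `]0%R, x]) ((expR (- x))%:E * (t `^ (s - 1))%:E))%E; last first.
  rewrite ge0_integralZl//.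
  - rewrite integral_powR// /rker x0 -EFinM; congr EFin.
    by rewrite addrK mul1r; ring.
  - by apply/measurable_EFinP/measurable_funTS; exact: measurable_powR.
  - by move=> t _; rewrite lee_fin powR_ge0.
rewrite -integral_itv_bndo_bndc; last first.
  apply: emeasurable_funM => //; apply/measurable_EFinP/measurable_funTS; exact: measurable_powR.
rewrite [RHS]integral_mkcond; apply: eq_integral => t _.
rewrite patchE /rker -EFinM.
have [/= t0|t0] := ltP 0 t; last first.
  by rewrite mulr0 memNset//= in_itv/= ltNge t0.
rewrite subr_gt0; have [tx|tx] := ltP t x; last first.
  by rewrite mul0r memNset//= in_itv/= (ltNge t x) tx andbF.
rewrite mem_set/= ?in_itv/= ?t0 ?tx// -EFinM; congr EFin.
rewrite subrr powRr0 !mul1r (_ : - x = - (x - t) + - t); last by ring.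
by rewrite expRD; ring.
Qed.

(** Instead of integrating by parts, [integral_rker_conv] is integrated in x: convolution with
    [rker 1 1], of mass 1, preserves the mass of [rker 1 s]. *)
Lemma rgamma_rec s : 0 < s -> rgamma s = ((s^-1)%:E * rgamma (s + 1))%E.
Proof.
move=> s0; rewrite -[LHS]mul1e -rgamma1 /rgamma.
have mE r : measurable_fun [set: R] (fun t => (rker 1 r t)%:E).
  by apply/measurable_EFinP; exact: measurable_rker.
rewrite -(conv_tonelli (F := fun t => (rker 1 1 t)%:E) (G := fun t => (rker 1 s t)%:E))//; last 2 first.
- by move=> t; rewrite lee_fin rker_ge0.
- by move=> t; rewrite lee_fin rker_ge0.
rewrite -ge0_integralZl//; last 3 first.
- exact: mE.
- by move=> t _; rewrite lee_fin rker_ge0.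
- by rewrite lee_fin invr_ge0 ltW.
by apply: eq_integral => x _; rewrite integral_rker_conv.
Qed.

(** In the extended reals the recursion passes finiteness upwards: an infinite value at k + 2 would
    force one at k + 1. *)
Lemma rgamma_nat (k : nat) : (rgamma k.+1%:R < +oo)%E.
Proof.
elim: k => [|k ih]; first by rewrite rgamma1 ltry.
have k0 : 0 < k.+1%:R :> R by [].
move: ih; rewrite (rgamma_rec k0) (_ : k.+1%:R + 1 = k.+2%:R); last by rewrite -[RHS]natr1.
case: (rgamma k.+2%:R) => [r| |] //=; first by move=> _; rewrite ltry.
by rewrite gt0_muley// lte_fin invr_gt0.
Qed.

(** The kernel is dominated by t^(r-1) on ]0, 1] and, for t > 1, by the kernel of an integer
    exponent N + 1 >= r. *)
Lemma rgamma_fin r : 0 < r -> (rgamma r < +oo)%E.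
Proof.
move=> r0; pose N := Num.truncn r.
have rN : r <= N.+1%:R by rewrite ltW// truncnS_gt.
pose h (t : R) := (t `^ (r - 1))%:E.
have mE s : measurable_fun [set: R] (fun t => (rker 1 s t)%:E).
  by apply/measurable_EFinP; exact: measurable_rker.
have mh : measurable_fun [set: R] (h \_ `]0, 1]).
  apply: (measurable_restrictT h (measurable_itv `]0, 1])).1.
  by apply/measurable_EFinP/measurable_funTS; exact: measurable_powR.
have h0 t : (0 <= (h \_ `]0%R, 1%R]) t)%E.
  by rewrite patchE; case: ifP => // _; rewrite lee_fin powR_ge0.
apply: (@le_lt_trans _ _ (\int[mu]_t ((h \_ `]0%R, 1%R]) t + (rker 1 N.+1%:R t)%:E))%E).
  apply: ge0_le_integral => //.
  - by move=> t _; rewrite lee_fin rker_ge0.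
  - exact: mE.
  - by apply: emeasurable_funD; [exact: mh|exact: mE].
  - move=> t _; rewrite patchE {1}/rker; have [t0|t0] := ltP 0 t; last first.
      by rewrite memNset ?add0e ?lee_fin ?rker_ge0//= in_itv/= ltNge t0.
    have [t1|t1] := leP t 1.
      rewrite mem_set/= ?in_itv/= ?t0 ?t1// /h -EFinD lee_fin.
      rewrite -[leLHS]addr0 lerD ?rker_ge0// ler_piMr ?powR_ge0//.
      by rewrite -[leRHS]expR0 ler_expR mul1r oppr_le0 ltW.
    rewrite memNset ?add0e/= ?in_itv/= ?(leNgt t 1) ?t1 ?andbF// lee_fin /rker t0.
    by rewrite ler_wpM2r ?expR_ge0//; apply: ler_powR; [exact: ltW|rewrite lerD2r].
rewrite ge0_integralD//;
  do ?[exact: mE|exact: mh|by move=> t _; rewrite lee_fin rker_ge0|by move=> t _; exact: h0].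
rewrite -integral_mkcond lte_add_pinfty//; last exact: rgamma_nat.
by rewrite integral_powR// ltry.
Qed.

Lemma rker_scale (lam r t : R) : 0 < lam ->
  rker lam r t = lam `^ (1 - r) * rker 1 r (lam * t + 0).
Proof.
move=> l0; rewrite /rker addr0 pmulr_rgt0//; case: ifP => t0; last by rewrite mulr0.
rewrite powRM ?ltW// !mulrA -powRD; last by rewrite (gt_eqF l0) implybT.
by rewrite (_ : 1 - r + (r - 1) = 0) ?powRr0 ?mul1r//; ring.
Qed.

Lemma integral_rker (lam r : R) : 0 < lam ->
  (\int[mu]_t (rker lam r t)%:E = (lam `^ (- r))%:E * rgamma r)%E.
Proof.
move=> l0.
have mE s : measurable_fun [set: R] (fun t => (rker 1 s t)%:E).
  by apply/measurable_EFinP; exact: measurable_rker.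
rewrite /rgamma (ge0_integral_affine 0 l0 (mE r)); last by move=> t; rewrite lee_fin rker_ge0.
rewrite muleA -EFinM -ge0_integralZl//; last 3 first.
- apply/measurable_EFinP; apply: (measurableT_comp (measurable_rker 1 r)).
  by apply: measurable_funD => //; exact: measurable_funM.
- by move=> t _; rewrite lee_fin rker_ge0.
- by rewrite lee_fin mulr_ge0 ?powR_ge0 ?ltW.
apply: eq_integral => t _; rewrite rker_scale// [LHS]EFinM; congr (_ * _)%E; congr EFin.
by rewrite -[X in _ * X](powRr1 (ltW l0)) -powRD ?(gt_eqF l0) ?implybT// addrC.
Qed.

Lemma L1_ker (lam : R) (p : R[i]) : 0 < lam -> 0 < cRe p -> L1 (ker lam p).
Proof.
move=> l0 p0; apply/cintbleP => //; split; first exact: measurable_ker.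
under eq_integral do rewrite cmod_ker.
rewrite integral_rker// lte_mul_pinfty ?lee_fin ?powR_ge0//.
exact: rgamma_fin.
Qed.

(** The Beta function, as the value at 1 of a convolution; scaling reduces every other point x > 0
    to this one. *)
Definition cbeta (p q : R[i]) : R[i] := conv (ker 0 p) (ker 0 q) 1.

Lemma ker_expR (lam : R) p t : ker lam p t = (expR (- (lam * t)))%:C * ker 0 p t.
Proof.
by rewrite /ker; case: ifP => _; rewrite ?mulr0// mul0r oppr0 expR0 mulr1 mulrC.
Qed.

Lemma ker_conv_scale (p q : R[i]) (x c t : R) : 0 < c ->
  ker 0 p (c * x - (c * t + 0)) * ker 0 q (c * t + 0) =
  cpow c (p + q - 2) * (ker 0 p (x - t) * ker 0 q t).
Proof.
move=> c0; rewrite addr0 -mulrBr /ker !pmulr_rgt0//.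
case: ifPn => h1; last by rewrite !mul0r mulr0.
case: ifPn => h2; last by rewrite !mulr0.
rewrite !mul0r !oppr0 !expR0 !mulr1 !cpowM//.
rewrite (_ : p + q - 2 = (p - 1) + (q - 1)); last by ring.
by rewrite (cpowD (p - 1) (q - 1) c0); ring.
Qed.

Lemma cmeas_ker_conv (p q : R[i]) (x : R) :
  cmeas [set: R] (fun t => ker 0 p (x - t) * ker 0 q t).
Proof.
apply: cmeasM; last exact: measurable_ker.
apply: (cmeas_comp (phi := fun t : measurableTypeR R => x - t)); last exact: measurable_ker.
exact: measurable_funB.
Qed.

(** Integrability holds at every x, not only at almost every x. The kernels with lam = 1 lie in L^1,
    so their convolution integral converges at some x1 > 0; there the two weights multiply to the
    constant e^(-x1) and can be removed; the substitution t -> (x / x1) t then carries x1 to x. *)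
Lemma L1_ker_conv (p q : R[i]) (x : R) : 0 < cRe p -> 0 < cRe q ->
  L1 (fun t => ker 0 p (x - t) * ker 0 q t).
Proof.
move=> p0 q0; have [x0|x0] := ltP 0 x; last first.
  apply: (eq_cintble _ _ (cintble0 mu setT)) => // t _; rewrite /ker.
  case: ifPn => h1; last by rewrite mul0r.
  by case: ifPn => h2; [exfalso; lra|rewrite mulr0].
have [x1 x10 Hx1] : exists2 x1 : R, 0 < x1 &
    L1 (fun t => ker 1 p (x1 - t) * ker 1 q t).
  have [N [mN N0 h]] := ae_cintble_conv (L1_ker ltr01 p0) (L1_ker ltr01 q0).
  apply: contrapT => hn.
  (* Without such a point, ]0, 1] would lie in the exceptional null set. *)
  have : (mu `]0%R, 1%R] <= mu N)%E.
    apply: le_measure; rewrite ?inE//.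
    move=> t /=; rewrite in_itv/= => /andP[t0 _]; apply: h => /= ht; apply: hn.
    by exists t.
  by rewrite N0 lebesgue_measure_itv/= lte_fin ltr01 sube0 lee_fin ler10.
have {}Hx1 : L1 (fun t => ker 0 p (x1 - t) * ker 0 q t).
  have := cintbleZ (expR x1)%:C measurableT Hx1; apply: eq_cintble => // t _.
  rewrite (ker_expR 1 p) (ker_expR 1 q) !mul1r.
  have e : (expR x1)%:C * (expR (- (x1 - t)))%:C * (expR (- t))%:C = 1 :> R[i].
    rewrite -!rmorphM /= -!expRD (_ : x1 + - (x1 - t) + - t = 0) ?expR0//; ring.
  transitivity ((expR x1)%:C * (expR (- (x1 - t)))%:C * (expR (- t))%:C * (ker 0 p (x1 - t) * ker 0 q t)).
    by ring.
  by rewrite e mul1r.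
have c0 : 0 < x / x1 by rewrite divr_gt0.
apply/(cintble_affine 0 c0); first exact: cmeas_ker_conv.
have := cintbleZ (cpow (x / x1) (p + q - 2)) measurableT Hx1; apply: eq_cintble => // t _.
rewrite -ker_conv_scale// divfK// gt_eqF//.
Qed.

Lemma ker_conv (p q : R[i]) (x : R) : 0 < cRe p -> 0 < cRe q ->
  conv (ker 0 p) (ker 0 q) x = cbeta p q * ker 0 (p + q) x.
Proof.
move=> p0 q0; have [x0|x0] := ltP 0 x; last first.
  rewrite {3}/ker ltNge x0 mulr0 -[RHS](cint0 mu setT); apply: eq_cint => t _; rewrite /ker.
  case: ifPn => h1; last by rewrite mul0r.
  by case: ifPn => h2; [exfalso; lra|rewrite mulr0].
rewrite /conv (cint_affine 0 x0 (L1_ker_conv x p0 q0)).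
transitivity (x%:C * cint mu setT (fun t => cpow x (p + q - 2) * (ker 0 p (1 - t) * ker 0 q t))).
  by congr (_ * _); apply: eq_cint => t _; rewrite -ker_conv_scale// mulr1.
rewrite cintZ//; last exact: L1_ker_conv.
rewrite /cbeta /conv /ker x0 mul0r oppr0 expR0 mulr1.
rewrite (_ : p + q - 1 = (p + q - 2) + 1); last by ring.
by rewrite cpowS//; ring.
Qed.

Lemma ker1_conv (p q : R[i]) (x : R) : 0 < cRe p -> 0 < cRe q ->
  conv (ker 1 p) (ker 1 q) x = cbeta p q * ker 1 (p + q) x.
Proof.
move=> p0 q0; rewrite (ker_expR 1 (p + q)) mulrCA -ker_conv// /conv -cintZ//; last first.
  exact: L1_ker_conv.
apply: eq_cint => t _; rewrite (ker_expR 1 p) (ker_expR 1 q) !mul1r.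
rewrite (_ : - x = - (x - t) + - t) ?expRD ?rmorphM/=; ring.
Qed.

Definition cgamma (p : R[i]) : R[i] := cint mu setT (ker 1 p).

(** The integral of a convolution is the product of the integrals, so it suffices to integrate
    [ker1_conv]. *)
Lemma cgammaM (p q : R[i]) : 0 < cRe p -> 0 < cRe q ->
  cgamma p * cgamma q = cbeta p q * cgamma (p + q).
Proof.
move=> p0 q0; rewrite -cint_conv; [|exact: L1_ker..].
rewrite -cintZ//; last by apply: L1_ker => //; rewrite cReD addr_gt0.
by apply: eq_cint => x _; exact: ker1_conv.
Qed.

Lemma fine_rgamma (r : R) : 0 < r -> cgamma r%:C = (fine (rgamma r))%:C.
Proof.
move=> r0; have e t : ker 1 r%:C t = (rker 1 r t)%:C.
  rewrite /ker /rker; case: ifP => // _.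
  by rewrite rmorphM /= -cpowR rmorphB.
apply: complex_ext => /=.
- by rewrite /Rintegral; congr fine; apply: eq_integral => t _; rewrite e.
- by rewrite /Rintegral integral0_eq// => t _; rewrite e.
Qed.

End GammaKernel.

(** * Non-vanishing of Gamma far to the right *)

Section TrigBounds.
Context {R : realType}.
Implicit Types u x : R.

Lemma ler_norm_sin u : `|sin u| <= `|u|.
Proof.
wlog u0 : u / 0 < u => [hw|].
  have [->|n0] := eqVneq u 0; first by rewrite sin0 !normr0.
  have [u0|u0] := ltP 0 u; first exact: hw.
  by rewrite -normrN -sinN -[leRHS]normrN hw// oppr_gt0 lt_neqAle n0.
have [c _] := MVT u0 (fun x _ => @is_derive_sin R x)
  (continuous_subspaceT (@continuous_sin R)).
rewrite sin0 !subr0 => ->.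
by rewrite normrM ler_piMl ?normr_ge0// cos_max.
Qed.

(** Follows from cos u = 1 - 2 sin^2 (u / 2) and |sin v| <= |v|. *)
Lemma cos_ge_parabola u : 1 - u ^+ 2 / 2 <= cos u.
Proof.
have -> : cos u = 1 - 2 * sin (u / 2) ^+ 2.
  rewrite {1}(_ : u = (u / 2) *+ 2); last by rewrite -mulr_natr divfK.
  by rewrite cos_mulr2n cos2sin2; ring.
rewrite lerD2l lerN2.
have : sin (u / 2) ^+ 2 <= (u / 2) ^+ 2.
  by rewrite -[leLHS](real_normK (num_real _)) -[leRHS](real_normK (num_real _)) ler_sqr ?nnegrE// ler_norm_sin.
rewrite expr_div_n; lra.
Qed.

(** The inequality ln y <= y - 1, at y = x and at y = 1 / x, bounds ln x from both sides. The
    right-hand side consists of integer powers of x, so against a Gamma density it integrates to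
    Gamma values. *)
Lemma sqr_ln_le x : 0 < x -> ln x ^+ 2 <= (x - 1) ^+ 2 + (x^-1 - 1) ^+ 2.
Proof.
move=> x0.
have h (y : R) : 0 < y -> ln y <= y - 1.
  move=> y0; have := @le_ln1Dx R (y - 1).
  by rewrite (_ : 1 + (y - 1) = y); [apply; lra|ring].
have h1 := h _ x0; have := h x^-1; rewrite invr_gt0 lnV ?posrE// => /(_ x0) h2.
have [l0|l0] := leP 0 (ln x).
  rewrite -[leLHS]addr0 lerD ?sqr_ge0// ler_sqr ?nnegrE//; lra.
rewrite -[leLHS]add0r lerD ?sqr_ge0// -[leLHS]sqrrN ler_sqr ?nnegrE//; lra.
Qed.

End TrigBounds.

Section GammaNonzero.
Context {R : realType}.
Local Notation mu := (@lebesgue_measure R).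
Local Notation L1 := (cintble mu setT).

Definition Gr (r : R) : R := \int[mu]_t rker 1 r t.

Lemma integrable_rker (r : R) : 0 < r -> mu.-integrable setT (EFin \o rker 1 r).
Proof.
move=> r0; apply/integrableP; split.
  by apply/measurable_EFinP; exact: measurable_rker.
have := rgamma_fin r0; rewrite /rgamma; congr (_ < _)%E; apply: eq_integral => t _.
by rewrite /= ger0_norm ?rker_ge0.
Qed.

Lemma Gr_rgamma (r : R) : 0 < r -> rgamma r = (Gr r)%:E.
Proof.
move=> r0; rewrite /Gr /Rintegral fineK// ge0_fin_numE ?rgamma_ge0//.
exact: rgamma_fin.
Qed.

Lemma GrS (r : R) : 0 < r -> Gr (r + 1) = r * Gr r.
Proof.
move=> r0; have := rgamma_rec r0; rewrite !Gr_rgamma ?addr_gt0// -EFinM => -[->].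
by rewrite mulrA divff ?mul1r// gt_eqF.
Qed.

(** On ]0, 1] the integrand is at least e^(-1) t^(r-1). *)
Lemma Gr_gt0 (r : R) : 0 < r -> 0 < Gr r.
Proof.
move=> r0; rewrite -lte_fin -Gr_rgamma//.
apply: (@lt_le_trans _ _ (\int[mu]_(t in `]0%R, 1%R]) ((expR (- 1))%:E * (t `^ (r - 1))%:E))%E).
  rewrite ge0_integralZl//; last 2 first.
  - by apply/measurable_EFinP/measurable_funTS; exact: measurable_powR.
  - by move=> t _; rewrite lee_fin powR_ge0.
  by rewrite integral_powR// -EFinM lte_fin mulr_gt0 ?expR_gt0// divr_gt0// powR_gt0.
rewrite integral_mkcond; apply: ge0_le_integral => //.
- by move=> t _; rewrite patchE; case: ifP => // _; rewrite -EFinM lee_fin mulr_ge0 ?expR_ge0 ?powR_ge0.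
- have := (measurable_restrictT (fun t : R => (expR (- 1))%:E * (t `^ (r - 1))%:E)%E (measurable_itv `]0, 1])).1; apply.
  by apply: emeasurable_funM => //; apply/measurable_EFinP/measurable_funTS; exact: measurable_powR.
- by apply/measurable_EFinP; exact: measurable_rker.
- move=> t _; rewrite patchE; case: ifPn => [|_]; last by rewrite lee_fin rker_ge0.
  rewrite inE/= in_itv/= => /andP[t0 t1]; rewrite -EFinM lee_fin /rker t0 mulrC.
  by rewrite ler_wpM2l ?powR_ge0// ler_expR mul1r lerN2.
Qed.

Lemma rkerS (r t : R) : t * rker 1 r t = rker 1 (r + 1) t.
Proof.
rewrite /rker; case: ifP => t0; last by rewrite mulr0.
rewrite mulrA; congr (_ * _).
by rewrite -[X in X * _](powRr1 (ltW t0)) -powRD ?(gt_eqF t0) ?implybT//; congr powR; ring.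
Qed.

(** The bracket is the integral of (t / X - 1)^2 + (X / t - 1)^2 against t^(X-1) e^(-t). The
    recursion expresses everything through H = Gr (X - 2); the terms of order X^2 cancel and the
    bracket collapses to (2 X - 1 + 2 / X) H <= 2 X H. What is subtracted is thus at most tau^2 X H,
    which the threshold on X keeps below Gr X = (X - 1) (X - 2) H. *)
Lemma Gr_parabola (X tau : R) : 6 + 3 * tau ^+ 2 < X ->
  0 < Gr X - tau ^+ 2 / 2 *
    (X ^- 2 * Gr (X + 2) - 2 / X * Gr (X + 1) + Gr X +
     (X ^+ 2 * Gr (X - 2) - 2 * X * Gr (X - 1) + Gr X)).
Proof.
have arith (H t : R) : 0 <= t -> 6 + 3 * t < X -> 0 < H ->
    0 < (X - 1) * ((X - 2) * H) - t / 2 *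
      (X ^- 2 * ((X + 1) * (X * ((X - 1) * ((X - 2) * H)))) -
       2 / X * (X * ((X - 1) * ((X - 2) * H))) + (X - 1) * ((X - 2) * H) +
       (X ^+ 2 * H - 2 * X * ((X - 2) * H) + (X - 1) * ((X - 2) * H))).
  move=> t0 hX H0.
  have X0 : 0 < X by lra.
  have Xn : X != 0 by rewrite gt_eqF.
  rewrite (_ : X ^- 2 * ((X + 1) * (X * ((X - 1) * ((X - 2) * H)))) -
    2 / X * (X * ((X - 1) * ((X - 2) * H))) + (X - 1) * ((X - 2) * H) +
    (X ^+ 2 * H - 2 * X * ((X - 2) * H) + (X - 1) * ((X - 2) * H)) =
    (X - 1) / X * ((X - 2) * H) + (X + 2) * H); last by field.
  have X2H : 0 <= (X - 2) * H by apply: mulr_ge0; lra.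
  have q2 : (X - 1) / X * ((X - 2) * H) <= (X - 2) * H.
    by apply: ler_piMl => //; rewrite ler_pdivrMr// mul1r; lra.
  have q3 : t * ((X - 1) / X * ((X - 2) * H) + (X + 2) * H) <= t * (2 * (X * H)).
    by apply: ler_wpM2l => //; lra.
  have q5 : 0 < X * H by rewrite mulr_gt0.
  have q4 : t * (X * H) <= (X - 6) * (X * H) by apply: ler_wpM2r; lra.
  move: q3 q4 q5; move: ((X - 1) / X * _ + _) => Z q3 q4 q5; lra.
move=> hX; have t2 : 0 <= tau ^+ 2 by exact: sqr_ge0.
have [X1 X2] : 0 < X - 1 /\ 0 < X - 2 by split; lra.
have X0 : 0 < X by lra.
have e1 : Gr (X - 1) = (X - 2) * Gr (X - 2).
  by rewrite -(GrS X2); congr Gr; ring.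
have e0 : Gr X = (X - 1) * Gr (X - 1) by rewrite -(GrS X1) subrK.
have e3 : Gr (X + 2) = (X + 1) * Gr (X + 1).
  have X3 : 0 < X + 1 by lra.
  by rewrite -(GrS X3); congr Gr; ring.
rewrite e3 (GrS X0) e0 e1.
exact: arith _ _ t2 hX (Gr_gt0 X2).
Qed.

(* After multiplication by X^(-i tau) the integrand has phase tau ln (t / X), which
   is small where t^(X-1) e^(-t) concentrates; cos u >= 1 - u^2 / 2 and
   ln^2 u <= (u - 1)^2 + (1/u - 1)^2 then make the real part positive. *)
Lemma cgamma_neq0_large (X tau : R) : 6 + 3 * tau ^+ 2 < X -> cgamma (X +i* tau) != 0.
Proof.
move=> hX; have t2 : 0 <= tau ^+ 2 by exact: sqr_ge0.
have X0 : 0 < X by lra.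
have Xn : X != 0 by rewrite gt_eqF.
apply/eqP => g0.
pose w := cpow X (0 +i* - tau).
have : cRe (w * cgamma (X +i* tau)) = 0 by rewrite g0 mulr0.
rewrite -cintZ//; last by apply: L1_ker.
rewrite Re_cint => I0.
pose low t := rker 1 X t - tau ^+ 2 / 2 *
  ((X ^- 2 * rker 1 (X + 2) t - 2 / X * rker 1 (X + 1) t + rker 1 X t) +
   (X ^+ 2 * rker 1 (X - 2) t - 2 * X * rker 1 (X - 1) t + rker 1 X t)).
have lowle t : low t <= cRe (w * ker 1 (X +i* tau) t).
  rewrite /low; have [t0|t0] := ltP 0 t; last first.
    by rewrite /rker /ker ltNge t0 /= !mulr0 /=; lra.
  have eS1 : rker 1 (X + 1) t = t * rker 1 X t by rewrite -rkerS.
  have eS2 : rker 1 (X + 2) t = t ^+ 2 * rker 1 X t.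
    by rewrite (_ : X + 2 = X + 1 + 1) -?rkerS ?expr2 ?mulrA//; ring.
  have eP1 : rker 1 (X - 1) t = t^-1 * rker 1 X t.
    by rewrite -{2}(subrK 1 X) -rkerS mulrA mulVf ?mul1r// gt_eqF.
  have eP2 : rker 1 (X - 2) t = t ^- 2 * rker 1 X t.
    rewrite -{2}(subrK 2 X) (_ : X - 2 + 2 = X - 2 + 1 + 1); last by ring.
    by rewrite -2!rkerS; field; rewrite gt_eqF.
  have -> : cRe (w * ker 1 (X +i* tau) t) = rker 1 X t * cos (tau * ln (t / X)).
    rewrite /ker t0 /w /cpow /rker t0 /= powRr0 lnM ?posrE ?invr_gt0// lnV ?posrE//.
    rewrite ?(cReM, cImM) /= ?(cReM, cImM) /=.
    rewrite subr0 (mulrBr tau (ln t)) cosB (mulNr tau) cosN sinN; ring.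
  rewrite eS1 eS2 eP1 eP2.
  apply: (@le_trans _ _ (rker 1 X t * (1 - (tau * ln (t / X)) ^+ 2 / 2))); last first.
    by rewrite ler_wpM2l ?rker_ge0// cos_ge_parabola.
  have := @sqr_ln_le R (t / X); rewrite divr_gt0// => /(_ isT).
  set L := ln _; rewrite invf_div => hL.
  have -> : X ^- 2 * (t ^+ 2 * rker 1 X t) - 2 / X * (t * rker 1 X t) + rker 1 X t +
    (X ^+ 2 * (t ^- 2 * rker 1 X t) - 2 * X * (t^-1 * rker 1 X t) + rker 1 X t) =
    rker 1 X t * ((t / X - 1) ^+ 2 + (X / t - 1) ^+ 2).
    by field; rewrite Xn gt_eqF.
  have := ler_wpM2l (mulr_ge0 (rker_ge0 1 X t) t2) hL; rewrite exprMn.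
  set S := _ + (X / t - 1) ^+ 2; move: (rker 1 X t) => K; lra.
have Ir (r : R) : 0 < r -> mu.-integrable setT (EFin \o rker 1 r) by exact: integrable_rker.
have IZ (c r : R) : 0 < r -> mu.-integrable setT (EFin \o (fun t => c * rker 1 r t)).
  by move=> r0; exact: (integrableZl measurableT c (Ir r r0)).
have X2 : 0 < X - 2 by lra.
have X1 : 0 < X - 1 by lra.
have Xp1 : 0 < X + 1 by lra.
have Xp2 : 0 < X + 2 by lra.
have ID (f g : R -> R) : mu.-integrable setT (EFin \o f) -> mu.-integrable setT (EFin \o g) ->
  mu.-integrable setT (EFin \o (fun t => f t + g t)).
  by move=> fi gi; exact: (integrableD measurableT fi gi).
have IB (f g : R -> R) : mu.-integrable setT (EFin \o f) -> mu.-integrable setT (EFin \o g) ->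
  mu.-integrable setT (EFin \o (fun t => f t - g t)).
  by move=> fi gi; exact: (integrableB measurableT fi gi).
have IA := ID _ _ (IB _ _ (IZ (X ^- 2) _ Xp2) (IZ (2 / X) _ Xp1)) (Ir _ X0).
have IC := ID _ _ (IB _ _ (IZ (X ^+ 2) _ X2) (IZ (2 * X) _ X1)) (Ir _ X0).
have IAC := integrableZl measurableT (tau ^+ 2 / 2) (ID _ _ IA IC).
have Ilow : mu.-integrable setT (EFin \o low) by exact: IB (Ir _ X0) IAC.
have := @le_Rintegral _ _ _ mu setT low (fun t => cRe (w * ker 1 (X +i* tau) t)) measurableT Ilow.
have [h1 _] := cintbleZ w measurableT (L1_ker (p := X +i* tau) ltr01 X0).
move=> /(_ h1 (fun t _ => lowle t)); rewrite I0 /low.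
rewrite RintegralB//; last exact: Ir.
rewrite RintegralZl//; last exact: (ID _ _ IA IC).
rewrite RintegralD//; try exact: IC; try exact: IA.
rewrite RintegralD//; try exact: Ir; try exact: IB (IZ _ _ _) (IZ _ _ _).
rewrite RintegralB//; try exact: IZ.
rewrite !RintegralZl//; try exact: Ir.
rewrite RintegralD//; try exact: Ir; try exact: IB (IZ _ _ _) (IZ _ _ _).
rewrite RintegralB//; try exact: IZ.
rewrite !RintegralZl//; try exact: Ir.
rewrite -!/(Gr _).
by rewrite leNgt (Gr_parabola hX).
Qed.

End GammaNonzero.

(** * Derivatives and primitives *)

Section DiffQuotient.
Context {R : realType}.
Implicit Types (A : set R) (f g : R -> R[i]) (l : R[i]).

(** The derivative along A without quotients: y = x needs no exclusion, one-sided derivatives at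
    endpoints are included, and the rules of calculus become plain estimates. Uniqueness of l comes
    from x being an accumulation point of A. *)
Definition cderiv A f x l := forall e : R, 0 < e -> exists2 d : R, 0 < d &
  forall y, A y -> `|y - x| < d -> cmod (f y - f x - l * (y - x)%:C) <= e * `|y - x|.

Definition accum A (x : R) := forall d : R, 0 < d -> exists y, [/\ A y, y != x & `|y - x| < d].

Lemma accum_cc (a b x : R) : a < b -> x \in `[a, b] -> accum `[a, b] x.
Proof.
move=> ab; rewrite in_itv/= => /andP[ax xb] d d0.
have [xb'|bx] := ltP x b.
  exists (Num.min b (x + d / 2)); split.
  - by rewrite /= in_itv/= ge_min lexx /= andbT le_min; lra.
  - by rewrite gt_eqF// lt_min xb'/=; lra.
  - have : x < Num.min b (x + d / 2) by rewrite lt_min xb'/=; lra.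
    move=> h; rewrite gtr0_norm ?subr_gt0// ltrBlDl gt_min; apply/orP; right; lra.
have xb' : x = b by apply/eqP; rewrite eq_le xb.
rewrite xb'; exists (Num.max a (b - d / 2)); split.
- by rewrite /= in_itv/= le_max lexx /= ge_max; lra.
- by rewrite lt_eqF// gt_max ab/=; lra.
- have : Num.max a (b - d / 2) < b by rewrite gt_max ab/=; lra.
  move=> h; rewrite ltr0_norm ?subr_lt0// opprB ltrBlDl -ltrBlDr lt_max.
  by apply/orP; right; lra.
Qed.

Lemma accum_oo (a b x : R) : a < b -> x \in `[a, b] -> accum `]a, b[ x.
Proof.
move=> ab; rewrite in_itv/= => /andP[ax xb] d d0.
have [xb'|bx] := ltP x b.
  exists (Num.min ((x + b) / 2) (x + d / 2)).
  have h : x < Num.min ((x + b) / 2) (x + d / 2) by rewrite lt_min; apply/andP; split; lra.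
  split.
  - rewrite /= in_itv/= (le_lt_trans ax h) gt_min; apply/orP; left; lra.
  - by rewrite gt_eqF.
  - by rewrite gtr0_norm ?subr_gt0// ltrBlDl gt_min; apply/orP; right; lra.
have xb' : x = b by apply/eqP; rewrite eq_le xb.
rewrite xb'; exists (Num.max ((a + b) / 2) (b - d / 2)).
have h : Num.max ((a + b) / 2) (b - d / 2) < b by rewrite gt_max; apply/andP; split; lra.
split.
- by rewrite /= in_itv/= h andbT lt_max; apply/orP; left; lra.
- by rewrite lt_eqF.
- rewrite ltr0_norm ?subr_lt0// opprB ltrBlDl -ltrBlDr lt_max.
  by apply/orP; right; lra.
Qed.

Lemma cderivP A f x l : cderiv A f x l <->
  (diff_quotient f x y @[y --> within A x^'] --> (l : R[i]^o)).
Proof.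
have key (y : R) : y != x -> cmod (diff_quotient f x y - l) =
    cmod (f y - f x - l * (y - x)%:C) / `|y - x|.
  move=> yx; rewrite /diff_quotient -(cmodR (y - x)) -cmodV -cmodM.
  have yx0 : (y - x)%:C != 0 :> R[i].
    by rewrite -cmod_eq0 cmodR normr_eq0 subr_eq0.
  by move: (y - x)%:C yx0 => v v0; congr cmod; field.
split.
- move=> h; apply/cvgC => e e0.
  have [d d0 hd] := h (e / 2) (divr_gt0 e0 (ltr0n _ 2)).
  apply/nbhs_ballP; exists d => //= y; rewrite /ball/= => yd yx Ay.
  rewrite key// ltr_pdivrMr ?normr_gt0 ?subr_eq0//.
  rewrite distrC in yd.
  apply: (le_lt_trans (hd _ Ay yd)).
  by rewrite ltr_pM2r ?normr_gt0 ?subr_eq0// ltr_pdivrMr// ltr_pMr// ltr1n.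
- move=> /cvgC h e e0; have /nbhs_ballP[d /= d0 hd] := h e e0.
  exists d => // y Ay yd; have [->|yx] := eqVneq y x.
    by rewrite !subrr mulr0 subrr cmod0 normr0 mulr0.
  have : ball x d y by rewrite /ball/= distrC.
  move=> /hd /(_ yx Ay); rewrite key// ltr_pdivrMr ?normr_gt0 ?subr_eq0//.
  exact: ltW.
Qed.

Lemma accum_proper A x : accum A x -> ProperFilter (within A x^').
Proof.
move=> h; apply: Build_ProperFilter_ex => P /nbhs_ballP[d /= d0 hd].
have [y [Ay yx yd]] := h d d0.
by exists y; apply: hd => //; rewrite /ball/= distrC.
Qed.

Lemma derive_onE A f x l : accum A x -> cderiv A f x l -> derive_on A f x = l.
Proof.
move=> /accum_proper PF /cderivP h.
have hh : hausdorff_space (R[i]^o) by apply: norm_hausdorff.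
exact: (@cvg_lim (R[i]^o) hh R (within A x^') PF (diff_quotient f x) l h).
Qed.

Lemma derivable_onP A f x : accum A x -> derivable_on A f x -> cderiv A f x (derive_on A f x).
Proof.
by move=> /accum_proper PF h; apply/cderivP; exact: h.
Qed.

Lemma cderiv_derivable A f x l : cderiv A f x l -> derivable_on A f x.
Proof. by move=> /cderivP h; apply/cvg_ex; exists l. Qed.

Lemma cderiv_cst A (c : R[i]) x : cderiv A (fun=> c) x 0.
Proof.
move=> e e0; exists 1 => // y _ _.
by rewrite subrr mul0r subrr cmod0 mulr_ge0// ltW.
Qed.

Lemma cderivD A f g x l m : cderiv A f x l -> cderiv A g x m ->
  cderiv A (fun y => f y + g y) x (l + m).
Proof.
move=> hf hg e e0; have e2 : 0 < e / 2 by rewrite divr_gt0.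
have [d1 d10 h1] := hf _ e2; have [d2 d20 h2] := hg _ e2.
exists (Num.min d1 d2); first by rewrite lt_min d10.
move=> y Ay; rewrite lt_min => /andP[y1 y2].
rewrite (_ : _ - _ = (f y - f x - l * (y - x)%:C) + (g y - g x - m * (y - x)%:C)); last by ring.
apply: (le_trans (ler_cmodD _ _)); rewrite (splitr e) mulrDl lerD//.
  exact: h1.
exact: h2.
Qed.

Lemma cderivZ A f x l (c : R[i]) : cderiv A f x l ->
  cderiv A (fun y => c * f y) x (c * l).
Proof.
move=> hf e e0; have c0 : 0 < cmod c + 1 by rewrite ltr_wpDl ?cmod_ge0.
have [d d0 h] := hf _ (divr_gt0 e0 c0); exists d => // y Ay yd.
rewrite (_ : _ - _ = c * (f y - f x - l * (y - x)%:C)); last by ring.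
rewrite cmodM; apply: (@le_trans _ _ (cmod c * (e / (cmod c + 1) * `|y - x|))).
  by rewrite ler_wpM2l ?cmod_ge0//; exact: h.
rewrite mulrA ler_wpM2r// mulrCA ger_pMr// ler_pdivrMr// mul1r; lra.
Qed.

Lemma cderiv_sum A (I : Type) (s : seq I) (P : pred I) (f : I -> R -> R[i]) x (l : I -> R[i]) :
  (forall i, P i -> cderiv A (f i) x (l i)) ->
  cderiv A (fun y => \sum_(i <- s | P i) f i y) x (\sum_(i <- s | P i) l i).
Proof.
move=> h; elim: s => [|i s ih].
  by rewrite big_nil; under eq_fun do rewrite big_nil; exact: cderiv_cst.
rewrite big_cons; under eq_fun do rewrite big_cons.
by case Pi : (P i) => //; apply: cderivD => //; exact: h.
Qed.

Lemma eq_cderiv A f g x l : A x -> (forall y, A y -> f y = g y) ->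
  cderiv A f x l -> cderiv A g x l.
Proof.
move=> Ax fg h e e0; have [d d0 hd] := h e e0; exists d => // y Ay yd.
by rewrite -!fg//; exact: hd.
Qed.

Lemma cderivS A B f x l : A `<=` B -> cderiv B f x l -> cderiv A f x l.
Proof.
by move=> AB h e e0; have [d d0 hd] := h e e0; exists d => // y /AB; exact: hd.
Qed.

Lemma cderiv_shift f (a x : R) l : cderiv setT f (x - a) l ->
  cderiv setT (fun y => f (y - a)) x l.
Proof.
move=> h e e0; have [d d0 hd] := h e e0; exists d => // y _ yd.
have := hd (y - a) I; rewrite (_ : y - a - (x - a) = y - x); last by ring.
exact.
Qed.

Lemma continuous_onP A f : continuous_on A f <->
  (forall x, A x -> forall e : R, 0 < e -> exists2 d : R, 0 < d &
    forall y, A y -> `|y - x| < d -> cmod (f y - f x) < e).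
Proof.
rewrite /continuous_on; split.
- move=> /subspace_continuousP h x Ax e e0.
  have /cvgC/(_ e e0)/nbhs_ballP[d /= d0 hd] := h x Ax.
  by exists d => // y Ay yd; apply: hd => //; rewrite /ball/= distrC.
- move=> h; apply/subspace_continuousP => x Ax; apply/cvgC => e e0.
  have [d d0 hd] := h x Ax e e0; apply/nbhs_ballP; exists d => //= y yd Ay.
  by apply: hd => //; rewrite distrC.
Qed.

Lemma cderiv_continuous_at A f x l : cderiv A f x l -> forall e : R, 0 < e ->
  exists2 d : R, 0 < d & forall y, A y -> `|y - x| < d -> cmod (f y - f x) < e.
Proof.
move=> h e e0; have [d d0 hd] := h 1 ltr01.
have c0 : 0 < cmod l + 1 by rewrite ltr_wpDl ?cmod_ge0.
exists (Num.min d (e / (cmod l + 1))).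
  by rewrite lt_min d0 divr_gt0.
move=> y Ay; rewrite lt_min => /andP[y1 y2].
have := hd y Ay y1; rewrite mul1r => h1.
rewrite (_ : f y - f x = (f y - f x - l * (y - x)%:C) + l * (y - x)%:C); last by ring.
apply: (le_lt_trans (ler_cmodD _ _)); rewrite cmodM cmodR.
apply: (@le_lt_trans _ _ ((cmod l + 1) * `|y - x|)); first by rewrite mulrDl mul1r addrC lerD2l.
by rewrite mulrC -ltr_pdivlMr.
Qed.

Lemma cderiv_continuous A f (l : R -> R[i]) : (forall x, A x -> cderiv A f x (l x)) ->
  continuous_on A f.
Proof.
by move=> h; apply/continuous_onP => x Ax; exact: cderiv_continuous_at (h x Ax).
Qed.

Lemma continuous_onS A B f : A `<=` B -> continuous_on B f -> continuous_on A f.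
Proof.
move=> AB /continuous_onP h; apply/continuous_onP => x Ax e e0.
by have [d d0 hd] := h x (AB _ Ax) e e0; exists d => // y /AB; exact: hd.
Qed.

Lemma continuous_on_sub A f g : continuous_on A f -> continuous_on A g ->
  continuous_on A (fun x => f x - g x).
Proof.
move=> /continuous_onP hf /continuous_onP hg; apply/continuous_onP => x Ax e e0.
have e2 : 0 < e / 2 by rewrite divr_gt0.
have [d1 d10 h1] := hf x Ax _ e2; have [d2 d20 h2] := hg x Ax _ e2.
exists (Num.min d1 d2); first by rewrite lt_min d10.
move=> y Ay; rewrite lt_min => /andP[y1 y2].
rewrite (_ : _ - _ = (f y - f x) + - (g y - g x)); last by ring.
apply: (le_lt_trans (ler_cmodD _ _)); rewrite cmodN (splitr e) ltrD//.
  exact: h1.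
exact: h2.
Qed.

Definition rderiv A (f : R -> R) x (l : R) := forall e : R, 0 < e -> exists2 d : R, 0 < d &
  forall y, A y -> `|y - x| < d -> `|f y - f x - l * (y - x)| <= e * `|y - x|.

Lemma cderivReIm A f x l : cderiv A f x l <->
  rderiv A (fun y => cRe (f y)) x (cRe l) /\
  rderiv A (fun y => cIm (f y)) x (cIm l).
Proof.
have eR (y : R) : cRe (f y - f x - l * (y - x)%:C) =
    cRe (f y) - cRe (f x) - cRe l * (y - x).
  by rewrite !cReB cReM /=; ring.
have eI (y : R) : cIm (f y - f x - l * (y - x)%:C) =
    cIm (f y) - cIm (f x) - cIm l * (y - x).
  by rewrite !cImB cImM /=; ring.
split.
  move=> h; split=> e e0; have [d d0 hd] := h e e0; exists d => // y Ay yd.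
  - by rewrite -eR; apply: le_trans (ler_Re_cmod _) (hd _ Ay yd).
  - by rewrite -eI; apply: le_trans (ler_Im_cmod _) (hd _ Ay yd).
move=> [h1 h2] e e0; have e2 : 0 < e / 2 by rewrite divr_gt0.
have [d1 d10 {}h1] := h1 _ e2; have [d2 d20 {}h2] := h2 _ e2.
exists (Num.min d1 d2); first by rewrite lt_min d10.
move=> y Ay; rewrite lt_min => /andP[y1 y2].
apply: (le_trans (ler_cmod_ReIm _)); rewrite eR eI (splitr e) mulrDl lerD//.
  exact: h1.
exact: h2.
Qed.

Lemma rderivP (f : R -> R) (x l : R) : rderiv setT f x l <-> is_derive x 1 f l.
Proof.
split.
- move=> h; have cv : h^-1 *: ((f \o shift x) (h *: (1 : R)) - f x) @[h --> 0^'] --> l.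
    apply/cvgrPdist_lt => e e0.
    have [d d0 hd] := h (e / 2) (divr_gt0 e0 (ltr0n _ 2)).
    apply/nbhs_ballP; exists d => //= t; rewrite /ball/= sub0r normrN => td t0.
    have := hd (t + x) I; rewrite addrK => /(_ td).
    rewrite distrC /GRing.scale /= mulr1 => h1.
    have n0 : 0 < `|t| by rewrite normr_gt0.
    rewrite -(ltr_pM2r n0) -normrM mulrBl mulrAC mulVf// mul1r.
    by apply: (le_lt_trans h1); rewrite ltr_pM2r// ltr_pdivrMr// ltr_pMr// ltr1n.
  by split; [apply/cvg_ex; exists l|apply: cvg_lim; [exact: Rhausdorff|exact: cv]].
- move=> [df dE] e e0.
  have cv : h^-1 *: ((f \o shift x) (h *: (1 : R)) - f x) @[h --> 0^'] --> l.
    by rewrite -dE; exact: df.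
  move/cvgrPdist_lt : cv => /(_ e e0)/nbhs_ballP[d /= d0 hd].
  exists d => // y _ yd; have [->|yx] := eqVneq y x.
    by rewrite !subrr mulr0 subrr normr0 mulr0.
  have n0 : 0 < `|y - x| by rewrite normr_gt0 subr_eq0.
  have := hd (y - x); rewrite /ball/= sub0r normrN => /(_ yd).
  rewrite subr_eq0 => /(_ yx); rewrite distrC /GRing.scale /= mulr1 subrK => h1.
  rewrite -(ltr_pM2r n0) -normrM mulrBl mulrAC mulVf ?subr_eq0// mul1r in h1.
  exact: ltW.
Qed.

Lemma rderiv_open (a b : R) (f : R -> R) (x l : R) : a < x < b ->
  rderiv `]a, b[ f x l -> rderiv setT f x l.
Proof.
move=> /andP[ax xb] h e e0; have [d d0 hd] := h e e0.
exists (Num.min d (Num.min (x - a) (b - x))).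
  by rewrite !lt_min d0 !subr_gt0 ax.
move=> y _; rewrite !lt_min => /and3P[yd ya yb]; apply: hd => //.
rewrite /= in_itv/=; move: ya yb; rewrite !ltr_norml => /andP[? ?] /andP[? ?].
by apply/andP; split; lra.
Qed.

Lemma cderiv_real A (f : R -> R) (x l : R) : rderiv A f x l -> cderiv A (fun y => (f y)%:C) x l%:C.
Proof.
move=> h; apply/cderivReIm; split => //= e e0.
by exists 1 => // y _ _; rewrite mul0r !subrr normr0 mulr_ge0// ltW.
Qed.

Lemma rderivS A B (f : R -> R) (x l : R) : A `<=` B -> rderiv B f x l -> rderiv A f x l.
Proof.
by move=> AB h e e0; have [d d0 hd] := h e e0; exists d => // y /AB; exact: hd.
Qed.

(** With z = r + i s, the components of the power are x^r cos (s ln x) and x^r sin (s ln x), to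
    which the real rules apply. *)
Lemma cderiv_cpow (z : R[i]) (x : R) : 0 < x ->
  cderiv setT (fun y => cpow y z) x (z * cpow x (z - 1)).
Proof.
move=> x0; set r := cRe z; set s := cIm z.
have D1 : is_derive x (1 : R) (fun y : R => y `^ r) (r * x `^ (r - 1)) by exact: is_derive1_powR.
have D2 : is_derive x (1 : R) (fun y : R => s * ln y) (s * x^-1).
  have D := is_derive1_ln x0; have := is_deriveZ s D; exact.
have D3 := @is_derive1_comp R (@cos R) (fun y : R => s * ln y) x _ _ (is_derive_cos (s * ln x)) D2.
have D4 := @is_derive1_comp R (@sin R) (fun y : R => s * ln y) x _ _ (is_derive_sin (s * ln x)) D2.
have D5 := is_deriveM D1 D3; have D6 := is_deriveM D1 D4.
have ex : x `^ r = x * x `^ (r - 1).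
  by rewrite -[X in X * _](powRr1 (ltW x0)) -powRD ?(gt_eqF x0) ?implybT//; congr powR; ring.
have eR : cRe (cpow x (z - 1)) = x `^ (r - 1) * cos (s * ln x).
  by rewrite /cpow cReM cReB cImB /= -/r -/s subr0 mul0r subr0.
have eI : cIm (cpow x (z - 1)) = x `^ (r - 1) * sin (s * ln x).
  by rewrite /cpow cImM cReB cImB /= -/r -/s subr0 mul0r addr0.
apply/cderivReIm; split; apply/rderivP.
- move: D5; rewrite /GRing.scale /= => D5.
  rewrite (_ : (fun y => _) = (fun y : R => y `^ r) * (cos \o (fun y : R => s * ln y))); last first.
    by apply/funext => y; rewrite /= mul0r subr0.
  rewrite (_ : cRe _ = x `^ r * (- sin (s * ln x) * (s / x)) + cos (s * ln x) * (r * x `^ (r - 1)))//.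
  rewrite cReM eR eI -/r -/s ex; field; lra.
- move: D6; rewrite /GRing.scale /= => D6.
  rewrite (_ : (fun y => _) = (fun y : R => y `^ r) * (sin \o (fun y : R => s * ln y))); last first.
    by apply/funext => y; rewrite /= mul0r addr0.
  rewrite (_ : cIm _ = x `^ r * (cos (s * ln x) * (s / x)) + sin (s * ln x) * (r * x `^ (r - 1)))//.
  rewrite cImM eR eI -/r -/s ex; field; lra.
Qed.

Lemma cderiv_exprn (k : nat) (x : R) :
  cderiv setT (fun y => (y ^+ k)%:C) x (k%:R * x ^+ k.-1)%:C.
Proof.
apply/cderiv_real/rderivP.
have := @is_deriveX R R id k x 1 1 (is_derive_id _ _).
have -> : (fun y : R => y ^+ k) = id ^+ k by rewrite exprfctE.
by rewrite /GRing.scale /= mulr1.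
Qed.

(** The mean value theorem is a statement about real functions, so it is applied to the real and
    imaginary parts separately. *)
Lemma cderiv0_cst (a b : R) f : a < b -> (forall x, x \in `[a, b] -> cderiv `[a, b] f x 0) ->
  forall x, x \in `[a, b] -> f x = f a.
Proof.
move=> ab h; have cf : continuous_on `[a, b] f.
  by apply: (cderiv_continuous (l := fun=> 0)) => x; exact: h.
have main (g : R -> R) : (forall x, x \in `[a, b] -> rderiv `[a, b] g x 0) ->
    forall x, x \in `[a, b] -> g x = g a.
  move=> hg x; rewrite in_itv/= => /andP[ax xb].
  move: ax; rewrite le_eqVlt => /predU1P[->//|ax].
  have [y yax] : exists2 c, c \in `]a, x[ & g x - g a = (fun=> 0) c * (x - a).
    apply: MVT => //.
    - move=> y; rewrite in_itv/= => /andP[ay yx]; apply/rderivP.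
      apply: (@rderiv_open a b); first by rewrite ay (lt_le_trans yx xb).
      apply: (@rderivS _ `[a, b]); first exact: subset_itv_oo_cc.
      by apply: hg; rewrite in_itv/= !ltW// (lt_le_trans yx xb).
    - apply/subspace_continuousP => y /=; rewrite in_itv/= => /andP[ay yx].
      have yab : y \in `[a, b] by rewrite in_itv/= ay (le_trans yx xb).
      apply/cvgrPdist_lt => e e0; have [d d0 hd] := hg y yab 1 ltr01.
      apply/nbhs_ballP; exists (Num.min d e); first by rewrite /= lt_min d0.
      move=> t /=; rewrite /ball/= lt_min => /andP[td te].
      rewrite in_itv/= => /andP[at_ tx].
      rewrite distrC in td; rewrite distrC in te; rewrite distrC.
      have := hd t; rewrite /= in_itv/= at_ (le_trans tx xb) => /(_ isT td).
      by rewrite mul0r subr0 mul1r => /le_lt_trans; apply.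
  by rewrite mul0r => /eqP; rewrite subr_eq0 => /eqP.
move=> x xab; apply: complex_ext.
- by apply: (main (fun y => cRe (f y))) => // y /h/cderivReIm[].
- by apply: (main (fun y => cIm (f y))) => // y /h/cderivReIm[].
Qed.

End DiffQuotient.

Lemma zextT {T : Type} {R : realType} (D : set T) (f : T -> R[i]) x : D x -> zext D f x = f x.
Proof. by move=> Dx; rewrite /zext /patch mem_set. Qed.

Lemma zextF {T : Type} {R : realType} (D : set T) (f : T -> R[i]) x : ~ D x -> zext D f x = 0.
Proof. by move=> Dx; rewrite /zext /patch memNset. Qed.

Lemma ler_dist_cmod {R : realType} (z w : R[i]) : `|cmod z - cmod w| <= cmod (w - z).
Proof.
have h1 := ler_cmodD (z - w) w; have h2 := ler_cmodD (w - z) z.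
move: h1 h2; rewrite !subrK (cmodB z) => h1 h2.
by rewrite ler_norml; apply/andP; split; lra.
Qed.

(** * Integrals over intervals and primitives *)

Section CIntItv.
Context {R : realType}.
Local Notation mu := (@lebesgue_measure R).
Implicit Types (w f : R -> R[i]) (a b x y : R).

Lemma cint_set0 w : cint mu set0 w = 0.
Proof. by congr (_ +i* _); rewrite Rintegral_set0. Qed.

Lemma cint_cst (l : R[i]) x y : x <= y ->
  cint mu `]x, y[ (fun=> l) = l * (y - x)%:C.
Proof.
move=> xy; apply: complex_ext.
- rewrite Re_cint Rintegral_cst// cReM /= lebesgue_measure_itv/= lte_fin.
  have [xy'|yx] := ltP x y; first by rewrite -EFinB /=; ring.
  by rewrite (_ : y - x = 0) /=; [ring|apply/eqP; rewrite subr_eq0 eq_le yx].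
- rewrite Im_cint Rintegral_cst// cImM /= lebesgue_measure_itv/= lte_fin.
  have [xy'|yx] := ltP x y; first by rewrite -EFinB /=; ring.
  by rewrite (_ : y - x = 0) /=; [ring|apply/eqP; rewrite subr_eq0 eq_le yx].
Qed.

Lemma lebesgue_ooE x y : x <= y -> mu `]x, y[ = (y - x)%:E.
Proof.
rewrite le_eqVlt lebesgue_measure_itv/= lte_fin => /predU1P[->|->]; last by rewrite -EFinB.
by rewrite ltxx subrr.
Qed.

Lemma lebesgue_oo_lty x y : (mu `]x, y[ < +oo)%E.
Proof. by rewrite lebesgue_measure_itv/=; case: ifP => _; rewrite ?ltry// -EFinB ltry. Qed.

Lemma cintble_cst (l : R[i]) x y : cintble mu `]x, y[ (fun=> l).
Proof.
apply: (@le_cintble _ _ _ _ _ _ (fun=> cmod l)) => //.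
apply: measurable_bounded_integrable => //.
- exact: lebesgue_oo_lty.
- exact: bounded_cst.
Qed.

Lemma cint_itvB w a x y : a <= x -> x <= y -> cintble mu `]a, y[ w ->
  cint mu `]a, y[ w - cint mu `]a, x[ w = cint mu `]x, y[ w.
Proof.
move=> ax; rewrite le_eqVlt => /predU1P[<- _|xy [w1 w2]].
  by rewrite subrr set_itvoo0 ?cint_set0.
have main (f : R -> R) : mu.-integrable `]a, y[ (EFin \o f) ->
    \int[mu]_(t in `]a, y[) f t - \int[mu]_(t in `]a, x[) f t = \int[mu]_(t in `]x, y[) f t.
  move=> fi; rewrite -(@Rintegral_itvB _ f (BRight a) (BLeft y) x)//.
  congr (_ - _); apply: Rintegral_itv_bndo_bndc.
  by apply: integrableS fi => //; apply: subset_itvl; rewrite bnd_simp ltW.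
by apply: complex_ext; rewrite ?cReB ?cImB /= main.
Qed.

Lemma cint_itv_close w (l : R[i]) x y (e : R) : x <= y -> cintble mu `]x, y[ w ->
  (forall t, x < t < y -> cmod (w t - l) <= e) ->
  cmod (cint mu `]x, y[ w - l * (y - x)%:C) <= e * (y - x).
Proof.
move=> xy wi h; rewrite -cint_cst// -cintB//; last exact: cintble_cst.
have di : cintble mu `]x, y[ (fun t => w t - l) by apply: cintbleB => //; exact: cintble_cst.
apply: (le_trans (le_cmod_cint _ di)) => //.
have me : fine (mu `]x, y[) = y - x.
  rewrite lebesgue_measure_itv/= lte_fin; have [//|yx] := ltP x y.
  by apply/esym/eqP; rewrite subr_eq0 eq_le yx.
rewrite -me -Rintegral_cst//; apply: le_Rintegral => //.
- exact: cintble_cmod.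
- apply: measurable_bounded_integrable => //.
  + exact: lebesgue_oo_lty.
  + exact: bounded_cst.
Qed.

Lemma continuous_on_real A (f : R -> R[i]) : continuous_on A f ->
  {within A, continuous (fun x => cRe (f x))} /\
  {within A, continuous (fun x => cIm (f x))} /\
  {within A, continuous (fun x => cmod (f x))}.
Proof.
move=> /continuous_onP h; do ![split]; apply/subspace_continuousP => x Ax;
  apply/cvgrPdist_lt => e e0; have [d d0 hd] := h x Ax e e0;
  apply/nbhs_ballP; exists d => //= y yd Ay; rewrite /ball /= distrC in yd;
  apply: le_lt_trans (hd y Ay yd).
- by rewrite -normrN opprB -cReB ler_Re_cmod.
- by rewrite -normrN opprB -cImB ler_Im_cmod.
- exact: ler_dist_cmod.
Qed.

Lemma continuous_cintble a b f : continuous_on `[a, b] f -> cintble mu `[a, b] f.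
Proof.
move=> /continuous_on_real[h1 [h2 _]].
by split; apply: continuous_compact_integrable => //; exact: segment_compact.
Qed.

Lemma continuous_on_bounded a b f : a <= b -> continuous_on `[a, b] f ->
  exists2 M : R, 0 <= M & forall x, x \in `[a, b] -> cmod (f x) <= M.
Proof.
move=> ab /continuous_on_real[_ [_ h]].
have [c cab hc] := EVT_max ab h.
by exists (cmod (f c)); [exact: cmod_ge0|move=> x xab; exact: hc].
Qed.

End CIntItv.

Section Primitive.
Context {R : realType}.
Local Notation mu := (@lebesgue_measure R).
Variables (a b : R).
Hypothesis ab : a < b.
Implicit Types (w f : R -> R[i]).

Definition Prim w (x : R) : R[i] := cint mu `]a, x[ w.

Lemma Prim_a w : Prim w a = 0.
Proof. by rewrite /Prim set_itvoo0 cint_set0. Qed.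

Lemma cintble_oo w (x y : R) : a <= x -> y <= b -> cintble mu `]a, b[ w -> cintble mu `]x, y[ w.
Proof.
by move=> ax yb; apply: cintbleS => //; apply: subset_itv; rewrite bnd_simp.
Qed.

Lemma PrimB w (x y : R) : cintble mu `]a, b[ w -> a <= x -> x <= y -> y <= b ->
  Prim w y - Prim w x = cint mu `]x, y[ w.
Proof. by move=> wi ax xy yb; rewrite /Prim cint_itvB//; exact: cintble_oo wi. Qed.

Lemma Prim_cderiv w (x : R) (l : R[i]) : cintble mu `]a, b[ w -> x \in `[a, b] ->
  (forall e : R, 0 < e -> exists2 d : R, 0 < d &
     forall y, y \in `]a, b[ -> `|y - x| < d -> cmod (w y - l) <= e) ->
  cderiv `[a, b] (Prim w) x l.
Proof.
move=> wi; rewrite in_itv/= => /andP[ax xb] h e e0.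
have [d d0 hd] := h e e0; exists d => // y /=; rewrite in_itv/= => /andP[ay yb] yd.
have [xy|yx] := leP x y.
  rewrite PrimB// ger0_norm ?subr_ge0//; apply: cint_itv_close => //.
    exact: cintble_oo wi.
  move=> t /andP[xt ty]; apply: hd.
    by rewrite in_itv/= (le_lt_trans ax xt) (lt_le_trans ty yb).
  apply: le_lt_trans yd; rewrite !ger0_norm ?subr_ge0//; lra.
have yx' := ltW yx.
rewrite -cmodN (_ : - _ = (Prim w x - Prim w y) - l * (x - y)%:C); last by rewrite !rmorphB /=; ring.
rewrite PrimB// distrC ger0_norm ?subr_ge0//; apply: cint_itv_close => //.
  exact: cintble_oo wi.
move=> t /andP[yt tx]; apply: hd.
  by rewrite in_itv/= (le_lt_trans ay yt) (lt_le_trans tx xb).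
apply: le_lt_trans yd; rewrite -normrN opprB -[leRHS]normrN opprB.
rewrite !ger0_norm ?subr_ge0//; lra.
Qed.

Lemma Prim_cderiv_cont w (x : R) : continuous_on `[a, b] w -> x \in `[a, b] ->
  cderiv `[a, b] (Prim w) x (w x).
Proof.
move=> cw xab; apply: Prim_cderiv => //.
  by apply: (cintbleS _ _ _ (continuous_cintble cw)) => //; exact: subset_itv_oo_cc.
move=> e e0; have /continuous_onP/(_ x xab e e0)[d d0 hd] := cw.
exists d => // y yab yd; apply/ltW/hd => //.
exact: subset_itv_oo_cc yab.
Qed.

(** The union of the disjoint intervals has measure < d, and the integral of |w| over sets of small
    measure is small. *)
Lemma Prim_abs_continuous w : cintble mu `]a, b[ w -> abs_continuous a b (Prim w).
Proof.
move=> wi e e0.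
have wz : mu.-integrable setT (EFin \o (fun x => cmod (zext `]a, b[ w x))).
  have mab : measurable (`]a, b[%classic : set (measurableTypeR R)) by exact: measurable_itv.
  exact: (cintble_cmod measurableT ((cintble_mkcond mu w mab).1 wi)).
have [d [d0 hd]] := integral_normr_continuous wz e0.
exists d => // N s t hst hdis hsum.
pose F (i : 'I_N) : set (measurableTypeR R) := `]s i, t i[%classic.
have mF i : measurable (F i) by exact: measurable_itv.
have tF : trivIset [set` index_enum 'I_N] F.
  apply/trivIsetP => i j _ _ ij; apply/seteqP; split => // x.
  rewrite /F /= !in_itv/= => -[/andP[h1 h2] /andP[h3 h4]].
  have := hdis i j ij; lra.
pose A := \big[setU/set0]_(i <- index_enum 'I_N) F i.
have mA : measurable A by apply: bigsetU_measurable.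
have muA : (mu A < d%:E)%E.
  rewrite /A measure_bigsetU_ord; last 2 first.
  - exact: mF.
  - by apply: sub_trivIset tF => i _ /=; rewrite mem_index_enum.
  apply: (le_lt_trans _ (_ : (\sum_(i < N) (t i - s i))%:E < d%:E)%E); last by rewrite lte_fin.
  rewrite -sumEFin; apply: lee_sum => i _.
  have [h1 h2 h3] := hst i.
  by rewrite le_eqVlt; apply/orP; left; apply/eqP; exact: lebesgue_ooE.
have wiF i : cintble mu (F i) w.
  by have [h1 h2 h3] := hst i; apply: cintble_oo wi.
have key i : ((cmod (Prim w (t i) - Prim w (s i)))%:E <= \int[mu]_(x in F i) `|cmod (zext `]a, b[ w x)|%:E)%E.
  have [h1 h2 h3] := hst i.
  rewrite PrimB//; apply: (le_trans (le_cmod_cint_ge0 mu (mF i) (cintble_meas (wiF i)))).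
  rewrite le_eqVlt; apply/orP; left; apply/eqP/eq_integral => x.
  rewrite inE /F/= in_itv/= => /andP[sx xt].
  rewrite ger0_norm ?cmod_ge0// zextT//= in_itv/=.
  by rewrite (le_lt_trans h1 sx) (lt_le_trans xt h3).
have -> : \sum_(i < N) `|Prim w (t i) - Prim w (s i)| =
    (\sum_(i < N) cmod (Prim w (t i) - Prim w (s i)))%:C.
  by rewrite rmorph_sum.
rewrite ltcR; apply: le_lt_trans (hd A mA muA).
rewrite -lee_fin -sumEFin /Rintegral fineK; last first.
  rewrite ge0_fin_numE; last by apply: integral_ge0 => x _; rewrite lee_fin.
  have /integrableP[_] := integrableS measurableT mA (@subsetT _ A) wz.
  by [].
rewrite (ge0_integral_bigsetU mu mF (index_enum_uniq _) tF); last 2 first.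
- apply/measurable_EFinP; apply: measurableT_comp => //; apply: measurable_funTS.
  by have /measurable_int/measurable_EFinP := wz.
- by move=> x _; rewrite lee_fin.
by apply: lee_sum => i _; exact: key.
Qed.

(** Lebesgue's differentiation theorem for the two components of w extended by 0: the integral from
    -oo then agrees with the one from a. *)
Lemma ae_Prim_cderiv w : cintble mu `]a, b[ w ->
  {ae mu, forall x, x \in `]a, b[ -> cderiv `]a, b[ (Prim w) x (w x)}.
Proof.
move=> wi.
have main (f : R -> R) : mu.-integrable `]a, b[ (EFin \o f) ->
    {ae mu, forall x, x \in `]a, b[ ->
      rderiv `]a, b[ (fun y => \int[mu]_(t in `]a, y[) f t) x (f x)}.
  move=> fi; pose g := f \_ `]a, b[.
  have gi : mu.-integrable setT (EFin \o g).
    have mab : measurable (`]a, b[%classic : set (measurableTypeR R)) by exact: measurable_itv.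
    by have := (integrable_mkcond (mu := mu) (EFin \o f) mab).1 fi; rewrite restrict_EFin.
  have giy y : mu.-integrable `]-oo, y] (EFin \o g) by exact: integrableS gi.
  have lg : locally_integrable [set: R] g by apply: open_integrable_locally => //; exact: openT.
  have := FTC1Ny giy lg; move=> /ae_imp; apply => x [dx ex] xab.
  have dg : is_derive x (1 : R) (fun x : R => \int[mu]_(t in `]-oo, x]) g t) (g x).
    by split=> //; rewrite -derive1E.
  have gx : g x = f x by rewrite /g patchE mem_set.
  have := rderivS (@subsetT _ `]a, b[%classic) ((rderivP _ _ _).2 dg); rewrite gx.
  move=> h e e0; have [d d0 hd] := h e e0; exists d => // y yab yd.
  have eqF z : z \in `]a, b[ -> \int[mu]_(t in `]-oo, z]) g t = \int[mu]_(t in `]a, z[) f t.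
    rewrite in_itv/= => /andP[az zb]; rewrite /g -Rintegral_mkcondr.
    rewrite Rintegral_itv_bndo_bndc; last first.
      by apply: integrableS fi => //; apply: subset_itvl; rewrite bnd_simp ltW.
    congr Rintegral; apply/seteqP; split=> t /=; rewrite !in_itv/=.
      by move=> [-> /andP[->]].
    by move=> /andP[-> tz]; rewrite tz (le_lt_trans tz zb).
  by have := hd y yab yd; rewrite !eqF.
case: wi => w1 w2; have := main _ w1; have := main _ w2.
move=> /ae_imp2 h /h; apply => x h2 h1 xab; apply/cderivReIm; split.
- exact: h1.
- exact: h2.
Qed.

Lemma Prim_continuous w : cintble mu `]a, b[ w -> continuous_on `[a, b] (Prim w).
Proof.
move=> wi; apply/continuous_onP => x xab e e0.
have [d d0 hd] := Prim_abs_continuous wi e0.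
exists d => // y yab yd.
move: xab yab; rewrite /= !in_itv/= => /andP[ax xb] /andP[ay yb].
wlog xy : x y ax xb ay yb yd / x <= y.
  move=> hw; have [xy|yx] := leP x y; first exact: hw.
  by rewrite cmodB; apply: hw => //; [rewrite distrC|exact: ltW].
have h := hd 1%N (fun=> x) (fun=> y); rewrite !big_ord1 in h.
rewrite -ltcR; apply: h => //.
  by move=> i j; rewrite !ord1 eqxx.
by apply: le_lt_trans yd; exact: ler_norm.
Qed.

Lemma Prim_cintble w : cintble mu `]a, b[ w -> cintble mu `]a, b[ (Prim w).
Proof.
move=> /Prim_continuous/continuous_cintble; apply: cintbleS => //.
exact: subset_itv_oo_cc.
Qed.

(** If f x <> g x, continuity keeps the two functions apart on an interval ]x, y[, which has
    positive measure. *)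
Lemma continuous_ae_unique f g : continuous_on `]a, b[ f -> continuous_on `]a, b[ g ->
  ae_eq_on `]a, b[ f g -> forall x, x \in `]a, b[ -> f x = g x.
Proof.
move=> cf cg [N [mN N0 hN]] x xab; apply: contrapT => fg.
have e0 : 0 < cmod (f x - g x).
  rewrite lt_neqAle cmod_ge0 andbT eq_sym cmod_eq0 subr_eq0; exact/eqP.
have /continuous_onP/(_ x xab _ e0)[d d0 hd] := continuous_on_sub cf cg.
move: (xab); rewrite in_itv/= => /andP[ax xb].
pose y := Num.min b (x + d).
have xy : x < y by rewrite lt_min xb ltrDl.
have : (mu `]x, y[ <= mu N)%E.
  apply: le_measure; rewrite ?inE// => t /=; rewrite in_itv/= lt_min => /and3P[xt tb td].
  apply: hN => /= h.
  have tab : `]a, b[%classic t by rewrite /= in_itv/= (lt_trans ax xt).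
  have := hd t tab; rewrite gtr0_norm ?subr_gt0// ltrBlDl => /(_ td).
  by rewrite (h tab) subrr sub0r cmodN ltxx.
rewrite N0 lebesgue_measure_itv/= lte_fin xy -EFinB lee_fin; lra.
Qed.

(** [xget] selects some continuous representative; by uniqueness every choice has the same values on
    ]a, b[. *)
Lemma cont_reprE f H : ae_eq_on `]a, b[ H f -> continuous_on `]a, b[ H ->
  forall x, x \in `]a, b[ -> cont_repr a b f x = H x.
Proof.
move=> Hf cH; rewrite /cont_repr; case: xgetP => [h _ [hf ch]|/(_ H)]; last by case.
apply: continuous_ae_unique => //.
by apply: (ae_imp2 hf Hf) => x h1 h2 xab; rewrite h1// h2.
Qed.

Lemma cont_repr_ae f : ae_eq_on `]a, b[ (cont_repr a b f) f.
Proof.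
rewrite /cont_repr; case: xgetP => [h _ [hf ch]|_]; first exact: hf.
exact: aeW.
Qed.

End Primitive.

(** All derivatives are exhibited at once. A derivative along A at a point of A sees values on A
    only, so at each step [G i] may replace the iterated [derive_on]. *)
Lemma deriven_onE {R : realType} (A : set R) (m : nat) (f : R -> R[i]) (G : nat -> R -> R[i]) :
  (forall x, A x -> accum A x) -> (forall x, A x -> f x = G 0%N x) ->
  (forall i x, (i < m)%N -> A x -> cderiv A (G i) x (G i.+1 x)) ->
  forall i x, (i <= m)%N -> A x -> deriven_on A i f x = G i x.
Proof.
move=> acc f0 hG; elim=> [|i ih] x im Ax; first exact: f0.
rewrite /deriven_on iterS -/(deriven_on A i f); apply: derive_onE; first exact: acc.
apply: (eq_cderiv (f := G i)) => //; last exact: hG.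
by move=> y Ay; rewrite ih// ltnW.
Qed.

(** * Recursion for Gamma and the normalised kernels *)

Section GammaFunction.
Context {R : realType}.
Local Notation mu := (@lebesgue_measure R).
Local Notation L1 := (cintble mu setT).
Implicit Types p q z : R[i].

Lemma Gamma_integralE p : Gamma_integral p = cgamma p.
Proof.
rewrite /Gamma_integral /cgamma -[LHS]/(cint mu _ _) cint_mkcond.
apply: eq_cint => t _; rewrite /ker; case: ifPn => t0.
  by rewrite zextT ?mul1r//= in_itv/= t0.
by rewrite zextF//= in_itv/= andbT; exact/negP.
Qed.

Lemma Gamma_pos p : 0 < cRe p -> Gamma p = cgamma p.
Proof.
by move=> p0; rewrite /Gamma p0 big_ord0 divr1 addr0 Gamma_integralE.
Qed.

Lemma cgamma1 : cgamma (1 : R[i]) = 1.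
Proof. by rewrite -[1 in LHS]/(1%:C) fine_rgamma// rgamma1. Qed.

Lemma ker0E p t : 0 < t -> ker 0 p t = cpow t (p - 1).
Proof. by move=> t0; rewrite /ker t0 mul0r oppr0 expR0 mulr1. Qed.

Lemma ker0_le0 p t : t <= 0 -> ker 0 p t = 0.
Proof. by move=> t0; rewrite /ker ltNge t0. Qed.

(** [ker 0 1] is the indicator of t > 0, so its convolution integral with [ker 0 p] at x runs over
    ]0, x[, and [L1_ker_conv] applies. *)
Lemma cintble_ker_itv p (x : R) : 0 < cRe p -> cintble mu `]0, x[ (ker 0 p).
Proof.
move=> p0; have one0 : 0 < cRe (1 : R[i]) by [].
have := L1_ker_conv x one0 p0.
have mI : measurable (`]0, x[%classic : set (measurableTypeR R)) by exact: measurable_itv.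
move=> h; apply/(cintble_mkcond mu (ker 0 p) mI); apply: eq_cintble h => // t _.
have [t0|t0] := leP t 0.
  by rewrite (ker0_le0 p t0) mulr0 zextF//= in_itv/= ltNge t0.
have [xt|tx] := leP x t.
  by rewrite ker0_le0 ?subr_le0// mul0r zextF//= in_itv/= (ltNge t x) xt andbF.
by rewrite ker0E ?subr_gt0// subrr cpowr0 mul1r zextT//= in_itv/= t0 tx.
Qed.

Lemma Prim_ker p (x : R) : 0 < cRe p ->
  Prim 0 (ker 0 p) x = cbeta 1 p * ker 0 (p + 1) x.
Proof.
move=> p0; rewrite addrC -ker_conv// /Prim cint_mkcond; apply: eq_cint => t _.
have [t0|t0] := leP t 0.
  by rewrite (ker0_le0 p t0) mulr0 zextF//= in_itv/= ltNge t0.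
have [xt|tx] := leP x t.
  by rewrite (@ker0_le0 1) ?subr_le0// mul0r zextF//= in_itv/= (ltNge t x) xt andbF.
by rewrite (@ker0E 1) ?subr_gt0// subrr cpowr0 mul1r zextT//= in_itv/= t0 tx.
Qed.

(* Differentiating [Prim_ker] at 1. *)
Lemma cbeta1 p : 0 < cRe p -> cbeta 1 p = p^-1.
Proof.
move=> p0.
have ab : (0 : R) < 2 by [].
have x1 : (1 : R) \in `[0, 2] by rewrite in_itv/= ler01 ler1n.
have d1 : cderiv `[0, 2] (Prim 0 (ker 0 p)) 1 1.
  apply: Prim_cderiv => //; first exact: cintble_ker_itv.
  move=> e e0; have D := cderiv_cpow (p - 1) (@ltr01 R).
  have [d d0 hd] := cderiv_continuous_at D e0; exists d => // y.
  rewrite in_itv/= => /andP[y0 _] yd; rewrite ker0E// -[X in _ - X](cpow1 (p - 1)); apply: ltW.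
  exact: hd.
have d2 : cderiv `[0, 2] (Prim 0 (ker 0 p)) 1 (cbeta 1 p * p).
  have D := cderivZ (cbeta 1 p) (cderivS (@subsetT _ `]0, 2[%classic) (cderiv_cpow p (@ltr01 R))).
  rewrite cpow1 mulr1 in D => e e0; have [d d0 hd] := D e e0.
  exists (Num.min d 1); first by rewrite lt_min d0 ltr01.
  move=> y _; rewrite lt_min => /andP[yd y1].
  have y0 : 0 < y by move: y1; rewrite ltr_norml; lra.
  have y2 : y < 2 by move: y1; rewrite ltr_norml; lra.
  rewrite !Prim_ker// !ker0E// addrK; apply: hd => //.
  by rewrite /= in_itv/= y0.
have acc := accum_cc ab x1.
have := derive_onE acc d2; rewrite (derive_onE acc d1) => e1.
have pn0 : p != 0 by apply: contraTneq p0 => ->; rewrite ltxx.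
by apply: (mulIf pn0); rewrite mulVf.
Qed.

Lemma cgammaS p : 0 < cRe p -> cgamma (p + 1) = p * cgamma p.
Proof.
move=> p0; have one0 : 0 < cRe (1 : R[i]) by [].
have pn0 : p != 0 by apply: contraTneq p0 => ->; rewrite ltxx.
have := cgammaM one0 p0.
rewrite cgamma1 mul1r (addrC 1 p) => ->.
by rewrite cbeta1// mulrA divff// mul1r.
Qed.

(** By the recursion a zero at p would propagate to every p + k. The threshold of
    [cgamma_neq0_large] depends on the imaginary part only, which these shifts leave fixed, so some
    p + N lies beyond it. *)
Lemma cgamma_neq0 p : 0 < cRe p -> cgamma p != 0.
Proof.
move=> p0; pose tau := cIm p.
pose N := (Num.truncn (6 + 3 * tau ^+ 2)).+1.
have hN : 6 + 3 * tau ^+ 2 < N%:R by exact: truncnS_gt.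
apply/eqP => g0.
have hk (k : nat) : cgamma (p + k%:R) = 0.
  elim: k => [|k ih]; first by rewrite addr0.
  rewrite -natr1 addrA cgammaS ?ih ?mulr0// cReD cRe_nat.
  by rewrite ltr_wpDr.
have := hk N; apply/eqP.
have -> : p + N%:R = (cRe p + N%:R) +i* tau.
  by apply: complex_ext; rewrite ?cReD ?cImD ?cRe_nat ?cIm_nat ?addr0.
apply: cgamma_neq0_large; lra.
Qed.

Lemma Gamma_neq0 p : 0 < cRe p -> Gamma p != 0.
Proof. by move=> p0; rewrite Gamma_pos// cgamma_neq0. Qed.

(** Written with inverses, the recursion holds at every z, the poles included: for Re z <= 0 the
    product defining Gamma z has exactly one factor, z, more than the one for Gamma (z + 1), and the
    shifted arguments coincide. *)
Lemma invGamma_rec z : (Gamma z)^-1 = z * (Gamma (z + 1))^-1.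
Proof.
have [z0|z0] := ltP 0 (cRe z).
  rewrite !Gamma_pos ?cReD ?addr_gt0// cgammaS//.
  have zn0 : z != 0 by apply: contraTneq z0 => ->; rewrite ltxx.
  by rewrite invfM mulrA divff// mul1r.
set r := cRe z in z0.
(* The definition of Gamma uses N + 1 factors at z and N factors at z + 1. *)
pose N := absz (Num.floor (- r)).
have fl : Num.floor (- r) = N%:Z.
  by rewrite /N gez0_abs// floor_ge0 oppr_ge0.
have e1 : Gamma z = Gamma_integral (z + N.+1%:R) / \prod_(i < N.+1) (z + i%:R).
  by rewrite /Gamma -/r ltNge z0 /= fl -(PoszD N 1) absz_nat addn1.
have e2 : Gamma (z + 1) = Gamma_integral (z + N.+1%:R) / \prod_(i < N) (z + 1 + i%:R).
  rewrite /Gamma cReD -/r /=.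
  have -> : (if 0 < r + 1 then 0%N else absz (Num.floor (- (r + 1)) + 1)) = N.
    have := floor_itv (- r); rewrite fl => /andP[f1 f2].
    case: ifPn => [r1|]; last first.
      move=> _; rewrite opprD -[-1]/((-1)%:~R) floorDrz ?intr_int// ?fl.
      by rewrite intrKfloor subrK absz_nat.
    (* When Re (z + 1) > 0, the bounds N <= - r < 1 force N = 0. *)
    move: f1; rewrite -pmulrn => f1.
    have : N%:R < (1 : R) by lra.
    by rewrite ltrn1; case: (N).
  congr (Gamma_integral _ / _).
  by rewrite -addrA -(natrD _ 1).
rewrite e1 e2 big_ord_recl /= addr0.
rewrite (_ : \prod_(i < N) (z + (bump 0 i)%:R) = \prod_(i < N) (z + 1 + i%:R)); last first.
  by apply: eq_bigr => i _; rewrite /bump add1n -natr1 addrA (addrAC z).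
by rewrite !invfM !invrK mulrC -!mulrA; congr (_ * _); rewrite mulrC.
Qed.

Lemma Gamma1 : Gamma (1 : R[i]) = 1.
Proof. by rewrite Gamma_pos//= cgamma1. Qed.

Lemma invGamma_Nnat (k : nat) : (Gamma (- k%:R : R[i]))^-1 = 0.
Proof.
elim: k => [|k ih]; first by rewrite invGamma_rec oppr0 mul0r.
by rewrite invGamma_rec -natr1 opprD subrK ih mulr0.
Qed.

(** The kernel K_p for every complex p, extended by 0 to t <= 0. Since 1 / Gamma vanishes at the
    poles, it is identically 0 for p = 0, -1, -2, ... *)
Definition Kr p (t : R) : R[i] := (Gamma p)^-1 * ker 0 p t.

(** [invGamma_rec] supplies the factor p for every p, so the poles form no exception. *)
Lemma Kr_cderiv p (t : R) : 0 < t -> cderiv setT (Kr (p + 1)) t (Kr p t).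
Proof.
move=> t0; have D := cderivZ (Gamma (p + 1))^-1 (cderiv_cpow p t0).
have -> : Kr p t = (Gamma (p + 1))^-1 * (p * cpow t (p - 1)).
  by rewrite /Kr ker0E// invGamma_rec; ring.
move=> e e0; have [d d0 hd] := D e e0.
exists (Num.min d t); first by rewrite lt_min d0 t0.
move=> y _; rewrite lt_min => /andP[yd yt].
have y0 : 0 < y by move: yt; rewrite ltr_norml => /andP[h _]; lra.
by rewrite /Kr !ker0E// addrK; exact: hd.
Qed.

Lemma Kr_nat (k : nat) (t : R) : 0 < t -> Kr (k.+1%:R) t = (t ^+ k / k`!%:R)%:C.
Proof.
move=> t0; rewrite /Kr ker0E// -natr1 addrK cpow_nat ?ltW//.
have -> : (Gamma (k%:R + 1 : R[i]))^-1 = (k`!%:R)^-1.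
  elim: k => [|k ih]; first by rewrite add0r Gamma1.
  have e := invGamma_rec (k%:R + 1 : R[i]); rewrite ih natr1 in e.
  have k0 : k.+1%:R != 0 :> R[i] by rewrite pnatr_eq0.
  have f0 : k`!%:R != 0 :> R[i] by rewrite pnatr_eq0 -lt0n fact_gt0.
  apply: (mulfI k0); rewrite -e factS natrM.
  by move: (k.+1%:R) (k`!%:R) k0 f0 => u v u0 v0; field; rewrite u0 v0.
by rewrite rmorphM fmorphV rmorph_nat mulrC.
Qed.

Lemma Kr_Nnat (k : nat) (t : R) : Kr (- k%:R) t = 0.
Proof. by rewrite /Kr invGamma_Nnat mul0r. Qed.

(** This is where the non-vanishing of Gamma enters: in Gamma p Gamma q = B(p, q) Gamma (p + q) all
    three Gamma values have to be inverted. *)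
Lemma invGammaM p q : 0 < cRe p -> 0 < cRe q ->
  (Gamma p)^-1 * (Gamma q)^-1 * cbeta p q = (Gamma (p + q))^-1.
Proof.
move=> p0 q0; have pq0 : 0 < cRe (p + q) by rewrite cReD addr_gt0.
rewrite !Gamma_pos//; have := cgammaM p0 q0.
have := cgamma_neq0 p0; have := cgamma_neq0 q0; have := cgamma_neq0 pq0.
move: (cgamma p) (cgamma q) (cgamma (p + q)) (cbeta p q) => u v w B w0 v0 u0 e.
have -> : B = u * v / w by rewrite e mulfK.
by field; rewrite u0 v0 w0.
Qed.

Lemma Kr_conv p q (x : R) : 0 < cRe p -> 0 < cRe q ->
  conv (Kr p) (Kr q) x = Kr (p + q) x.
Proof.
move=> p0 q0; rewrite /Kr -invGammaM// -mulrA -ker_conv// /conv -cintZ//; last exact: L1_ker_conv.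
by apply: eq_cint => t _; ring.
Qed.

End GammaFunction.

(** * Fractional integrals *)

Section RiemannLiouville.
Context {R : realType}.
Local Notation mu := (@lebesgue_measure R).
Local Notation L1 := (cintble mu setT).
Variables (a b : R).
Hypothesis ab : a < b.
Implicit Types (p q beta gamma : R[i]) (f g : R -> R[i]).

Local Notation I := (`]a, b[%classic : set (measurableTypeR R)).
Local Notation Lab := (cintble mu I).

Let mI : measurable I. Proof. exact: measurable_itv. Qed.

Lemma L1_zext f : Lab f -> L1 (zext I f).
Proof. by move=> /(cintble_mkcond mu f mI). Qed.

Lemma Lab_zext f : L1 f -> Lab f.
Proof. exact: cintbleS. Qed.

(* Kernel cut off beyond the length of the interval, which makes it integrable. *)
Definition kerT p (t : R) : R[i] := if t < b - a then ker 0 p t else 0.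

Lemma L1_kerT p : 0 < cRe p -> L1 (kerT p).
Proof.
move=> p0; have mJ : measurable (`]0, b - a[%classic : set (measurableTypeR R)) by exact: measurable_itv.
have := (cintble_mkcond mu _ mJ).1 (cintble_ker_itv (b - a) p0).
apply: eq_cintble => // t _; rewrite /kerT; case: ifPn => tb.
  have [t0|t0] := ltP 0 t; first by rewrite zextT//= in_itv/= t0.
  by rewrite ker0_le0// zextF//= in_itv/= ltNge t0.
by rewrite zextF//= in_itv/= (negbTE tb) andbF.
Qed.

Lemma conv_kerT p f (x : R) : x < b -> conv (kerT p) (zext I f) x = conv (ker 0 p) (zext I f) x.
Proof.
move=> xb; apply: eq_cint => t _; have [tI|tI] := pselect (I t); last by rewrite zextF// !mulr0.
rewrite /kerT ifT//; move: tI; rewrite /= in_itv/= => /andP[ta tb]; lra.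
Qed.

(** The kernel vanishes for t >= x and the extension of f for t <= a, so the integral over ]a, x[ is
    a convolution on the whole line. *)
Lemma rl_integralE p f (x : R) : p != 0 -> x \in `]a, b[ ->
  rl_integral a p f x = (Gamma p)^-1 * conv (ker 0 p) (zext I f) x.
Proof.
move=> p0; rewrite in_itv/= => /andP[ax xb]; rewrite /rl_integral (negbTE p0).
congr (_ * _); rewrite -[LHS]/(cint mu _ _) cint_mkcond; apply: eq_cint => t _.
have [tx|xt] := ltP t x; last first.
  by rewrite zextF ?ker0_le0 ?mul0r ?subr_le0//= in_itv/= (ltNge t x) xt andbF.
have [at_|ta] := ltP a t; last first.
  by rewrite !zextF ?mulr0//= in_itv/= (ltNge a t) ta.
rewrite !zextT ?ker0E ?subr_gt0//= in_itv/= at_ ?tx//.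
exact: lt_trans tx xb.
Qed.

Lemma rl_integral0 f x : rl_integral a 0 f x = f x.
Proof. by rewrite /rl_integral eqxx. Qed.

Lemma Re_gt0_neq0 p : 0 < cRe p -> p != 0.
Proof. by apply: contraTneq => ->; rewrite ltxx. Qed.

Lemma ae_cintble_ker p f : 0 < cRe p -> Lab f ->
  {ae mu, forall x, x \in `]a, b[ -> L1 (fun t => ker 0 p (x - t) * zext I f t)}.
Proof.
move=> p0 fi; apply: (ae_imp (ae_cintble_conv (L1_kerT p0) (L1_zext fi))) => x h.
rewrite in_itv/= => /andP[ax xb]; apply: eq_cintble h => // t _.
have [tI|tI] := pselect (I t); last by rewrite zextF// !mulr0.
by rewrite /kerT ifT//; move: tI; rewrite /= in_itv/= => /andP[ta tb]; lra.
Qed.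

Lemma rl_integral_ae p f g x : cmeas I f -> cmeas I g -> p != 0 -> ae_eq_on `]a, b[ f g ->
  x \in `]a, b[ -> rl_integral a p f x = rl_integral a p g x.
Proof.
move=> mf mg p0 fg xab; rewrite !rl_integralE//; congr (_ * _).
have mk (h : R -> R[i]) : cmeas I h -> cmeas [set: R] (fun t => ker 0 p (x - t) * zext I h t).
  move=> mh; apply: cmeasM; last exact: (cmeas_restrict h mI).1 mh.
  apply: (cmeas_comp (phi := fun t : measurableTypeR R => x - t)); last exact: measurable_ker.
  exact: measurable_funB.
apply: ae_eq_cint => //; [exact: mk|exact: mk|].
apply: (ae_imp fg) => t h _; have [tI|tI] := pselect (I t).
  by rewrite !zextT// h.
by rewrite !zextF.
Qed.

Lemma rl_integral_cintble p f : 0 < cRe p -> Lab f -> Lab (rl_integral a p f).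
Proof.
move=> p0 fi; have := cintbleZ (Gamma p)^-1 measurableT (cintble_conv (L1_kerT p0) (L1_zext fi)).
move=> /Lab_zext; apply: eq_cintble => // x; rewrite inE => xI.
rewrite rl_integralE//; last exact: Re_gt0_neq0.
by rewrite conv_kerT//; move: xI; rewrite /= in_itv/= => /andP[].
Qed.

(** Associativity of convolution, with truncated kernels so that all three factors lie in L^1; the
    truncation is invisible on ]a, b[. The constants combine by [invGammaM]. *)
Lemma rl_integral_comp p q f : 0 < cRe p -> 0 < cRe q -> Lab f ->
  {ae mu, forall x, x \in `]a, b[ ->
    rl_integral a p (rl_integral a q f) x = rl_integral a (p + q) f x}.
Proof.
move=> p0 q0 fi; have pn0 := Re_gt0_neq0 p0; have qn0 := Re_gt0_neq0 q0.
have pq0 : 0 < cRe (p + q) by rewrite cReD addr_gt0.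
have fz := L1_zext fi.
pose g := conv (kerT q) (zext I f).
have gi : L1 g by exact: cintble_conv (L1_kerT q0) fz.
have gI : Lab g by exact: Lab_zext.
have E := conv_assoc (L1_kerT p0) (L1_kerT q0) fz.
have H1 := ae_cintble_ker p0 gI.
apply: (ae_imp2 (ae_imp2 E H1 (fun x e h => conj e h)) (ae_cintble_ker pq0 fi)) => x [e h1] h2 xab.
have [ax xb] : a < x /\ x < b by move: xab; rewrite in_itv/= => /andP[].
rewrite !rl_integralE//; last exact: Re_gt0_neq0.
rewrite -invGammaM// -!mulrA; congr (_ * _).
have -> : conv (ker 0 p) (zext I (rl_integral a q f)) x =
    (Gamma q)^-1 * conv (ker 0 p) (zext I g) x.
  rewrite /conv -cintZ//; last exact: h1.
  apply: eq_cint => t _; have [tI|tI] := pselect (I t); last by rewrite !zextF// !mulr0.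
  rewrite !zextT// rl_integralE// /g conv_kerT; first by ring.
  by move: tI; rewrite /= in_itv/= => /andP[].
congr (_ * _); rewrite -conv_kerT//.
(* For t <= a the function g is 0 because f is supported in ]a, b[; for t >= b > x the kernel is
   0. *)
have -> : conv (kerT p) (zext I g) x = conv (kerT p) g x.
  apply: eq_cint => t _; have [tI|tI] := pselect (I t); first by rewrite zextT.
  rewrite zextF// mulr0; have [ta|at_] := leP t a.
    suff -> : g t = 0 by rewrite mulr0.
    rewrite -[RHS](cint0 mu setT); apply: eq_cint => s _.
    have [sI|sI] := pselect (I s); last by rewrite zextF// mulr0.
    move: sI; rewrite /= in_itv/= => /andP[sa sb].
    by rewrite /kerT ker0_le0 ?if_same ?mul0r// subr_le0; lra.
  have [bt|tb] := leP b t; last by exfalso; apply: tI; rewrite /= in_itv/= at_.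
  by rewrite /kerT ker0_le0 ?if_same ?mul0r// subr_le0; lra.
rewrite /g e /conv -[RHS]cintZ//; last exact: h2.
apply: eq_cint => s _; have [sI|sI] := pselect (I s); last by rewrite zextF// !mulr0.
rewrite mulrA; congr (_ * _); rewrite -ker_conv//; apply: eq_cint => t _.
move: sI; rewrite /= in_itv/= => /andP[sa sb].
(* The product is nonzero at most for 0 < t < x - s < b - a, where neither truncation acts. *)
have [t0|t0] := leP t 0; first by rewrite /kerT (ker0_le0 q t0) if_same !mulr0.
have [ts|st] := leP (x - s) t.
  by rewrite /kerT (ker0_le0 p) ?if_same ?mul0r// subr_le0.
by rewrite /kerT !ifT//; lra.
Qed.

Lemma rl_integral_Kr p q x : 0 < cRe p -> 0 < cRe q -> x \in `]a, b[ ->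
  rl_integral a p (fun y => Kr q (y - a)) x = Kr (p + q) (x - a).
Proof.
move=> p0 q0 xab; rewrite rl_integralE//; last exact: Re_gt0_neq0.
rewrite -Kr_conv//.
have ki : L1 (fun t => Kr p (x - a - t) * Kr q t).
  have := cintbleZ ((Gamma p)^-1 * (Gamma q)^-1) measurableT (L1_ker_conv (x - a) p0 q0).
  by apply: eq_cintble => // t _; rewrite /Kr; ring.
rewrite /conv -(cint_shift a ki) -cintZ//.
- apply: eq_cint => t _; rewrite /Kr.
  have -> : x - a - (t - a) = x - t by ring.
  have [tI|tI] := pselect (I t); first by rewrite zextT//; ring.
  rewrite zextF// !mulr0; have [ta|at_] := leP t a.
    by rewrite (ker0_le0 q) ?subr_le0// !mulr0.
  have [bt|tb] := leP b t; last by exfalso; apply: tI; rewrite /= in_itv/= at_.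
  move: xab; rewrite in_itv/= => /andP[ax xb].
  by rewrite (ker0_le0 p) ?mulr0 ?mul0r// subr_le0; lra.
- have := (cintble_shift a (cintble_meas ki)).2 ki.
  move=> /(cintbleZ (Gamma p) measurableT); apply: eq_cintble => // t _.
  have -> : x - a - (t - a) = x - t by ring.
  have gp := Gamma_neq0 p0.
  have [tI|tI] := pselect (I t); first by rewrite zextT// [Kr p _]/Kr; field.
  rewrite zextF// !mulr0; have [ta|at_] := leP t a.
    by rewrite /Kr (ker0_le0 q) ?subr_le0// !mulr0.
  have [bt|tb] := leP b t; last by exfalso; apply: tI; rewrite /= in_itv/= at_.
  move: xab; rewrite in_itv/= => /andP[ax xb].
  by rewrite /Kr (ker0_le0 p) ?mulr0 ?mul0r ?mulr0// subr_le0; lra.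
Qed.

Lemma Lab_Kr q : 0 < cRe q -> Lab (fun y => Kr q (y - a)).
Proof.
move=> q0; have k1 := cintbleZ (Gamma q)^-1 measurableT (L1_kerT q0).
have := (cintble_shift a (cintble_meas k1)).2 k1; move=> /Lab_zext.
apply: eq_cintble => // y; rewrite inE /= in_itv/= => /andP[ya yb].
by rewrite /Kr /kerT ifT// ltrD2r.
Qed.

Lemma rl_integral1 f x : rl_integral a 1 f x = Prim a f x.
Proof.
rewrite /rl_integral oner_eq0 Gamma1 invr1 mul1r -[LHS]/(cint mu _ _).
by apply: eq_cint => t _; rewrite subrr cpowr0 mul1r.
Qed.

(** Exponents for which [rl_integral a p] acts on L^1. The value 0, where it is the identity, occurs
    as n - alpha for natural alpha and as alpha - beta for beta = alpha. *)
Definition rl_ok p := p = 0 \/ 0 < cRe p.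

Lemma rl_ok_nat (k : nat) : rl_ok k%:R.
Proof. by case: k => [|k]; [left|right; rewrite cRe_nat]. Qed.

Lemma rl_cintble p f : rl_ok p -> Lab f -> Lab (rl_integral a p f).
Proof.
move=> [->|p0] fi; last exact: rl_integral_cintble.
by apply: eq_cintble fi => // x _; rewrite rl_integral0.
Qed.

Lemma rl_ae p f g : rl_ok p -> Lab f -> Lab g -> ae_eq_on `]a, b[ f g ->
  ae_eq_on `]a, b[ (rl_integral a p f) (rl_integral a p g).
Proof.
move=> [->|p0] fi gi fg.
  by apply: (ae_imp fg) => x h xab; rewrite !rl_integral0 h.
apply: aeW => x xab; apply: rl_integral_ae => //.
- exact: cintble_meas fi.
- exact: cintble_meas gi.
- exact: Re_gt0_neq0.
Qed.

Lemma rl_comp p q f : rl_ok p -> rl_ok q -> Lab f ->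
  ae_eq_on `]a, b[ (rl_integral a p (rl_integral a q f)) (rl_integral a (p + q) f).
Proof.
move=> [->|p0] hq fi; first by apply: aeW => x _; rewrite rl_integral0 add0r.
case: hq => [->|q0]; last exact: rl_integral_comp.
apply: aeW => x xab; rewrite addr0; apply: rl_integral_ae => //.
- have h0 : rl_ok 0 by left.
  exact: cintble_meas (rl_cintble h0 fi).
- exact: cintble_meas fi.
- exact: Re_gt0_neq0.
- by apply: aeW => y _; rewrite rl_integral0.
Qed.

Lemma rlD p f g : rl_ok p -> Lab f -> Lab g ->
  ae_eq_on `]a, b[ (rl_integral a p (fun y => f y + g y))
    (fun x => rl_integral a p f x + rl_integral a p g x).
Proof.
move=> [->|p0] fi gi; first by apply: aeW => x _; rewrite !rl_integral0.
have pn0 := Re_gt0_neq0 p0.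
apply: (ae_imp2 (ae_cintble_ker p0 fi) (ae_cintble_ker p0 gi)) => x hf hg xab.
rewrite !rl_integralE// -mulrDr /conv -cintD//; [|exact: hf|exact: hg].
congr (_ * _); apply: eq_cint => t _; have [tI|tI] := pselect (I t).
  by rewrite !zextT// mulrDr.
by rewrite !zextF// !mulr0 addr0.
Qed.

Lemma rlZ p f (c : R[i]) : rl_ok p -> Lab f ->
  ae_eq_on `]a, b[ (rl_integral a p (fun y => c * f y)) (fun x => c * rl_integral a p f x).
Proof.
move=> [->|p0] fi; first by apply: aeW => x _; rewrite !rl_integral0.
have pn0 := Re_gt0_neq0 p0.
apply: (ae_imp (ae_cintble_ker p0 fi)) => x hf xab.
rewrite !rl_integralE// mulrCA /conv -[X in _ = _ * X]cintZ//; last exact: hf.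
congr (_ * _); apply: eq_cint => t _; have [tI|tI] := pselect (I t).
  by rewrite !zextT//; ring.
by rewrite !zextF// !mulr0.
Qed.

Lemma rl_sum p (J : Type) (s : seq J) (f : J -> R -> R[i]) : rl_ok p ->
  (forall i, Lab (f i)) ->
  ae_eq_on `]a, b[ (rl_integral a p (fun y => \sum_(i <- s) f i y))
    (fun x => \sum_(i <- s) rl_integral a p (f i) x).
Proof.
move=> hp fi; elim: s => [|i s ih].
  case: hp => [->|p0]; first by apply: aeW => x _; rewrite rl_integral0 !big_nil.
  apply: aeW => x xab; rewrite big_nil rl_integralE//; last exact: Re_gt0_neq0.
  rewrite (_ : conv _ _ _ = 0) ?mulr0// -[RHS](cint0 mu setT); apply: eq_cint => t _.
  have [tI|tI] := pselect (I t); first by rewrite zextT// big_nil mulr0.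
  by rewrite zextF// mulr0.
have si : Lab (fun y => \sum_(i <- s) f i y) by exact: cintble_sum.
have e : (fun y => \sum_(j <- i :: s) f j y) = (fun y => f i y + \sum_(j <- s) f j y).
  by apply/funext => y; rewrite big_cons.
rewrite e; apply: (ae_imp2 ih (rlD hp (fi i) si)) => x h1 h2 xab.
by rewrite h2// big_cons h1.
Qed.

Lemma rl_Kr p q : rl_ok p -> 0 < cRe q ->
  ae_eq_on `]a, b[ (rl_integral a p (fun y => Kr q (y - a))) (fun x => Kr (p + q) (x - a)).
Proof.
move=> [->|p0] q0; apply: aeW => x xab; last exact: rl_integral_Kr.
by rewrite rl_integral0 add0r.
Qed.

Lemma iter_Prim_cintble (m : nat) f : Lab f -> Lab (iter m (Prim a) f).
Proof. by move=> fi; elim: m => //= m ih; exact: Prim_cintble. Qed.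

Lemma rl_nat (m : nat) f : Lab f ->
  ae_eq_on `]a, b[ (rl_integral a m%:R f) (iter m (Prim a) f).
Proof.
move=> fi; elim: m => [|m ih]; first by apply: aeW => x _; rewrite rl_integral0.
have h := rl_comp (rl_ok_nat 1) (rl_ok_nat m) fi.
apply: (ae_imp h) => x {}h xab; rewrite -add1n natrD -h// /=.
rewrite -rl_integral1; apply: rl_integral_ae => //.
- exact: cintble_meas (rl_cintble (rl_ok_nat m) fi).
- exact: cintble_meas (iter_Prim_cintble m fi).
Qed.

(** The primitive is continuous, hence zero everywhere on ]a, b[; its derivative is then 0, and it
    is f almost everywhere. *)
Lemma Prim_eq0 f : Lab f -> ae_eq_on `]a, b[ (Prim a f) (fun=> 0) -> ae_eq_on `]a, b[ f (fun=> 0).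
Proof.
move=> fi f0.
have h0 x : x \in `]a, b[ -> Prim a f x = 0.
  apply: (continuous_ae_unique (g := fun=> 0)) => //.
    have sub : `]a, b[%classic `<=` `[a, b]%classic by exact: subset_itv_oo_cc.
    exact: (continuous_onS sub (Prim_continuous fi)).
  exact: (cderiv_continuous (l := fun=> 0) (fun x _ => @cderiv_cst R _ 0 x)).
apply: (ae_imp (ae_Prim_cderiv fi)) => x h xab.
have xab' : x \in `[a, b] by exact: subset_itv_oo_cc xab.
have acc := accum_oo ab xab'.
rewrite -(derive_onE acc (h xab)).
apply: derive_onE => //; apply: (eq_cderiv (f := fun=> 0)) => //.
  by move=> y yab; rewrite h0.
exact: cderiv_cst.
Qed.

Lemma iter_Prim_eq0 (m : nat) f : Lab f ->
  ae_eq_on `]a, b[ (iter m (Prim a) f) (fun=> 0) -> ae_eq_on `]a, b[ f (fun=> 0).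
Proof.
by move=> fi; elim: m => //= m ih h; apply: ih; apply: Prim_eq0 => //; exact: iter_Prim_cintble.
Qed.

(* Composing with a further fractional integral reduces to an iterated primitive. *)
Lemma rl_eq0 p q (m : nat) f : rl_ok p -> rl_ok q -> q + p = m%:R -> Lab f ->
  ae_eq_on `]a, b[ (rl_integral a p f) (fun=> 0) -> ae_eq_on `]a, b[ f (fun=> 0).
Proof.
move=> hp hq hm fi f0; apply: (@iter_Prim_eq0 m) => //.
have h1 := rl_comp hq hp fi; rewrite hm in h1.
have h2 := rl_ae hq (rl_cintble hp fi) (cintble0 mu I) f0.
have h3 := rlZ 0 hq fi.
apply: (ae_imp2 (ae_imp2 h1 h2 (fun x u v => conj u v)) (ae_imp2 h3 (rl_nat m fi) (fun x u v => conj u v))).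
move=> x [e1 e2] [e3 e4] xab; rewrite -e4// -e1// e2//.
have := e3 xab; under eq_fun do rewrite mul0r.
by move=> ->; rewrite mul0r.
Qed.

End RiemannLiouville.

(** * Absolutely continuous functions are primitives *)

Section Variation.
Context {R : realType} (a b : R) (ab : a < b).
Implicit Types (F : R -> R) (L : seq (R * R)).

Definition nonoverlap (p q : R * R) := (p.2 <= q.1) || (q.2 <= p.1).

Definition disj_intervals L :=
  all (fun p => [&& a <= p.1, p.1 <= p.2 & p.2 <= b]) L && pairwise nonoverlap L.

Definition mesh L := \sum_(p <- L) (p.2 - p.1).

Definition increments F L := \sum_(p <- L) `|F p.2 - F p.1|.

(** Absolute continuity of a real function, with lists of intervals, which can be subdivided by
    induction, and with a non-strict bound, which survives the suprema in total variations. *)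
Definition ac_seq F := forall e : R, 0 < e -> exists2 d : R, 0 < d &
  forall L, disj_intervals L -> mesh L < d -> increments F L <= e.

Lemma disj_intervals_split L1 L2 (u v w : R) : u <= v -> v <= w ->
  disj_intervals (L1 ++ (u, w) :: L2) -> disj_intervals (L1 ++ (u, v) :: (v, w) :: L2).
Proof.
move=> uv vw; rewrite /disj_intervals !all_cat !pairwise_cat /= !allrel_consr.
move=> /and5P[/andP[-> /andP[/and3P[au _ wb] ->]] /andP[h1 ->] -> h2 ->].
rewrite au uv vw wb (le_trans au uv) (le_trans vw wb) /=.
have h1' (p q : R) : u <= p -> q <= w -> all (nonoverlap^~ (p, q)) L1.
  move=> up qw; apply: sub_all h1 => -[x y]; rewrite /nonoverlap/= => /orP[yu|wx].
    by rewrite (le_trans yu up).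
  by rewrite (le_trans qw wx) orbT.
have h2' (p q : R) : u <= p -> q <= w -> all (nonoverlap (p, q)) L2.
  move=> up qw; apply: sub_all h2 => -[x y]; rewrite /nonoverlap/= => /orP[wx|yu].
    by rewrite (le_trans qw wx).
  by rewrite (le_trans yu up) orbT.
by rewrite !h1' ?h2'//= /nonoverlap/= lexx.
Qed.

Lemma disj_intervals_catr L1 L2 : disj_intervals (L1 ++ L2) -> disj_intervals L2.
Proof.
by rewrite /disj_intervals all_cat pairwise_cat => /andP[/andP[_ ->] /and3P[_ _ ->]].
Qed.

Lemma disj_intervals_catl L1 L2 : disj_intervals (L1 ++ L2) -> disj_intervals L1.
Proof.
by rewrite /disj_intervals all_cat pairwise_cat => /andP[/andP[-> _] /and3P[_ -> _]].
Qed.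

(* Induction on L2; a partition of its first interval is moved into L1 piece by
   piece. *)
Lemma increments_tv_le F (d e : R) :
  (forall L, disj_intervals L -> mesh L < d -> increments F L <= e) ->
  forall L2 L1, disj_intervals (L1 ++ L2) -> mesh (L1 ++ L2) < d ->
  ((increments F L1)%:E + \sum_(p <- L2) total_variation p.1 p.2 F <= e%:E)%E.
Proof.
move=> hF; elim=> [|[u w] L2 IH] L1 hL mL.
  by move: hL mL; rewrite cats0 => hL mL; rewrite big_nil adde0 lee_fin hF.
have rest0 (L : seq (R * R)) : disj_intervals L -> (0 <= \sum_(p <- L) total_variation p.1 p.2 F)%E.
  move=> /andP[/allP oL _]; rewrite big_seq; apply: sume_ge0 => p /oL /and3P[_ h _].
  exact: total_variation_ge0.
have uw : u <= w by move: hL; rewrite /disj_intervals all_cat => /andP[/andP[_ /= /andP[/and3P[]]]].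
have key s : forall u L1, disj_intervals (L1 ++ (u, w) :: L2) -> mesh (L1 ++ (u, w) :: L2) < d ->
    itv_partition u w s ->
    ((increments F L1)%:E + ((variation u w F s)%:E + \sum_(p <- L2) total_variation p.1 p.2 F) <= e%:E)%E.
  elim: s => [|v s IHs] {uw hL mL L1}u L1 hL mL hs.
    rewrite /variation big_nil add0e; apply: IH.
      by move: hL; rewrite /disj_intervals !all_cat !pairwise_cat /= !allrel_consr;
        move=> /and5P[/andP[-> /andP[/and3P[au _ wb] ->]] /andP[h1 ->] -> h2 ->].
    have -> // : mesh (L1 ++ L2) = mesh (L1 ++ (u, w) :: L2).
    rewrite /mesh !big_cat/= big_cons/=.
    by move/itv_partition_nil : hs => ->; rewrite subrr add0r.
  have hs2 : itv_partition v w s by exact: itv_partition_cons hs.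
  have uv : u < v by case: hs => /= /andP[].
  have vw : v <= w := itv_partition_le hs2.
  have := IHs v (L1 ++ [:: (u, v)]).
  rewrite -!catA/= => /(_ (disj_intervals_split (ltW uv) vw hL)).
  have -> : mesh (L1 ++ [:: (u, v), (v, w) & L2]) = mesh (L1 ++ (u, w) :: L2).
    by rewrite /mesh !big_cat/= !big_cons/=; lra.
  move=> /(_ mL hs2); apply: le_trans.
  rewrite addeA addeA leeD2r// -!EFinD lee_fin.
  rewrite -[v :: s]cat1s (variation_cat F (ltW uv) vw (itv_partition1 uv) hs2).
  rewrite addrA lerD2r /increments big_cat/= lerD2l big_seq1/=.
  by rewrite /variation big_nat1.
have hL2 : disj_intervals ((u, w) :: L2) := disj_intervals_catr hL.
have rfin : (\sum_(p <- L2) total_variation p.1 p.2 F)%E \is a fin_num.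
  rewrite ge0_fin_numE; last by apply: rest0; exact: (disj_intervals_catr (L1 := [:: _]) hL2).
  apply: (@le_lt_trans _ _ e%:E); last by rewrite ltry.
  have := IH [::]; rewrite /increments big_nil add0e cat0s; apply.
    exact: (disj_intervals_catr (L1 := [:: _]) hL2).
  apply: le_lt_trans mL; rewrite /mesh !big_cat/= big_cons/= addrA lerDr.
  rewrite addr_ge0 ?subr_ge0// big_seq sumr_ge0// => p pL1; rewrite subr_ge0.
  by move/disj_intervals_catl : hL => /andP[/allP/(_ _ pL1)/and3P[]].
rewrite big_cons/= addeA -leeBrDr// -leeBrDl//.
apply: ge_ereal_sup => _ [_ [s hs <-] <-].
by rewrite leeBrDl// leeBrDr// -addeA key.
Qed.

Lemma ac_seq_tv F : ac_seq F -> forall e : R, 0 < e -> exists2 d : R, 0 < d &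
  forall L, disj_intervals L -> mesh L < d ->
    (\sum_(p <- L) total_variation p.1 p.2 F <= e%:E)%E.
Proof.
move=> acF e /acF[d d0 hd]; exists d => // L hL mL.
by have := increments_tv_le hd (L2 := L) (L1 := [::]) hL mL; rewrite /increments big_nil add0e.
Qed.

(** Pieces of length less than d have variation at most 1, and finitely many pieces of length d / 2
    cover [a, x]. *)
Lemma ac_seq_tv_fin F : ac_seq F -> forall x, x \in `[a, b] ->
  total_variation a x F \is a fin_num.
Proof.
move=> /ac_seq_tv/(_ 1 ltr01)[d d0 hd].
have small u v : a <= u -> u <= v -> v <= b -> v - u < d -> (total_variation u v F < +oo)%E.
  move=> au uv vb vud; apply: (@le_lt_trans _ _ 1%:E); last by rewrite ltry.
  have := hd [:: (u, v)]; rewrite big_seq1/=; apply; last by rewrite /mesh big_seq1.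
  by rewrite /disj_intervals/= au uv vb.
have key k : forall x, a <= x -> x <= b -> x - a < k%:R * (d / 2) ->
    (total_variation a x F < +oo)%E.
  elim: k => [|k IH] x ax xb; first by rewrite mul0r subr_lt0 ltNge ax.
  rewrite -natr1 mulrDl mul1r => xk.
  have [xa|xa] := leP x (a + d / 2).
    by apply: small => //; clear -ab d0 ax xb xk xa; lra.
  have h1 : a <= x - d / 2 by clear -ab d0 ax xb xk xa; lra.
  have h2 : x - d / 2 <= x by clear -ab d0 ax xb xk xa; lra.
  rewrite (total_variationD F h1 h2) lte_add_pinfty//.
    by apply: IH => //; [exact: le_trans xb|clear -ab d0 ax xb xk xa; lra].
  by apply: small => //; clear -ab d0 ax xb xk xa; lra.
move=> x; rewrite in_itv/= => /andP[ax xb]; rewrite ge0_fin_numE ?total_variation_ge0//.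
apply: (key (Num.bound ((x - a) / (d / 2)))) => //.
rewrite -ltr_pdivrMr ?divr_gt0//.
by apply: le_lt_trans (archi_boundP _); rewrite ?divr_ge0// ?subr_ge0// ltW.
Qed.

(** The function V of Jordan's decomposition F = V - (V - F): V and V - F are nondecreasing, and
    absolutely continuous when F is. *)
Definition var_fun F x := fine (total_variation a x F).

Lemma var_funB F u v : ac_seq F -> a <= u -> u <= v -> v <= b ->
  (var_fun F v - var_fun F u)%:E = total_variation u v F.
Proof.
move=> acF au uv vb.
have uab : u \in `[a, b] by rewrite in_itv/= au (le_trans uv).
have vab : v \in `[a, b] by rewrite in_itv/= (le_trans au uv).
rewrite EFinB !fineK ?ac_seq_tv_fin// (total_variationD F au uv).
by rewrite addeAC subee ?add0e// ac_seq_tv_fin.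
Qed.

Lemma ac_seq_cont F : ac_seq F -> forall e : R, 0 < e -> exists2 d : R, 0 < d &
  forall x y, a <= x -> x <= y -> y <= b -> y - x < d -> `|F y - F x| <= e.
Proof.
move=> acF e /acF[d d0 hd]; exists d => // x y ax xy yb xyd.
have := hd [:: (x, y)]; rewrite /increments /mesh !big_seq1/=; apply => //.
by rewrite /disj_intervals/= ax xy yb.
Qed.

Lemma ac_seq_var F : ac_seq F -> ac_seq (var_fun F).
Proof.
move=> acF e /(ac_seq_tv acF)[d d0 hd]; exists d => // L hL /(hd _ hL).
rewrite -lee_fin; apply: le_trans; rewrite /increments -sumEFin big_seq [leRHS]big_seq.
apply: lee_sum => p pL; have /andP[/allP/(_ _ pL)/and3P[au uv vb] _] := hL.
have := var_funB acF au uv vb => h; rewrite -h lee_fin ger0_norm// -lee_fin h.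
exact: total_variation_ge0.
Qed.

Lemma var_fun_ge F u v : ac_seq F -> a <= u -> u <= v -> v <= b ->
  `|F v - F u| <= var_fun F v - var_fun F u.
Proof.
by move=> acF au uv vb; rewrite -lee_fin var_funB// total_variation_ge.
Qed.

Lemma ac_seqB F G : ac_seq F -> ac_seq G -> ac_seq (F \- G).
Proof.
move=> acF acG e e0; have e2 : 0 < e / 2 by rewrite divr_gt0.
have [d1 d10 h1] := acF _ e2; have [d2 d20 h2] := acG _ e2.
exists (Num.min d1 d2); first by rewrite lt_min d10.
move=> L hL; rewrite lt_min => /andP[/(h1 _ hL) m1 /(h2 _ hL) m2].
rewrite (splitr e); apply: le_trans (lerD m1 m2); rewrite /increments -big_split/=.
apply: ler_sum => p _; rewrite (_ : F p.2 - G p.2 - _ = (F p.2 - F p.1) - (G p.2 - G p.1)); last by ring.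
exact: ler_normB.
Qed.

End Variation.

(** * Density of an absolutely continuous Lebesgue-Stieltjes measure *)

Section StieltjesDensity.
Context {R : realType} (a b : R) (ab : a < b) (C : cumulative R R).
Hypothesis acC : ac_seq a b C.
Local Notation mu := (@lebesgue_measure R).
Local Notation nu := (lebesgue_stieltjes_measure C).
Local Notation D := (`]a, b]%classic : set (measurableTypeR R)).

Lemma stieltjes_oc (s t : R) : s <= t -> nu `]s, t] = (C t - C s)%:E.
Proof.
move=> st; rewrite /lebesgue_stieltjes_measure/= /measure_extension/=.
by rewrite measurable_mu_extE//=; [rewrite wlength_itv_bnd | exact: is_ocitv].
Qed.

Lemma lebesgue_oc (s t : R) : s <= t -> mu `]s, t] = (t - s)%:E.
Proof.
move=> st; rewrite lebesgue_measure_itv/= lte_fin.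
by case: ltP => [//|ts]; rewrite (_ : t = s) ?subrr//; apply/le_anti; rewrite ts.
Qed.

Lemma trivIset_oc (B : set (set R)) (X Y : set R) (p q : R * R) :
  trivIset B id -> B X -> B Y -> X <> Y -> p.1 < p.2 -> q.1 < q.2 ->
  X = `]p.1, p.2]%classic -> Y = `]q.1, q.2]%classic -> nonoverlap p q.
Proof.
move=> tB BX BY XY p12 q12 Xp Yq; rewrite /nonoverlap; apply/negP => /negP.
rewrite negb_or -!ltNge => /andP[qp pq].
apply: XY; apply: tB => //; exists (Num.min p.2 q.2); rewrite Xp Yq; split.
  by rewrite /= in_itv/= lt_min p12 pq ge_min lexx.
by rewrite /= in_itv/= lt_min qp q12 ge_min lexx orbT.
Qed.

Lemma measure_fset (m : {measure set (measurableTypeR R) -> \bar R})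
    (B : set (set (measurableTypeR R))) : finite_set B -> trivIset B id ->
  (forall X, B X -> measurable X) ->
  (m (\bigcup_(X in B) X) = \sum_(X <- fset_set B) m X)%E.
Proof. by move=> fB tB mB; rewrite measure_fin_bigcup// fsbig_finite. Qed.

(** A set of the ring generated by half-open intervals is a finite disjoint union of them. On such a
    union Lebesgue measure is the [mesh] of the list of intervals and the Stieltjes measure is its
    [increments]. *)
Lemma stieltjes_ring_le (d e : R) : (forall L, disj_intervals a b L -> mesh L < d ->
    increments C L <= e) ->
  forall A : set (SetRing.type (ocitv_type R)), measurable A -> A `<=` D ->
  (mu A < d%:E -> nu A <= e%:E)%E.
Proof.
move=> hde A /SetRing.ring_finite_set[B [finB B0 tB mB ->]] AD.
have mB' X : B X -> measurable (X : set (measurableTypeR R)).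
  by move=> BX; have /mB/ocitvP[->//|[p _ ->]] : X \in B by apply/mem_set.
have mU : measurable (\bigcup_(X in B) X : set (measurableTypeR R)) by exact: fin_bigcup_measurable.
have /choice[p hp] : forall X : set R, exists p : R * R, B X -> p.1 < p.2 /\ X = `]p.1, p.2]%classic.
  move=> X; have [BX|nBX] := pselect (B X); last by exists (0, 0).
  have : ocitv X by apply: mB; rewrite inE.
  by move=> /ocitvP[X0|[p p12 Xp]]; [have [x] := B0 _ BX; rewrite X0|exists p].
rewrite (measure_fset mu finB tB mB') (measure_fset nu finB tB mB'); pose L := map p (fset_set B).
have inB X : X \in fset_set B -> B X by rewrite in_fset_set// inE.
have -> : (\sum_(i <- fset_set B) mu i)%E = (mesh L)%:E.
  rewrite /mesh big_map -sumEFin; apply: eq_big_seq => X /inB/hp[p12 Xp].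
  by rewrite [in LHS]Xp lebesgue_oc// ltW.
have hL : disj_intervals a b L.
  apply/andP; split.
    apply/allP => _ /mapP[X /inB BX ->]; have [p12 Xp] := hp _ BX.
    have XD : X `<=` D by apply: subset_trans AD => x Xx; exists X.
    have := XD (p X).2; rewrite {1}Xp /= !in_itv/= p12 lexx => /(_ isT)/andP[_ ->].
    rewrite (ltW p12) !andbT leNgt; apply/negP => pa.
    (* If the left end were below a, this minimum would be a point of X outside ]a, b]. *)
    have := XD (Num.min a (p X).2); rewrite {1}Xp /= !in_itv/= lt_min pa p12 ge_min lexx orbT.
    by move=> /(_ isT)/andP[]; rewrite lt_min ltxx.
  rewrite pairwise_map.
  have : uniq (fset_set B) by exact: fset_uniq.
  rewrite uniq_pairwise; apply: (sub_in_pairwise (P := [pred X | X \in fset_set B])); last by apply/allP => X.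
  move=> X Y /= /inB BX /inB BY /eqP XY.
  have [p1 Xp] := hp _ BX; have [q1 Yq] := hp _ BY.
  exact: (trivIset_oc tB BX BY).
have -> : (\sum_(i <- fset_set B) nu i)%E = (increments C L)%:E.
  rewrite /increments big_map -sumEFin; apply: eq_big_seq => X /inB/hp[p12 Xp].
  rewrite [in LHS]Xp stieltjes_oc ?(ltW p12)// ger0_norm// subr_ge0.
  exact: cumulative_is_nondecreasing (ltW p12).
by rewrite !lte_fin lee_fin; exact: hde.
Qed.

(* Finitely many intervals of a cover of small total length split into disjoint
   ones, to which absolute continuity applies. *)
Lemma stieltjes_null A : measurable A -> (mu A = 0 -> nu (A `&` D) = 0)%E.
Proof.
move=> mA muA; apply/eqP; rewrite eq_le measure_ge0 andbT.
apply/lee_addgt0Pr => e e0; rewrite add0e.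
have [d d0 hd] := acC e0.
have : (mu A < d%:E)%E by rewrite muA lte_fin.
(* Lebesgue measure is an infimum over countable covers by half-open intervals, so A has a cover of
   total length < d. *)
rewrite {1}/lebesgue_measure/= /lebesgue_stieltjes_measure/= /measure_extension/=.
move=> /ereal_inf_lt[_ [F [mF AF] <-]] hF.
have mFD k : ocitv (F k `&` D) by apply: ocitvI; [exact: mF|exact: is_ocitv].
have mo (X : set R) : ocitv X -> measurable (X : set (measurableTypeR R)).
  by move=> [p _ <-].
pose G N := \big[setU/set0]_(k < N.+1) (F k `&` D).
have GE N : G N = \bigcup_(k in `I_N.+1) (F k `&` D).
  by rewrite bigcup_mkord.
have mG N : measurable (G N : set (measurableTypeR R)).
  by apply: bigsetU_measurable => k _; apply: mo.
have mU : measurable (\bigcup_k (F k `&` D) : set (measurableTypeR R)).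
  by apply: bigcup_measurable => k _; apply: mo.
apply: (@le_trans _ _ (nu (\bigcup_k (F k `&` D)))).
  apply: le_measure; rewrite ?inE//.
    by apply: measurableI => //.
  by rewrite -setI_bigcupl; exact: setSI.
have GU : \bigcup_N G N = \bigcup_k (F k `&` D).
  exact: bigcup_bigsetU_bigcup.
have GN N : (nu (G N) <= e%:E)%E.
  apply: (stieltjes_ring_le hd) => //.
  - apply: (@bigsetU_measurable _ (SetRing.type (ocitv_type R))) => k _.
    by apply: (@SetRing.measurable_subring _ (ocitv_type R)); exact: mFD.
  - by rewrite GE; apply: bigcup_sub => k _ x [].
  - apply: le_lt_trans hF.
    have mFk k : measurable (F k : set (measurableTypeR R)) by apply: mo; exact: mF.
    have h := @content_subadditive _ R (measurableTypeR R) mu (G N) F N.+1.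
    apply: (le_trans (h _ (mG N) _)) => [k _||]; first exact: mFk.
      by rewrite GE -(bigcup_mkord _ F); apply: subset_bigcup => k _; exact: subIsetl.
    have hw k : mu (F k) = wlength idfun (F k).
      rewrite /lebesgue_measure/= /lebesgue_stieltjes_measure/= /measure_extension/=.
      by rewrite measurable_mu_extE.
    rewrite (eq_bigr (fun k : 'I_N.+1 => wlength idfun (F k))) => [|k _]; last exact: hw.
    rewrite -(big_mkord xpredT (fun k => wlength idfun (F k))); apply: nneseries_lim_ge => k _ _.
    exact: wlength_ge0.
(* Continuity from below carries the bound from the finite unions [G N] to the whole cover. *)
rewrite -GU.
have hcv := @nondecreasing_cvg_mu _ (measurableTypeR R) R nu G mG.
have cv : nu (G N) @[N --> \oo] --> nu (\bigcup_N G N).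
  apply: hcv; first by rewrite GU.
  apply/nondecreasing_seqP => N; apply/subsetPset; rewrite /G [X in _ `<=` X]big_ord_recr/=.
  exact: subsetUl.
rewrite -(cvg_lim _ cv)//; apply: lime_le.
  by apply/cvg_ex; eexists; exact: cv.
by near=> N; exact: GN.
Unshelve. all: by end_near. Qed.

(** The Stieltjes measure restricted to ]a, b] is finite and, by [stieltjes_null], dominated by
    Lebesgue measure. Its Radon-Nikodym derivative is the density, tested on ]a, x]. *)
Lemma stieltjes_density : exists2 phi : R -> R,
  mu.-integrable `]a, b[ (EFin \o phi) &
  forall x, x \in `[a, b] -> C x = C a + \int[mu]_(t in `]a, x[) phi t.
Proof.
have mD : measurable D by exact: measurable_itv.
have nuD : (nu D < +oo)%E by rewrite stieltjes_oc ?ltry// ltW.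
have dom : mfrestr mD nuD `<< mu.
  apply/null_content_dominatesP => A mA muA; exact: stieltjes_null.
have [f [f0 ffin fi fE]] := radon_nikodym_sigma_finite dom.
have hf : EFin \o (fine \o f) = f by apply/funext => x /=; rewrite fineK.
exists (fine \o f).
  by rewrite hf; apply: (integrableS measurableT) => //; exact: measurable_itv.
move=> x; rewrite in_itv/= => /andP[ax xb].
have -> : \int[mu]_(t in `]a, x[) (fine \o f) t = fine (nu `]a, x]).
  rewrite /Rintegral; congr fine.
  rewrite (eq_integral f) => [|t _]; last by rewrite /= fineK.
  have -> : nu `]a, x] = mfrestr mD nuD `]a, x].
    rewrite /mfrestr/mrestr setIidl//; apply: subset_itv; rewrite bnd_simp//.
  rewrite fE; last exact: measurable_itv.
  rewrite integral_itv_bndo_bndc//.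
  by apply: measurable_funS (measurable_int _ fi).
by rewrite stieltjes_oc//= addrC subrK.
Qed.

End StieltjesDensity.

Section AbsContinuousPrimitive.
Context {R : realType} (a b : R) (ab : a < b).
Local Notation mu := (@lebesgue_measure R).

(** A cumulative function must be nondecreasing and right-continuous on the whole line; composing
    with [clamp] extends a function on [a, b] by its end values. *)
Definition clamp (x : R) := Num.max a (Num.min x b).

Lemma clampE x : x \in `[a, b] -> clamp x = x.
Proof.
by rewrite in_itv/= => /andP[ax xb]; rewrite /clamp (min_idPl xb) (max_idPr ax).
Qed.

Lemma clamp_itv x : a <= clamp x <= b.
Proof. by rewrite /clamp le_max lexx/= ge_max (ltW ab) ge_min lexx orbT. Qed.

Lemma le_clamp x y : x <= y -> clamp x <= clamp y.
Proof. by move=> xy; rewrite /clamp le_max2//  le_min2. Qed.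

Lemma clampB x y : x <= y -> clamp y - clamp x <= y - x.
Proof.
move=> xy; have yx0 : 0 <= y - x by rewrite subr_ge0.
rewrite /clamp lerBlDr ge_max; apply/andP; split.
  by apply: (@le_trans _ _ (0 + a)); [rewrite add0r|rewrite lerD// le_max lexx].
apply: (@le_trans _ _ (y - x + Num.min x b)).
  by have [xb|bx] := leP x b; rewrite ge_min; apply/orP; [left|right]; lra.
by rewrite lerD2l le_max lexx orbT.
Qed.

Lemma nondecreasing_ac_density (G : R -> R) :
  {in `[a, b] &, {homo G : x y / x <= y}} -> ac_seq a b G ->
  exists2 phi : R -> R, mu.-integrable `]a, b[ (EFin \o phi) &
  forall x, x \in `[a, b] -> G x = G a + \int[mu]_(t in `]a, x[) phi t.
Proof.
move=> ndG acG.
have cab x : clamp x \in `[a, b] by rewrite in_itv/= clamp_itv.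
have nd : {homo G \o clamp : x y / x <= y}.
  by move=> x y xy /=; apply: ndG => //; exact: le_clamp.
have rc : right_continuous (G \o clamp).
  move=> x; apply/cvgrPdist_le => e e0.
  have [d d0 hd] := ac_seq_cont acG e0.
  near=> y.
  have xy : x <= y by near: y; exact: nbhs_right_ge.
  have yd : y < x + d by near: y; apply: nbhs_right_lt; rewrite ltrDl.
  rewrite distrC /=.
  have /andP[? _] := clamp_itv x; have /andP[_ ?] := clamp_itv y.
  apply: hd => //; first exact: le_clamp.
  by apply: le_lt_trans (clampB xy) _; rewrite ltrBlDl.
pose C : cumulative R R := HB.pack (G \o clamp) (isCumulative.Build _ _ _ (G \o clamp) nd rc).
have aab : a \in `[a, b] by rewrite in_itv/= lexx ltW.
have acC : ac_seq a b C.
  move=> e /acG[d d0 hd]; exists d => // L hL mL; have := hd _ hL mL.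
  apply: le_trans; rewrite /increments big_seq [leRHS]big_seq; apply: ler_sum => p pL /=.
  have /andP[/allP/(_ _ pL)/and3P[au uv vb] _] := hL.
  by rewrite !clampE// in_itv/= ?au ?vb ?(le_trans au uv) ?(le_trans uv vb).
have [phi phii hphi] := stieltjes_density ab acC.
by exists phi => // x xab; have := hphi x xab; rewrite /= !clampE.
Unshelve. all: by end_near. Qed.

Lemma ac_seq_density (F : R -> R) : ac_seq a b F ->
  exists2 phi : R -> R, mu.-integrable `]a, b[ (EFin \o phi) &
  forall x, x \in `[a, b] -> F x = F a + \int[mu]_(t in `]a, x[) phi t.
Proof.
move=> acF; have acV := ac_seq_var acF; have acVF := ac_seqB acV acF.
have h u v : u \in `[a, b] -> v \in `[a, b] -> u <= v ->
    `|F v - F u| <= var_fun a F v - var_fun a F u.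
  by rewrite !in_itv/= => /andP[au _] /andP[_ vb] uv; exact: var_fun_ge acF au uv vb.
have [|phi phii hphi] := nondecreasing_ac_density _ acV.
  by move=> u v hu hv uv; rewrite -subr_ge0; apply: le_trans (h _ _ hu hv uv).
have [|psi psii hpsi] := nondecreasing_ac_density _ acVF.
  move=> u v hu hv uv /=; have := h _ _ hu hv uv; have := ler_norm (F v - F u); lra.
exists (phi \- psi).
  by have := integrableB _ phii psii; apply; exact: measurable_itv.
move=> x xab; have := hphi x xab; have := hpsi x xab; rewrite /= => h1 h2.
have axb : `]a, x[ `<=` `]a, b[.
  by apply: subset_itvl; rewrite bnd_simp; move: xab; rewrite in_itv/= => /andP[].
rewrite RintegralB//; first by lra.
  by apply: integrableS phii => //; exact: measurable_itv.
by apply: integrableS psii => //; exact: measurable_itv.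
Qed.

(** Re and Im do not increase distances, so they inherit absolute continuity, and the real case
    provides both components of phi. *)
Lemma abs_continuous_primitive (f : R -> R[i]) : abs_continuous a b f ->
  exists2 phi, cintble mu `]a, b[ phi &
  forall x, x \in `[a, b] -> f x = f a + Prim a phi x.
Proof.
move=> acf.
have key (P : R[i] -> R) : (forall z w, `|P z - P w| <= cmod (z - w)) -> ac_seq a b (P \o f).
  move=> hP e /acf[d d0 hd]; exists d => // L /andP[oL pL] mL.
  have nL (i : 'I_(size L)) : nth (0, 0) L i \in L by exact: mem_nth.
  have := hd (size L) (fun i => (nth (0, 0) L i).1) (fun i => (nth (0, 0) L i).2).
  have -> // : \sum_(i < size L) ((nth (0, 0) L i).2 - (nth (0, 0) L i).1) = mesh L.
    by rewrite /mesh (big_nth (0, 0)) big_mkord.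
  move=> /(_ _ _ mL); rewrite /increments (big_nth (0, 0)) big_mkord => hs.
  rewrite -lecR; apply/ltW; apply: le_lt_trans (hs _ _).
  - rewrite rmorph_sum/=; apply: ler_sum => i _; rewrite normcE lecR; exact: hP.
  - by move=> i; have /and3P[] := allP oL _ (nL i).
  - move=> i j ij; apply/orP; have hp := elimT (pairwiseP (0, 0)) pL.
    have [ij'|ji|/val_inj/eqP] := ltngtP i j; last by rewrite (negPf ij).
      exact: (hp i j (ltn_ord i) (ltn_ord j) ij').
    by rewrite orbC; exact: (hp j i (ltn_ord j) (ltn_ord i) ji).
have [|p1 i1 h1] := ac_seq_density (key (@complex.Re R) _).
  by move=> z w; rewrite -cReB ler_Re_cmod.
have [|p2 i2 h2] := ac_seq_density (key (@complex.Im R) _).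
  by move=> z w; rewrite -cImB ler_Im_cmod.
exists (fun x => p1 x +i* p2 x); first by split.
move=> x xab; apply: complex_ext.
  by rewrite cReD; exact: h1.
by rewrite cImD; exact: h2.
Qed.

End AbsContinuousPrimitive.

(** * Volterra equations in L^1 *)

Lemma cvg_dist0 {R : realType} (s : nat -> R) (l : R) :
  s n @[n --> \oo] --> l -> `|s n - l| @[n --> \oo] --> (0 : R).
Proof.
move=> h; rewrite -(normr0 R) -(subrr l); apply: cvg_norm; apply: cvgB => //.
exact: cvg_cst.
Qed.

Section L1Contraction.
Context {d : measure_display} {T : measurableType d} {R : realType}.
Variables (mu : {measure set T -> \bar R}) (D : set T).
Hypothesis mD : measurable D.
Implicit Types f g h : T -> R[i].

Definition L1norm f : \bar R := (\int[mu]_(x in D) (cmod (f x))%:E)%E.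

Lemma L1norm_ge0 f : (0 <= L1norm f)%E.
Proof. by apply: integral_ge0 => x _; rewrite lee_fin cmod_ge0. Qed.

Lemma emeasurable_cmod f : cmeas D f -> measurable_fun D (fun x => (cmod (f x))%:E).
Proof. by move=> mf; apply/measurable_EFinP; exact: measurable_cmod. Qed.

Lemma L1norm_fin f : cintble mu D f -> (L1norm f < +oo)%E.
Proof. by move=> /(cintbleP _ _ mD)[]. Qed.

Lemma L1norm_le f g h : cmeas D f -> cmeas D g -> cmeas D h ->
  (forall x, D x -> cmod (f x) <= cmod (g x) + cmod (h x)) ->
  (L1norm f <= L1norm g + L1norm h)%E.
Proof.
move=> mf mg mh fgh; rewrite -ge0_integralD//; first last.
- exact: emeasurable_cmod.
- by move=> x _; rewrite lee_fin cmod_ge0.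
- exact: emeasurable_cmod.
- by move=> x _; rewrite lee_fin cmod_ge0.
- apply: ge0_le_integral => //.
  + by move=> x _; rewrite lee_fin cmod_ge0.
  + exact: emeasurable_cmod.
  + by apply: emeasurable_funD; exact: emeasurable_cmod.
Qed.

Lemma L1norm_eq0 f : cmeas D f -> L1norm f = 0%E -> ae_eq mu D f (fun=> 0).
Proof.
move=> mf f0; have [h _] := ae_eq_integral_abs mu mD (emeasurable_cmod mf).
 apply: (ae_imp (h _)) => [|x hx Dx].
  by rewrite -[RHS]f0; apply: eq_integral => y _; rewrite gee0_abs// lee_fin cmod_ge0.
by apply/eqP; rewrite -cmod_eq0; have [->] := hx Dx.
Qed.

Lemma ae_eq_L1norm f g : cmeas D f -> cmeas D g -> ae_eq mu D f g -> L1norm f = L1norm g.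
Proof.
move=> mf mg fg; apply: ae_eq_integral => //; [exact: emeasurable_cmod..|].
by apply: (ae_imp fg) => x h Dx; rewrite h.
Qed.

Variable F : (T -> R[i]) -> T -> R[i].
Hypothesis F_cintble : forall f, cintble mu D f -> cintble mu D (F f).
Hypothesis F_contract : forall f g, cintble mu D f -> cintble mu D g ->
  (L1norm (fun x => (F f x - F g x)%R) <= 2^-1%:E * L1norm (fun x => (f x - g x)%R))%E.

Lemma half_le0 (x : \bar R) : (0 <= x -> x < +oo -> x <= 2^-1%:E * x -> x = 0)%E.
Proof.
case: x => [r| |]//; rewrite !lee_fin => r0 _ h; congr EFin; lra.
Qed.

Lemma contraction_unique f g : cintble mu D f -> cintble mu D g ->
  ae_eq mu D f (F f) -> ae_eq mu D g (F g) -> ae_eq mu D f g.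
Proof.
move=> fi gi fF gF.
have fgi := cintbleB mD fi gi.
have : L1norm (fun x => f x - g x) = 0%E.
  apply: half_le0; [exact: L1norm_ge0|exact: L1norm_fin|].
  apply: le_trans (F_contract fi gi); rewrite le_eqVlt; apply/orP; left; apply/eqP.
  apply: ae_eq_L1norm; [exact: cintble_meas fgi|exact: cintble_meas (cintbleB mD (F_cintble fi) (F_cintble gi))|].
  by apply: (ae_imp2 fF gF) => x h1 h2 Dx; rewrite -h1// -h2.
move=> /(L1norm_eq0 (cintble_meas fgi)) h; apply: (ae_imp h) => x {}h Dx.
by apply/eqP; rewrite -subr_eq0; apply/eqP; exact: h.
Qed.

(** Picard iterates from 0. Their convergence in L^1 is obtained as in the Riesz-Fischer theorem:
    the sum [S] of the moduli of the increments has a finite integral by comparison with a geometric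
    series, so the iterates converge almost everywhere and [S] dominates them. *)
Let u (n : nat) := iter n F (fun=> 0).

Let ui n : cintble mu D (u n).
Proof. by elim: n => [|n ih]; [exact: cintble0|exact: F_cintble]. Qed.

Let du (n : nat) x : R[i] := u n.+1 x - u n x.

Let dui n : cintble mu D (du n). Proof. exact: cintbleB. Qed.

Let du_le n : (L1norm (du n) <= (2^-1 ^+ n)%:E * L1norm (du 0))%E.
Proof.
elim: n => [|n ih]; first by rewrite expr0 mul1e.
apply: (le_trans (F_contract (ui n.+1) (ui n))).
by rewrite exprS EFinM -muleA lee_pmul2l// lte_fin.
Qed.

Let S x : \bar R := (\sum_(0 <= n <oo) (cmod (du n x))%:E)%E.

Let S0 x : (0 <= S x)%E.
Proof. by apply: nneseries_ge0 => n _ _; rewrite lee_fin cmod_ge0. Qed.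

Let mS : measurable_fun D S.
Proof.
apply: (ge0_emeasurable_sum (P := xpredT)) => [k x _ _|k _]; first by rewrite lee_fin cmod_ge0.
exact/emeasurable_cmod/cintble_meas.
Qed.

Let S_fin : (\int[mu]_(x in D) S x < +oo)%E.
Proof.
rewrite integral_nneseries//; last 2 first.
- by move=> n; exact/emeasurable_cmod/cintble_meas.
- by move=> n x _; rewrite lee_fin cmod_ge0.
set c := fine (L1norm (du 0)).
have cE : L1norm (du 0) = c%:E.
  by rewrite fineK// ge0_fin_numE ?L1norm_ge0// L1norm_fin.
have c0 : 0 <= c by rewrite fine_ge0// L1norm_ge0.
apply: (@le_lt_trans _ _ (c / (1 - 2^-1))%:E); last by rewrite ltry.
apply: lime_le; first by apply: is_cvg_nneseries => n _ _; exact: L1norm_ge0.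
apply: nearW => n; apply: (@le_trans _ _ (series (geometric c 2^-1) n)%:E).
  rewrite /series/= -sumEFin; apply: lee_sum => k _; apply: le_trans (du_le k) _.
  by rewrite cE -EFinM mulrC.
rewrite lee_fin; apply: geometric_le_lim => //.
by rewrite gtr0_norm; lra.
Qed.

Let E : set T := D `&` [set x | (S x < +oo)%E].

Let mE : measurable E.
Proof. exact: emeasurable_fun_infty_o. Qed.

Let E_ae : {ae mu, forall x, D x -> E x}.
Proof.
have Si : mu.-integrable D S.
  apply/integrableP; split => //; under eq_integral do rewrite gee0_abs//.
  exact: S_fin.
apply: (ae_imp (integrable_ae mD Si)) => x h Dx; split => //=.
by rewrite -ge0_fin_numE// h.
Qed.

Let du_series_le n x : E x -> \sum_(0 <= k < n) cmod (du k x) <= fine (S x).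
Proof.
move=> [Dx Sx]; rewrite -lee_fin fineK ?ge0_fin_numE// -sumEFin.
by apply: nneseries_lim_ge => k _ _; rewrite lee_fin cmod_ge0.
Qed.

Let uE n x : u n x = \sum_(0 <= k < n) du k x.
Proof. by rewrite telescope_sumr// subr0. Qed.

Let u_le n x : E x -> cmod (u n x) <= fine (S x).
Proof.
by move=> Ex; rewrite uE; apply: le_trans (ler_cmod_sum _ _ _) _; exact: du_series_le.
Qed.

(** P stands for Re or Im; additivity and |P z| <= |z| are all that the two have to share. *)
Let part_cvg (P : R[i] -> R) x : (forall z, `|P z| <= cmod z) ->
  (forall z w, P (z + w) = P z + P w) -> E x -> cvgn (fun n => P (u n x)).
Proof.
move=> Ple PD Ex; have P0 : P 0 = 0.
  by apply/eqP; rewrite -normr_le0; apply: le_trans (Ple 0) _; rewrite cmod0.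
rewrite (_ : (fun n => _) = series (fun k => P (du k x))); last first.
  by apply/funext => n; rewrite uE /series/=; exact: (big_morph P PD P0).
apply: normed_cvg; apply: nondecreasing_is_cvgn.
  by apply: nondecreasing_series => k _ _; exact: normr_ge0.
exists (fine (S x)) => _ [n _ <-]; apply: le_trans (du_series_le n Ex).
by rewrite /series/=; apply: ler_sum => k _; exact: Ple.
Qed.

Let v x : R[i] :=
  zext E (fun x => limn (fun n => cRe (u n x)) +i* limn (fun n => cIm (u n x))) x.

(** Cut off outside the set [E] of convergence, the iterates converge to [v] at every point, so that
    the measurability of [v] follows from that of a pointwise limit. *)
Let zu n := zext E (u n).

Let zu_cvg (P : R[i] -> R) x : (forall z, `|P z| <= cmod z) ->
  (forall z w, P (z + w) = P z + P w) ->
  (E x -> P (v x) = limn (fun n => P (u n x))) ->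
  P (zu n x) @[n --> \oo] --> P (v x).
Proof.
move=> Ple PD hP; have [Ex|nEx] := pselect (E x).
  rewrite (_ : (fun n => _) = (fun n => P (u n x))); last first.
    by apply/funext => n; rewrite /zu zextT.
  by rewrite hP//; exact: part_cvg.
rewrite /v zextF// (_ : (fun n => _) = cst (P 0)); first exact: cvg_cst.
by apply/funext => n; rewrite /zu zextF.
Qed.

Let zuRe x : cRe (zu n x) @[n --> \oo] --> cRe (v x).
Proof.
apply: zu_cvg; [exact: ler_Re_cmod|exact: cReD|by move=> Ex; rewrite /v zextT].
Qed.

Let zuIm x : cIm (zu n x) @[n --> \oo] --> cIm (v x).
Proof.
apply: zu_cvg; [exact: ler_Im_cmod|exact: cImD|by move=> Ex; rewrite /v zextT].
Qed.

Let mzu n : cmeas D (zu n).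
Proof.
apply: (cmeasS (E := setT)) => //; apply/(cmeas_restrict _ mE).
by apply: cmeasS (cintble_meas (ui n)) => // x [].
Qed.

Let mv : cmeas D v.
Proof.
by split; [apply: (measurable_fun_cvg (h := fun n x => cRe (zu n x))) => [n|x _] |
  apply: (measurable_fun_cvg (h := fun n x => cIm (zu n x))) => [n|x _]] => //; have [] := mzu n.
Qed.

Let zu_le n x : cmod (zu n x) <= fine (S x).
Proof.
have [Ex|nEx] := pselect (E x); first by rewrite /zu zextT// u_le.
by rewrite /zu zextF// cmod0 fine_ge0.
Qed.

Let dist_cvg x : cmod (zu n x - v x) @[n --> \oo] --> (0 : R).
Proof.
have h : `|cRe (zu n x) - cRe (v x)| + `|cIm (zu n x) - cIm (v x)|
    @[n --> \oo] --> (0 : R).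
  rewrite -(addr0 0); apply: cvgD.
    by apply: cvg_dist0; exact: zuRe.
  by apply: cvg_dist0; exact: zuIm.
apply: (squeeze_cvgr _ (cvg_cst 0) h); near=> n.
by rewrite cmod_ge0 -cReB -cImB ler_cmod_ReIm.
Unshelve. all: by end_near. Qed.

Let v_le x : cmod (v x) <= fine (S x).
Proof.
apply/ler_addgt0Pl => e e0.
have /cvgr0Pnorm_lt/(_ e e0) [N _ /(_ N (leqnn N))/=] := dist_cvg x.
rewrite ger0_norm ?cmod_ge0// => h.
have := ler_cmodD (v x - zu N x) (zu N x); rewrite subrK.
have := zu_le N x; rewrite cmodB; move: h.
by move: (cmod (v x)) (cmod (zu N x)) (cmod (zu N x - v x)) (fine (S x)) => *; lra.
Qed.

Let Si : mu.-integrable D (EFin \o (fun x => fine (S x))).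
Proof.
apply/integrableP; split.
  by apply/measurable_EFinP; apply: measurableT_comp.
apply: le_lt_trans S_fin; apply: ge0_le_integral => //.
- by apply: measurableT_comp => //; apply/measurable_EFinP; apply: measurableT_comp.
- move=> x _ /=; rewrite ger0_norm ?fine_ge0//.
  by have := S0 x; case: (S x) => //= *; rewrite leey.
Qed.

Let vi : cintble mu D v.
Proof. by apply: (le_cintble mD mv Si) => x _; exact: v_le. Qed.

Let norm_cvg : L1norm (fun x => u n x - v x) @[n --> \oo] --> 0%E.
Proof.
rewrite (_ : (fun n => _) = fun n => L1norm (fun x => zu n x - v x)); last first.
  apply/funext => n; apply: ae_eq_L1norm.
  - exact: cintble_meas (cintbleB mD (ui n) vi).
  - by apply: cmeasD => //; exact: cmeasN.
  - by apply: (ae_imp E_ae) => x h Dx; rewrite /zu zextT//; exact: h.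
rewrite -(integral0 mu D).
apply: (dominated_cvg mD (g := EFin \o (fun x => 2 * fine (S x)))) => //.
- by move=> n; apply: emeasurable_cmod; apply: cmeasD => //; exact: cmeasN.
- move=> x _; apply/fine_cvgP; split; first by near=> n.
  exact: dist_cvg.
- have := @integrableZl _ _ _ mu _ mD 2 _ Si; exact: eq_integrable.
- move=> n x _ /=; rewrite lee_fin ger0_norm ?cmod_ge0//.
  apply: le_trans (ler_cmodD _ _) _; rewrite cmodN mulr_natl mulr2n lerD//; exact: zu_le.
Unshelve. all: by end_near. Qed.

Lemma contraction_fixpoint : exists2 f, cintble mu D f & ae_eq mu D f (F f).
Proof.
exists v => //.
have vFi := cintbleB mD vi (F_cintble vi).
have : L1norm (fun x => v x - F v x) = 0%E.
  apply/eqP; rewrite eq_le L1norm_ge0 andbT; apply/lee_addgt0Pr => e e0; rewrite add0e.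
  have e2 : 0 < e / 2 by rewrite divr_gt0.
  have /fine_cvgP[_ /cvgr0Pnorm_lt/(_ _ e2)[N _ hN]] := norm_cvg.
  have fn n : L1norm (fun x => u n x - v x) = (fine (L1norm (fun x => u n x - v x)))%:E.
    by rewrite fineK// ge0_fin_numE ?L1norm_ge0// L1norm_fin//; exact: cintbleB.
  have hn n : (N <= n)%N -> (L1norm (fun x => (u n x - v x)%R) <= (e / 2)%:E)%E.
    move=> /hN /=; rewrite ger0_norm ?fine_ge0 ?L1norm_ge0// => h.
    by rewrite fn lee_fin ltW.
  (* Triangle inequality through u (N + 1) = F (u N); the contraction property handles the second
     term. *)
  apply: (@le_trans _ _ ((L1norm (fun x => (u N.+1 x - v x)%R) +
      L1norm (fun x => (F (u N) x - F v x)%R))%E)).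
    apply: L1norm_le; [exact: cintble_meas vFi|exact: cintble_meas (cintbleB mD (ui _) vi)| |].
      exact: cintble_meas (cintbleB mD (F_cintble (ui N)) (F_cintble vi)).
    move=> x _; rewrite [X in _ <= X + _]cmodB.
    by rewrite (_ : v x - F v x = (v x - u N.+1 x) + (u N.+1 x - F v x)) ?ler_cmodD//; ring.
  rewrite [e]splitr EFinD leeD ?hn// (le_trans (F_contract (ui N) vi))//.
  apply: le_trans (hn N (leqnn N)); rewrite fn -EFinM lee_fin.
  have := fine_ge0 (L1norm_ge0 (fun x => u N x - v x)).
  by move: (fine _) => r; lra.
move=> /(L1norm_eq0 (cintble_meas vFi)) h; apply: (ae_imp h) => x {}h Dx.
by apply/eqP; rewrite -subr_eq0; apply/eqP; exact: h.
Qed.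

End L1Contraction.

(** Each term is brought below c = 1 / (2 (n + 1)), which means lam >= (K j / c)^(1 / r j); lam is 1
    plus the sum of these thresholds. Using n + 1 in c covers the empty sum as well. *)
Lemma powR_sum_small {R : realType} (n : nat) (K r : 'I_n -> R) :
  (forall j, 0 <= K j) -> (forall j, 0 < r j) ->
  exists2 lam : R, 0 < lam & \sum_(j < n) K j * lam `^ (- r j) <= 2^-1.
Proof.
move=> K0 r0; pose c : R := (2 * n.+1%:R)^-1.
have c0 : 0 < c by rewrite invr_gt0 mulr_gt0.
pose L j := (K j / c) `^ (r j)^-1.
pose lam := 1 + \sum_(j < n) L j.
have S0 : 0 <= \sum_(j < n) L j by apply: sumr_ge0 => j _; exact: powR_ge0.
have lam0 : 0 < lam by rewrite ltr_pwDl.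
exists lam => //; apply: (@le_trans _ _ (\sum_(j < n) c)).
  apply: ler_sum => j _; rewrite powRN ler_pdivrMr ?powR_gt0// mulrC -ler_pdivrMr//.
  rewrite -[leLHS]powRr1 ?divr_ge0 ?K0 ?(ltW c0)// -(@mulVf _ (r j)) ?gt_eqF// powRrM.
  apply: ge0_ler_powR; rewrite ?nnegrE ?powR_ge0 ?(ltW lam0) ?(ltW (r0 j))//.
  rewrite /lam (bigD1 j)//= addrCA lerDl addr_ge0// sumr_ge0// => i _; exact: powR_ge0.
have -> : \sum_(j < n) c = n%:R / (2 * n.+1%:R) by rewrite sumr_const card_ord mulr_natl.
rewrite ler_pdivrMr ?mulr_gt0// mulKf//.
by rewrite ler_nat.
Qed.

(** * Fractional Volterra equations *)

Section Volterra.
Context {R : realType} (a b : R) (ab : a < b).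
Local Notation mu := (@lebesgue_measure R).
Local Notation I := (`]a, b[%classic : set (measurableTypeR R)).
Local Notation Lab := (cintble mu I).
Local Notation norm1 := (L1norm mu I).
Local Notation RxR := (measurableTypeR R * measurableTypeR R)%type.
Implicit Types (p : R[i]) (f g : R -> R[i]).

Let mI : measurable I. Proof. exact: measurable_itv. Qed.

Lemma cintbleM_cont A f : continuous_on `[a, b] A -> Lab f -> Lab (fun x => A x * f x).
Proof.
move=> cA fi; have [M M0 hM] := continuous_on_bounded (ltW ab) cA.
have mA : cmeas I A.
  apply: cmeasS (cintble_meas (continuous_cintble cA)); first exact: measurable_itv.
  exact: subset_itv_oo_cc.
have := cintble_cmod mI fi => /(@integrableZl _ _ _ _ _ mI M) h.
apply: (le_cintble mI _ h) => [|x xI]; first by apply: cmeasM => //; exact: (cintble_meas fi).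
by rewrite cmodM ler_wpM2r ?cmod_ge0// hM//; exact: subset_itv_oo_cc.
Qed.

Lemma continuous_on_expR (lam : R) : continuous_on `[a, b] (fun x => (expR (lam * x))%:C).
Proof.
apply/continuous_onP => x _ e e0.
have h : {for x, continuous (fun y => expR (lam * y))}.
  apply: continuous_comp; first exact: mulrl_continuous.
  exact: continuous_expR.
move/cvgrPdist_lt : h => /(_ e e0) /nbhs_ballP[d /= d0 hd].
exists d => // y _ yd; rewrite -rmorphB cmodR distrC.
by apply: (hd y); rewrite /ball/= distrC.
Qed.

Lemma norm1_mkcond f : norm1 f = (\int[mu]_x (cmod (zext I f x))%:E)%E.
Proof.
rewrite /L1norm integral_mkcond; apply: eq_integral => x _; rewrite /patch.
case: ifPn => xI; first by rewrite zextT// -inE.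
by rewrite zextF ?cmod0// => /mem_set h; rewrite h in xI.
Qed.

(* Conjugation by exp (lam x) turns the kernel t^(p-1) into t^(p-1) exp (- lam t),
   whose L^1 norm is lam^(-Re p) times a constant. *)
Definition wrl (lam : R) p f x :=
  (expR (- lam * x))%:C * rl_integral a p (fun t => (expR (lam * t))%:C * f t) x.

Lemma wrl_cintble lam p f : 0 < cRe p -> Lab f -> Lab (wrl lam p f).
Proof.
move=> p0 fi; apply: cintbleM_cont; first exact: continuous_on_expR.
by apply: rl_integral_cintble => //; apply: cintbleM_cont => //; exact: continuous_on_expR.
Qed.

Lemma wrl_le lam p f x : 0 < cRe p -> Lab f -> I x ->
  ((cmod (wrl lam p f x))%:E <= (cmod (Gamma p)^-1)%:E *
    \int[mu]_t ((rker lam (cRe p) (x - t))%:E * (cmod (zext I f t))%:E))%E.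
Proof.
move=> p0 fi xI; rewrite /wrl (rl_integralE _ (Re_gt0_neq0 p0) xI).
rewrite mulrCA cmodM EFinM; apply: lee_wpmul2l; first by rewrite lee_fin cmod_ge0.
set h := fun t => ker 0 p (x - t) * zext I (fun t => (expR (lam * t))%:C * f t) t.
have mh : cmeas [set: R] h.
  apply: cmeasM.
    apply: (cmeas_comp (phi := fun t : measurableTypeR R => x - t)); last exact: measurable_ker.
    exact: measurable_funB.
  apply: (cmeas_restrict _ mI).1; apply: cintble_meas; apply: cintbleM_cont => //.
  exact: continuous_on_expR.
rewrite cmodM EFinM cmodR ger0_norm ?expR_ge0//.
apply: (@le_trans _ _ ((expR (- lam * x))%:E * \int[mu]_t (cmod (h t))%:E)%E).
  apply: lee_wpmul2l; first by rewrite lee_fin expR_ge0.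
  exact: le_cmod_cint_ge0.
rewrite -ge0_integralZl//; last first.
- by move=> t _; rewrite lee_fin cmod_ge0.
- exact: emeasurable_cmod.
rewrite le_eqVlt; apply/orP; left; apply/eqP/eq_integral => t _.
rewrite -!EFinM -cmod_ker -cmodM; congr EFin.
rewrite -[expR _]ger0_norm ?expR_ge0// -cmodR -cmodM /h [ker lam _ _]ker_expR.
congr cmod; have [tI|tI] := pselect (I t); last by rewrite !zextF// !mulr0.
rewrite !zextT//; set u := ker 0 p _; rewrite mulrCA [RHS]mulrAC mulrC; congr (_ * _).
rewrite mulrA; congr (_ * _); rewrite -rmorphM -expRD.
by congr (expR _)%:C; ring.
Qed.

(** Young's inequality in L^1, by [conv_tonelli]; [integral_rker] supplies the negative power of
    lam. *)
Lemma norm1_wrl_le lam p f : 0 < lam -> 0 < cRe p -> Lab f ->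
  (norm1 (wrl lam p f) <=
   (cmod (Gamma p)^-1 * fine (rgamma (cRe p)) * lam `^ (- cRe p))%:E * norm1 f)%E.
Proof.
move=> lam0 p0 fi; set r := cRe p.
have mz : measurable_fun setT (fun t => (cmod (zext I f t))%:E).
  by apply: emeasurable_cmod; exact: cintble_meas (L1_zext fi).
have mk : measurable_fun setT (fun t => (rker lam r t)%:E).
  by apply/measurable_EFinP; exact: measurable_rker.
pose H x := (\int[mu]_t ((rker lam r (x - t))%:E * (cmod (zext I f t))%:E))%E.
have H0 x : (0 <= H x)%E.
  by apply: integral_ge0 => t _; rewrite -EFinM lee_fin mulr_ge0 ?rker_ge0 ?cmod_ge0.
have mH : measurable_fun [set: R] H.
  apply: (measurable_fun_fubini_tonelli_F
    (fun z : RxR => ((rker lam r (z.1 - z.2)%R)%:E * (cmod (zext I f z.2))%:E)%E)).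
    apply: emeasurable_funM.
      by apply: (measurableT_comp mk); exact: measurable_funB.
    exact: (measurableT_comp mz).
  by move=> z; rewrite -EFinM lee_fin mulr_ge0 ?rker_ge0 ?cmod_ge0.
apply: (@le_trans _ _ (\int[mu]_(x in I) ((cmod (Gamma p)^-1)%:E * H x))%E).
  apply: ge0_le_integral => //.
  - by move=> x _; rewrite lee_fin cmod_ge0.
  - by apply: emeasurable_cmod; exact: cintble_meas (wrl_cintble _ p0 fi).
  - by apply: measurable_funS (emeasurable_funM _ mH) => //.
  - by move=> x xI; exact: wrl_le.
apply: (@le_trans _ _ (\int[mu]_x ((cmod (Gamma p)^-1)%:E * H x))%E).
  apply: ge0_subset_integral => //; first by apply: emeasurable_funM.
  by move=> x _; rewrite mule_ge0// lee_fin cmod_ge0.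
rewrite ge0_integralZl//; last by rewrite lee_fin cmod_ge0.
rewrite /H (conv_tonelli mk mz); last 2 first.
- by move=> t; rewrite lee_fin rker_ge0.
- by move=> t; rewrite lee_fin cmod_ge0.
rewrite integral_rker// -norm1_mkcond muleA.
rewrite -[rgamma r]fineK; last by rewrite ge0_fin_numE ?rgamma_ge0// rgamma_fin.
by rewrite -!EFinM mulrA mulrAC.
Qed.

Lemma wrlB lam p f g : 0 < cRe p -> Lab f -> Lab g ->
  ae_eq mu I (fun x => wrl lam p f x - wrl lam p g x) (wrl lam p (fun x => f x - g x)).
Proof.
move=> p0 fi gi; have hp : rl_ok p by right.
have fi' := cintbleM_cont (@continuous_on_expR lam) fi.
have gi' := cintbleM_cont (@continuous_on_expR lam) gi.
have h1 := rlD hp fi' (cintbleZ (-1) mI gi'); have h2 := rlZ (-1) hp gi'.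
apply: (ae_imp2 h1 h2) => x {}h1 {}h2 xI; rewrite /wrl -mulrBr; congr (_ * _).
rewrite -[X in _ + X]mulN1r -(h2 xI) -(h1 xI).
by congr rl_integral; apply/funext => t; rewrite mulN1r mulrBr.
Qed.

Variables (n : nat) (A : 'I_n -> R -> R[i]) (gamma : 'I_n -> R[i]) (G : R -> R[i]).
Hypothesis cA : forall j, continuous_on `[a, b] (A j).
Hypothesis gamma0 : forall j, 0 < cRe (gamma j).
Hypothesis Gi : Lab G.

(** The fixed points u of this map correspond to the solutions f of the Volterra equation through u
    x = e^(- lam x) f x. *)
Let F lam f (x : R) : R[i] := (expR (- lam * x))%:C * G x - \sum_(j < n) A j x * wrl lam (gamma j) f x.

Let F_cintble lam f : Lab f -> Lab (F lam f).
Proof.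
move=> fi; apply: cintbleB => //; first exact: cintbleM_cont (@continuous_on_expR _) Gi.
by apply: cintble_sum => // j _; apply: cintbleM_cont => //; exact: wrl_cintble.
Qed.

Lemma norm1_sum_le (m : nat) (h : 'I_m -> R -> R[i]) (c : 'I_m -> \bar R) :
  (forall j, Lab (h j)) -> (forall j, norm1 (h j) <= c j)%E ->
  (norm1 (fun x => (\sum_(j < m) h j x)%R) <= \sum_(j < m) c j)%E.
Proof.
elim: m h c => [|m ih] h c hi hc.
  rewrite big_ord0 /L1norm integral0_eq// => x _.
  by rewrite big_ord0 cmod0.
rewrite big_ord_recl.
have hi' : Lab (fun x => \sum_(j < m) h (lift ord0 j) x) by exact: cintble_sum.
apply: (@le_trans _ _ (norm1 (h ord0) + norm1 (fun x => (\sum_(j < m) h (lift ord0 j) x)%R))%E).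
  apply: L1norm_le => //; [|exact: cintble_meas|exact: cintble_meas hi'|].
    by apply: cintble_meas; exact: cintble_sum.
  by move=> x _; rewrite big_ord_recl ler_cmodD.
by apply: leeD => //; exact: ih.
Qed.

Let contract : exists2 lam : R, 0 < lam & forall f g, Lab f -> Lab g ->
  (norm1 (fun x => (F lam f x - F lam g x)%R) <= 2^-1%:E * norm1 (fun x => (f x - g x)%R))%E.
Proof.
have /choice[M hM] : forall j, exists M : R, 0 <= M /\ forall x, x \in `[a, b] -> cmod (A j x) <= M.
  by move=> j; have [M M0 hM] := continuous_on_bounded (ltW ab) (@cA j); exists M.
(* Multiplied by lam^(-Re gamma_j), this bounds the operator norm of the j-th term: a bound of |A
   j|, then |1 / Gamma|, then the real Gamma integral. *)
pose K j := M j * (cmod (Gamma (gamma j))^-1 * fine (rgamma (cRe (gamma j)))).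
have [|lam lam0 hlam] := powR_sum_small (K := K) (r := fun j => cRe (gamma j)) _ gamma0.
  move=> j; rewrite /K mulr_ge0//; first by have [] := hM j.
  by rewrite mulr_ge0 ?cmod_ge0// fine_ge0// rgamma_ge0.
exists lam => // f g fi gi.
have fgi := cintbleB mI fi gi.
have hi j : Lab (fun x => A j x * wrl lam (gamma j) (fun x => f x - g x) x).
  by apply: cintbleM_cont => //; exact: wrl_cintble.
have -> : norm1 (fun x => F lam f x - F lam g x) =
    norm1 (fun x => \sum_(j < n) A j x * wrl lam (gamma j) (fun x => f x - g x) x).
  transitivity (norm1 (fun x => F lam g x - F lam f x)).
    by apply: eq_integral => x _; rewrite cmodB.
  apply: ae_eq_L1norm => //.
  - by apply: cintble_meas; apply: cintbleB => //; exact: F_cintble.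
  - by apply: cintble_meas; exact: cintble_sum.
  - have /ae_forall := fun j => wrlB lam (gamma0 j) fi gi.
    move=> /ae_imp; apply => x hx xI; rewrite /F opprB addrC addrA subrK.
    by rewrite -sumrB; apply: eq_bigr => j _; rewrite -mulrBr hx.
apply: (@le_trans _ _ (\sum_(j < n) ((K j * lam `^ (- cRe (gamma j)))%:E *
    norm1 (fun x => (f x - g x)%R)))%E).
  apply: norm1_sum_le => // j.
  have [M0 {}hM] := hM j.
  have wi := wrl_cintble lam (gamma0 j) fgi.
  apply: (@le_trans _ _ ((M j)%:E * norm1 (wrl lam (gamma j) (fun x => (f x - g x)%R)))%E).
    rewrite -ge0_integralZl//; last 2 first.
    - by apply: emeasurable_cmod; exact: cintble_meas wi.
    - by move=> x _; rewrite lee_fin cmod_ge0.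
    apply: ge0_le_integral => //.
    - by move=> x _; rewrite lee_fin cmod_ge0.
    - by apply: emeasurable_cmod; exact: cintble_meas (hi j).
    - by apply: emeasurable_funM => //; apply: emeasurable_cmod; exact: cintble_meas wi.
    - move=> x xI; rewrite -EFinM lee_fin cmodM ler_wpM2r ?cmod_ge0// hM//.
      exact: subset_itv_oo_cc.
  rewrite /K -mulrA [in leRHS]EFinM -muleA; apply: lee_wpmul2l => //.
  exact: norm1_wrl_le.
rewrite -ge0_sume_distrl ?sumEFin.
  by apply: lee_wpmul2r; [exact: L1norm_ge0|rewrite lee_fin].
move=> j _; rewrite lee_fin mulr_ge0 ?powR_ge0// mulr_ge0//; first by have [] := hM j.
by rewrite mulr_ge0 ?cmod_ge0// fine_ge0// rgamma_ge0.
Qed.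

Definition volterra_eq f := ae_eq_on `]a, b[
  (fun x => f x + \sum_(j < n) A j x * rl_integral a (gamma j) f x) G.

Let exp1 (lam x : R) : (expR (lam * x))%:C * (expR (- lam * x))%:C = 1 :> R[i].
Proof. by rewrite -rmorphM -expRD mulNr subrr expR0. Qed.

Lemma volterra_exists : exists2 f, Lab f & volterra_eq f.
Proof.
have [lam lam0 hlam] := contract.
have [u ui uF] := contraction_fixpoint mI (@F_cintble lam) hlam.
pose f x := (expR (lam * x))%:C * u x.
exists f; first exact: cintbleM_cont (@continuous_on_expR _) ui.
apply: (ae_imp uF) => x {}uF xI.
rewrite {1}/f uF// /F mulrBr mulrA exp1 mul1r -addrA -[RHS]addr0; congr (_ + _).
rewrite mulr_sumr addrC; apply/eqP; rewrite subr_eq0; apply/eqP; apply: eq_bigr => j _.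
by rewrite mulrCA /wrl [X in _ = _ * X]mulrA exp1 mul1r.
Qed.

Lemma volterra_unique f g : Lab f -> Lab g -> volterra_eq f -> volterra_eq g ->
  ae_eq_on `]a, b[ f g.
Proof.
have [lam lam0 hlam] := contract.
pose w (h : R -> R[i]) x := (expR (- lam * x))%:C * h x.
have wi h : Lab h -> Lab (w h) by move=> hi; exact: cintbleM_cont (@continuous_on_expR _) hi.
have hw h : Lab h -> volterra_eq h -> ae_eq mu I (w h) (F lam (w h)).
  move=> hi hE; apply: (ae_imp hE) => x {}hE xI.
  rewrite {1}/w /F -hE// mulrDr mulr_sumr -addrA -[LHS]addr0; congr (_ + _).
  apply/esym/eqP; rewrite subr_eq0; apply/eqP; apply: eq_bigr => j _.
  rewrite /wrl mulrCA; congr (_ * (_ * _)); congr rl_integral; apply/funext => t.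
  by rewrite /w mulrA exp1 mul1r.
move=> fi gi fE gE.
have h := contraction_unique mI (@F_cintble lam) hlam (wi _ fi) (wi _ gi) (hw _ fi fE) (hw _ gi gE).
apply: (ae_imp h) => x {}h xI.
by rewrite -[f x]mul1r -[g x]mul1r -(exp1 lam x) -!mulrA; congr (_ * _); exact: h.
Qed.

End Volterra.

(** * The Cauchy problem *)

Lemma cvg_at_right_continuous {R : realType} (a b : R) (f g : R -> R[i]) : a < b ->
  continuous_on `[a, b] g -> (forall x, x \in `]a, b[ -> f x = g x) ->
  (f x : R[i]^o) @[x --> a^'+] --> (g a : R[i]^o).
Proof.
move=> ab /continuous_onP cg fg; apply/cvgC => e e0.
have aab : a \in `[a, b] by rewrite in_itv/= lexx ltW.
have [d d0 hd] := cg a aab e e0.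
near=> x.
have ax : a < x by near: x; exact: nbhs_right_gt.
have xb : x < b by near: x; exact: nbhs_right_lt.
have xd : x < a + d by near: x; apply: nbhs_right_lt; rewrite ltrDl.
rewrite fg ?in_itv/= ?ax//; apply: hd; first by rewrite /= in_itv/= !ltW.
by rewrite gtr0_norm ?subr_gt0// ltrBlDl.
Unshelve. all: by end_near. Qed.

Lemma continuous_onD {R : realType} (A : set R) (f g : R -> R[i]) :
  continuous_on A f -> continuous_on A g -> continuous_on A (fun x => f x + g x).
Proof.
move=> /continuous_onP hf /continuous_onP hg; apply/continuous_onP => x Ax e e0.
have e2 : 0 < e / 2 by rewrite divr_gt0.
have [d1 d10 h1] := hf x Ax _ e2; have [d2 d20 h2] := hg x Ax _ e2.
exists (Num.min d1 d2); first by rewrite lt_min d10.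
move=> y Ay; rewrite lt_min => /andP[/(h1 y Ay) k1 /(h2 y Ay) k2].
rewrite (splitr e) (_ : _ - _ = (f y - f x) + (g y - g x)); last by ring.
exact: le_lt_trans (ler_cmodD _ _) (ltrD k1 k2).
Qed.

(** * Functions represented by a density and a sum of kernels *)

Section Representation.
Context {R : realType} (a b : R) (ab : a < b).
Local Notation mu := (@lebesgue_measure R).
Local Notation I := (`]a, b[%classic : set (measurableTypeR R)).
Local Notation Lab := (cintble mu I).
Implicit Types (p : R[i]) (w z f : R -> R[i]).

Let mI : measurable I. Proof. exact: measurable_itv. Qed.

Lemma iter_Prim_cont (d : nat) w : Lab w -> continuous_on `[a, b] (iter d.+1 (Prim a) w).
Proof.
move=> wi; have wi' := iter_Prim_cintble d wi.
by rewrite iterS; exact: (Prim_continuous wi').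
Qed.

Lemma iter_Prim_cderiv (d : nat) w x : Lab w -> x \in `[a, b] ->
  cderiv `[a, b] (iter d.+2 (Prim a) w) x (iter d.+1 (Prim a) w x).
Proof. by move=> wi xab; rewrite iterS; apply: Prim_cderiv_cont => //; exact: iter_Prim_cont. Qed.

Section KernelSums.
Variables (n : nat) (c : nat -> R[i]).

(* The index k stands for k + 1 in the statement: c k is b_(k+1) or 0. *)
Definition kersum p (x : R) : R[i] := \sum_(k < n) c k * Kr (p - k%:R) (x - a).

Lemma kersum_cderiv p x : a < x -> cderiv setT (kersum (p + 1)) x (kersum p x).
Proof.
move=> ax; apply: cderiv_sum => k _; apply: cderivZ.
apply: (cderiv_shift (f := Kr (p + 1 - k%:R))).
by rewrite addrAC; apply: Kr_cderiv; rewrite subr_gt0.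
Qed.

(** The most singular term is k = n - 1, whose exponent p - (n - 1) still has positive real part. *)
Lemma kersum_cintble p : (0 < n)%N -> n%:R - 1 < cRe p -> Lab (kersum p).
Proof.
move=> n0 np; apply: cintble_sum; first exact: measurable_itv.
move=> k _; apply: cintbleZ; first exact: measurable_itv.
apply: (Lab_Kr a b); rewrite cReB cRe_nat subr_gt0; apply: le_lt_trans np.
by rewrite lerBrDr natr1 ler_nat.
Qed.

(* The i-th derivative of [chain w p m] is [chain w p (m - i)]. *)
Definition chain w p (d : nat) (x : R) : R[i] := iter d (Prim a) w x + kersum (p + d%:R) x.

Lemma chain_cderiv w p (d : nat) x : Lab w -> x \in `]a, b[ ->
  cderiv `]a, b[ (chain w p d.+2) x (chain w p d.+1 x).
Proof.
move=> wi xab; have xcc : x \in `[a, b] by exact: subset_itv_oo_cc.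
apply: cderivD.
  by apply: (cderivS (B := `[a, b]%classic)); [exact: subset_itv_oo_cc|exact: iter_Prim_cderiv].
apply: (cderivS (B := setT)) => //.
rewrite -[d.+2]addn1 natrD addrA; apply: kersum_cderiv.
by move: xab; rewrite in_itv/= => /andP[].
Qed.

(** The last derivative in the chain exists only almost everywhere, because w is merely
    integrable. *)
Lemma ae_chain_cderiv w p : Lab w -> {ae mu, forall x, x \in `]a, b[ ->
  cderiv `]a, b[ (chain w p 1) x (chain w p 0 x)}.
Proof.
move=> wi; apply: (ae_imp (ae_Prim_cderiv wi)) => x h xab; apply: cderivD.
  exact: h.
rewrite addr0; apply: (cderivS (B := setT)) => //; apply: kersum_cderiv.
by move: xab; rewrite in_itv/= => /andP[].
Qed.

Lemma kersum_cont p : continuous_on `]a, b[ (kersum p).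
Proof.
apply: (cderiv_continuous (l := kersum (p - 1))) => x /=; rewrite in_itv/= => /andP[ax _].
by apply: (cderivS (B := setT)) => //; rewrite -{1}(subrK 1 p); exact: kersum_cderiv.
Qed.

Lemma chain_cont w p (d : nat) : Lab w -> continuous_on `]a, b[ (chain w p d.+1).
Proof.
move=> wi; apply: continuous_onD; last exact: kersum_cont.
by apply: (continuous_onS (B := `[a, b]%classic)); [exact: subset_itv_oo_cc|exact: iter_Prim_cont].
Qed.

Section DerivativesOfChain.
Variables (m : nat) (w : R -> R[i]) (p : R[i]) (f : R -> R[i]).
Hypothesis wi : Lab w.
Hypothesis fE : ae_eq_on `]a, b[ f (chain w p m).

(** For m > 0 the chain is continuous on ]a, b[, so it is the representative taken by [cont_repr].
    As long as i < m, at least one primitive of w is left, and the formula holds at every point. *)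
Lemma deriven_cont_repr (i : nat) x : (i < m)%N -> x \in `]a, b[ ->
  deriven_on `]a, b[ i (cont_repr a b f) x = chain w p (m - i) x.
Proof.
move=> im xab; have m0 : (0 < m)%N by apply: leq_ltn_trans im.
apply: (@deriven_onE _ _ m.-1 _ (fun i => chain w p (m - i))) => //.
- by move=> y yab; apply: accum_oo => //; exact: subset_itv_oo_cc.
- move=> y yab; rewrite subn0; apply: cont_reprE => //.
    by apply: (ae_imp fE) => t h tab; rewrite h.
  by rewrite -(prednK m0); exact: chain_cont.
- move=> k y km yab; rewrite (_ : (m - k = (m - k.+2).+2)%N); last by lia.
  by rewrite (_ : (m - k.+1 = (m - k.+2).+1)%N); [exact: chain_cderiv|lia].
- by rewrite -ltnS prednK.
Qed.

Lemma deriven_cont_repr_ae :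
  ae_eq_on `]a, b[ (deriven_on `]a, b[ m (cont_repr a b f)) (chain w p 0).
Proof.
(* For m = 0 nothing is differentiated, and whatever [cont_repr] returns agrees with f almost
   everywhere. *)
have [m0|m0] := posnP m.
  apply: (ae_imp2 (cont_repr_ae a b f) fE) => x h1 h2 xab.
  by rewrite m0 in h2 *; rewrite /deriven_on /= h1// h2.
apply: (ae_imp (ae_chain_cderiv p wi)) => x h xab.
rewrite -(prednK m0) /deriven_on iterS -/(deriven_on _ _ _).
apply: derive_onE; first by apply: accum_oo => //; exact: subset_itv_oo_cc.
apply: (eq_cderiv (f := chain w p 1)) => //; last exact: h.
by move=> y yab; rewrite deriven_cont_repr ?ltn_predL// (_ : (m - m.-1 = 1)%N)//; lia.
Qed.

End DerivativesOfChain.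

Section RepresentedFunction.
Variables (alpha : R[i]) (phi z : R -> R[i]).
Hypothesis n0 : (0 < n)%N.
Hypothesis alpha_n : n%:R - 1 < cRe alpha.
Hypothesis phii : Lab phi.
Hypothesis zi : Lab z.
Hypothesis zE : ae_eq_on `]a, b[ z (fun x => rl_integral a alpha phi x + kersum alpha x).

Let alpha0 : 0 < cRe alpha.
Proof. by apply: le_lt_trans alpha_n; rewrite subr_ge0 ler1n. Qed.

(** The semigroup law, used twice, rewrites I^(m - beta) I^alpha phi as I^m I^(alpha - beta) phi,
    and I^m is an m-fold primitive; on the kernels the same operator adds m - beta to the
    exponent. *)
Lemma rl_represented (m : nat) (beta : R[i]) : rl_ok (m%:R - beta) -> rl_ok (alpha - beta) ->
  ae_eq_on `]a, b[ (rl_integral a (m%:R - beta) z)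
    (chain (rl_integral a (alpha - beta) phi) (alpha - beta) m).
Proof.
move=> hq hg; have ha : rl_ok alpha by right.
have ksi := kersum_cintble n0 alpha_n.
have ali := rl_cintble ha phii.
have e1 := rl_ae hq zi (cintbleD mI ali ksi) zE.
have e2 := rlD hq ali ksi.
have e3 := rl_comp hq ha phii.
have e4 := rl_comp (rl_ok_nat m) hg phii.
have e5 := rl_nat m (rl_cintble hg phii).
have kri k : (k < n)%N -> 0 < cRe (alpha - k%:R).
  move=> kn; rewrite cReB cRe_nat subr_gt0; apply: le_lt_trans alpha_n.
  by rewrite lerBrDr natr1 ler_nat.
have e6 : ae_eq_on `]a, b[ (rl_integral a (m%:R - beta) (kersum alpha))
    (kersum (alpha - beta + m%:R)).
  have h1 := @rl_sum _ a b _ _ (index_enum _) (fun (k : 'I_n) x => c k * Kr (alpha - k%:R) (x - a)) hq.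
  have h2 : {ae mu, forall x, forall k : 'I_n, x \in `]a, b[ ->
      rl_integral a (m%:R - beta) (fun x => c k * Kr (alpha - k%:R) (x - a)) x =
      c k * Kr (alpha - beta + m%:R - k%:R) (x - a)}.
    apply: ae_forall => k; have kr := Lab_Kr a b (kri k (ltn_ord k)).
    apply: (ae_imp2 (rlZ (c k) hq kr) (rl_Kr a b hq (kri k (ltn_ord k)))) => x h h' xab.
    by rewrite h// h'//; congr (_ * Kr _ _); ring.
  apply: (ae_imp2 (h1 _) h2) => [k|x {}h1 {}h2 xab].
    exact: (cintbleZ (c k) mI (Lab_Kr a b (kri k (ltn_ord k)))).
  by rewrite /kersum h1//; apply: eq_bigr => k _; rewrite h2.
apply: (ae_imp2 (ae_conj e1 e2) (ae_conj (ae_conj e3 e4) (ae_conj e5 e6))).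
move=> x [h1 h2] [[h3 h4] [h5 h6]] xab.
rewrite h1// h2// h3// h6//; congr (_ + _).
rewrite (_ : m%:R - beta + alpha = m%:R + (alpha - beta)); last by ring.
by rewrite -h4// -h5.
Qed.

Lemma rl_derive_represented beta : rl_ok ((rl_order beta)%:R - beta) -> rl_ok (alpha - beta) ->
  ae_eq_on `]a, b[ (rl_derive a b beta z)
    (fun x => rl_integral a (alpha - beta) phi x + kersum (alpha - beta) x).
Proof.
move=> hq hg; rewrite /rl_derive.
have := deriven_cont_repr_ae (rl_cintble hg phii) (rl_represented hq hg).
by move=> /ae_imp; apply => x h xab; rewrite h// /chain /= addr0.
Qed.

End RepresentedFunction.

End KernelSums.
End Representation.

(** * Taylor expansions and AC^n *)

Section TaylorPart.
Context {R : realType} (a : R).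

(** On x > a this is K_(d - j)(x - a). Unlike [Kr], the monomial is not cut off at x <= a, so it is
    differentiable at the endpoint a. *)
Definition tmono (d j : nat) (x : R) : R[i] :=
  if (j < d)%N then ((x - a) ^+ (d - j.+1) / (d - j.+1)`!%:R)%:C else 0.

Lemma tmono_cderiv d j x : cderiv setT (tmono d.+1 j) x (tmono d j x).
Proof.
rewrite /tmono; have [jd|dj|->] := ltngtP j d.
- rewrite (leqW jd) subSS (_ : (d - j = (d - j.+1).+1)%N); last by lia.
  set k := (d - j.+1)%N.
  apply: (cderiv_shift (f := fun y => (y ^+ k.+1 / k.+1`!%:R)%:C)).
  have := cderivZ ((k.+1`!%:R : R)^-1)%:C (cderiv_exprn k.+1 (x - a)).
  rewrite -rmorphM /= (_ : (k.+1)`!%:R^-1 * _ = (x - a) ^+ k / k`!%:R); last first.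
    rewrite factS natrM invfM -mulrA mulrCA mulKf ?pnatr_eq0//.
    exact: mulrC.
  by apply: eq_cderiv => // y _; rewrite -rmorphM mulrC.
- by rewrite ltnS leqNgt dj; exact: cderiv_cst.
- rewrite ltnS leqnn subSS subnn.
  by apply: eq_cderiv (cderiv_cst setT (1 : R[i]) x) => // y _; rewrite expr0 fact0 divr1.
Qed.

Lemma tmono_Kr d j x : a < x -> tmono d j x = Kr (d%:R - j%:R) (x - a).
Proof.
move=> ax; rewrite /tmono; case: ltnP => [jd|dj].
  rewrite -natrB ?(ltnW jd)// (_ : (d - j = (d - j.+1).+1)%N); last by lia.
  by rewrite Kr_nat// subr_gt0.
by rewrite -opprB -natrB// Kr_Nnat.
Qed.

Lemma tmono_a d j : tmono d.+1 j a = (j == d)%:R.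
Proof.
rewrite /tmono subrr expr0n subSS; have [jd|dj|->] := ltngtP j d.
- by rewrite (leqW jd) subn_eq0 leqNgt jd mul0r.
- by rewrite ltnS leqNgt dj.
- by rewrite ltnS leqnn subnn eqxx fact0 divr1.
Qed.

End TaylorPart.

Section Primitives.
Context {R : realType} (a b : R) (ab : a < b).
Local Notation mu := (@lebesgue_measure R).
Local Notation I := (`]a, b[%classic : set (measurableTypeR R)).
Local Notation Lab := (cintble mu I).

Section TaylorSums.
Variables (n : nat) (c : nat -> R[i]) (phi : R -> R[i]).
Hypothesis phii : Lab phi.

(** The analogue of [chain] at p = 0 on the closed interval, where [ACn] and the limits at a are
    read. *)
Definition taylor (d : nat) (x : R) : R[i] :=
  iter d (Prim a) phi x + \sum_(j < n) c j * tmono a d j x.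

Lemma taylor_chain d x : x \in `]a, b[ -> taylor d x = chain a n c phi 0 d x.
Proof.
rewrite in_itv/= => /andP[ax _]; congr (_ + _); apply: eq_bigr => j _.
by rewrite tmono_Kr// add0r.
Qed.

Lemma tsum_cderiv d x : cderiv setT (fun x => \sum_(j < n) c j * tmono a d.+1 j x) x
  (\sum_(j < n) c j * tmono a d j x).
Proof. by apply: cderiv_sum => j _; apply: cderivZ; exact: tmono_cderiv. Qed.

Lemma taylor_cderiv d x : x \in `[a, b] ->
  cderiv `[a, b] (taylor d.+2) x (taylor d.+1 x).
Proof.
move=> xab; apply: cderivD; first exact: iter_Prim_cderiv.
by apply: (cderivS (B := setT)) => //; exact: tsum_cderiv.
Qed.

Lemma taylor_cont d : continuous_on `[a, b] (taylor d.+1).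
Proof.
apply: continuous_onD; first exact: iter_Prim_cont.
apply: (cderiv_continuous (l := fun x => \sum_(j < n) c j * tmono a d j x)) => x _.
by apply: (cderivS (B := setT)) => //; exact: tsum_cderiv.
Qed.

(** At a the iterated primitive vanishes, and so do all monomials except the one of degree 0, which
    has index d. *)
Lemma taylor_a d : (d < n)%N -> taylor d.+1 a = c d.
Proof.
move=> dn; rewrite /taylor iterS Prim_a add0r (bigD1 (Ordinal dn))//= tmono_a eqxx mulr1.
rewrite big1 ?addr0// => j jd; rewrite tmono_a -(inj_eq val_inj) /= in jd *.
by rewrite (negPf jd) mulr0.
Qed.

Lemma taylor_deriven i x : (i < n)%N -> x \in `[a, b] ->
  deriven_on `[a, b] i (taylor n) x = taylor (n - i) x.
Proof.
move=> im xab; apply: (@deriven_onE _ _ n.-1 _ (fun i => taylor (n - i))) => //.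
- by move=> y; exact: accum_cc.
- by move=> y _; rewrite subn0.
- move=> k y km yab; rewrite (_ : (n - k = (n - k.+2).+2)%N); last by lia.
  by rewrite (_ : (n - k.+1 = (n - k.+2).+1)%N); [exact: taylor_cderiv|lia].
- by lia.
Qed.

Lemma taylor_ACn : (0 < n)%N -> ACn n a b (taylor n).
Proof.
move=> n0; split.
- move=> i x im xab; apply: (@cderiv_derivable _ _ _ _ (taylor (n - i.+1) x)).
  apply: (eq_cderiv (f := taylor (n - i))) => //.
    by move=> y yab; rewrite taylor_deriven//; lia.
  rewrite (_ : (n - i = (n - i.+2).+2)%N); last by lia.
  by rewrite (_ : (n - i.+1 = (n - i.+2).+1)%N); [exact: taylor_cderiv|lia].
- move=> i im; apply/continuous_onP => x xab e e0.
  have := @taylor_cont (n - i).-1; rewrite prednK ?subn_gt0// => /continuous_onP/(_ x xab e e0).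
  move=> [d d0 hd]; exists d => // y yab yd; rewrite !taylor_deriven//; exact: hd.
- move=> e /(Prim_abs_continuous phii)[d d0 hd]; exists d => // N s t hst no small.
  have -> : \sum_(i < N) `|deriven_on `[a, b] n.-1 (taylor n) (t i) -
      deriven_on `[a, b] n.-1 (taylor n) (s i)| = \sum_(i < N) `|Prim a phi (t i) - Prim a phi (s i)|.
    apply: eq_bigr => i _; have [h1 h2 h3] := hst i.
    rewrite !taylor_deriven ?ltn_predL//; last 2 first.
    - by rewrite in_itv/= h1 (le_trans h2).
    - by rewrite in_itv/= h3 (le_trans h1).
    rewrite (_ : (n - n.-1 = 1)%N); last by lia.
    congr (`|_|); rewrite /taylor /= opprD addrACA.
    (* At order one the polynomial part is the constant c 0, which cancels in differences. *)
    rewrite [X in _ + X](_ : _ = 0) ?addr0// -sumrB big1// => j _.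
    by rewrite -mulrBr /tmono ltnS; case: j => -[|j] jn /=; rewrite ?subrr ?mulr0// subnn !expr0 subrr mulr0.
  exact: hd.
Qed.

End TaylorSums.

(** The derivative of order n - 1 is a constant plus the primitive of some phi. Descending in the
    order, each derivative of h and its Taylor form have the same derivative and, by the choice of
    the coefficients, the same value at a. *)
Lemma ACn_taylor n (h : R -> R[i]) : (0 < n)%N -> ACn n a b h ->
  exists2 phi, Lab phi & forall x, x \in `[a, b] ->
    h x = taylor n (fun j => deriven_on `[a, b] (n - j.+1) h a) phi n x.
Proof.
move=> n0 [hD hC hAC]; have [phi phii hphi] := abs_continuous_primitive ab hAC.
exists phi => //; set c := fun j => _.
have aab : a \in `[a, b] by rewrite in_itv/= lexx ltW.
have key d : (d < n)%N -> forall x, x \in `[a, b] ->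
    deriven_on `[a, b] (n - d.+1) h x = taylor n c phi d.+1 x.
  elim: d => [|d ih] dn x xab.
    rewrite subn1 hphi// addrC /taylor; congr (_ + _).
    rewrite (bigD1 (Ordinal n0))//= /c /tmono/= subnn expr0 divr1 mulr1 subn1.
    rewrite big1 ?addr0// => j j0; rewrite ltnS leqn0 ifF ?mulr0//.
    by apply/negbTE; move: j0; rewrite -(inj_eq val_inj).
  have hd y : y \in `[a, b] ->
      cderiv `[a, b] (fun y => deriven_on `[a, b] (n - d.+2) h y + (-1) * taylor n c phi d.+2 y) y 0.
    move=> yab; rewrite [X in cderiv _ _ _ X](_ : 0 = taylor n c phi d.+1 y + (-1) * taylor n c phi d.+1 y); last first.
      by rewrite mulN1r subrr.
    apply: cderivD; last by apply: cderivZ; exact: taylor_cderiv.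
    rewrite -ih//; last exact: ltnW.
    have lt1 : (n - d.+2 < n.-1)%N by lia.
    have := derivable_onP (accum_cc ab yab) (hD _ _ lt1 yab).
    by rewrite -[derive_on _ _ _]/(deriven_on `[a, b] (n - d.+2).+1 h y) (_ : (n - d.+2).+1 = n - d.+1)%N//; lia.
  have := cderiv0_cst ab hd xab; rewrite taylor_a//.
  rewrite {2}/c mulN1r mulN1r subrr => /eqP; rewrite subr_eq0 => /eqP.
  by [].
move=> x xab; have := key n.-1; rewrite prednK// subnn; exact.
Qed.

End Primitives.

(** * Orders of the Riemann-Liouville derivatives *)

Section Order.
Context {R : realType}.
Implicit Types (beta alpha : R[i]).

Lemma rl_order_nat (m : nat) : rl_order (m%:R : R[i]) = m.
Proof.
rewrite /rl_order ifT; last by apply/asboolP; exists m.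
by rewrite cRe_nat natrK.
Qed.

(** The case m = 0, with a negative real part, is the one behind D^(alpha - n) = I^(n - alpha). *)
Lemma rl_order_floor alpha (m : nat) : ~ is_natc alpha ->
  m%:R - 1 <= cRe alpha < m%:R -> rl_order alpha = m.
Proof.
move=> na /andP[h1 h2]; rewrite /rl_order ifF; last by apply/asboolP.
rewrite (@floor_def _ _ (m%:Z - 1)).
  by rewrite subrK.
by rewrite subrK !rmorphB /= -!pmulrn h1.
Qed.

Lemma rl_order_ok beta : 0 <= cRe beta -> rl_ok ((rl_order beta)%:R - beta).
Proof.
move=> b0; have [[m ->]|nb] := pselect (is_natc beta).
  by rewrite rl_order_nat subrr; left.
right; rewrite /rl_order ifF; last by apply/asboolP.
rewrite cReB cRe_nat subr_gt0.
have f0 : 0 <= Num.floor (cRe beta) + 1 by rewrite addr_ge0// floor_ge0.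
by rewrite natr_absz ger0_norm// floorD1_gt.
Qed.

(** By the last clause, subtracting k lowers the order by exactly k, so (n - k) - (alpha - k) = n -
    alpha: all initial values are read off derivatives of the same function I^(n - alpha) y. *)
Lemma rl_order_alpha alpha : 0 < cRe alpha ->
  (~ is_natc alpha -> (rl_order alpha)%:R - 1 < cRe alpha < (rl_order alpha)%:R) ->
  [/\ (0 < rl_order alpha)%N, (rl_order alpha)%:R - 1 < cRe alpha,
    rl_ok ((rl_order alpha)%:R - alpha) &
    forall k, (k <= rl_order alpha)%N -> rl_order (alpha - k%:R) = (rl_order alpha - k)%N].
Proof.
move=> a0 ha; have ok := rl_order_ok (ltW a0); set n := rl_order alpha in ha ok *.
have [[m am]|na] := pselect (is_natc alpha).
  have nm : n = m by rewrite /n am rl_order_nat.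
  have n0 : (0 < n)%N by move: a0; rewrite am cRe_nat ltr0n nm.
  split => //; first by rewrite am cRe_nat nm ltrBlDr ltrDl.
  by move=> k kn; rewrite am -nm -natrB// rl_order_nat.
have /andP[h1 h2] := ha na.
split => //; first by rewrite -(ltr0n R); exact: lt_trans h2.
move=> k kn; apply: rl_order_floor.
  by move=> [m hm]; apply: na; exists (m + k)%N; rewrite natrD -hm subrK.
rewrite natrB// cReB cRe_nat; apply/andP; split; lra.
Qed.

End Order.

(** * Admissible indices *)

Section Admissible.
Context {R : realType} (a b : R) (ab : a < b).
Local Notation mu := (@lebesgue_measure R).
Local Notation I := (`]a, b[%classic : set (measurableTypeR R)).
Local Notation Lab := (cintble mu I).

Lemma Kr_succ p (t : R) : 0 < t -> p * Kr (p + 1) t = t%:C * Kr p t.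
Proof.
move=> t0; rewrite /Kr !ker0E// addrK (invGamma_rec p).
rewrite mulrA [RHS]mulrCA; congr (_ * _).
by rewrite -{1}(subrK 1 p) cpowS.
Qed.

Lemma continuous_on_shift : continuous_on `[a, b] (fun x => (x - a)%:C).
Proof.
apply/continuous_onP => x _ e e0; exists e => // y _ yx.
by rewrite -rmorphB cmodR (_ : y - a - (x - a) = y - x)//; ring.
Qed.

(** K_(p + 1)(x - a) is K_p(x - a) times the bounded factor (x - a) / p. *)
Lemma cintble_Kr_succ A p : continuous_on `[a, b] A ->
  Lab (fun x => A x * Kr p (x - a)) -> Lab (fun x => A x * Kr (p + 1) (x - a)).
Proof.
have mI : measurable I by exact: measurable_itv.
move=> cA hi; have [p0|p0] := eqVneq p 0.
  (* For p = 0 division by p is impossible; there K_1 = 1, and A itself is integrable. *)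
  have h := cintbleM_cont ab cA (cintble_cst (1 : R[i]) a b).
  apply: (eq_cintble mI _ h) => x; rewrite inE /= in_itv/= => /andP[ax _].
  by rewrite p0 add0r (Kr_nat 0) ?subr_gt0// expr0 fact0 divr1.
have h := cintbleZ p^-1 mI (cintbleM_cont ab continuous_on_shift hi).
apply: (eq_cintble mI _ h) => x; rewrite inE /= in_itv/= => /andP[ax _].
by rewrite [X in _ * X]mulrCA -Kr_succ ?subr_gt0// mulrCA mulKf.
Qed.

(* Admissibility passes from k0 to all smaller indices. *)
Lemma cintble_Kr_sub A p (i k : nat) : continuous_on `[a, b] A -> (i <= k)%N ->
  Lab (fun x => A x * Kr (p - k%:R) (x - a)) -> Lab (fun x => A x * Kr (p - i%:R) (x - a)).
Proof.
move=> cA ik; rewrite -(subnKC ik); elim: (k - i)%N => [|m ih]; first by rewrite addn0.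
move=> /(cintble_Kr_succ cA); rewrite addnS -natr1 opprD addrA subrK; exact: ih.
Qed.

End Admissible.

(** * Membership in L^alpha and initial values *)

Section CauchyProblem.
Context {R : realType} (a b : R) (ab : a < b).
Local Notation mu := (@lebesgue_measure R).
Local Notation I := (`]a, b[%classic : set (measurableTypeR R)).
Local Notation Lab := (cintble mu I).
Variables (alpha : R[i]).
Hypothesis alpha0 : 0 < cRe alpha.
Hypothesis alphaN : ~ is_natc alpha ->
  (rl_order alpha)%:R - 1 < cRe alpha < (rl_order alpha)%:R.
Local Notation n := (rl_order alpha).

Let n0 : (0 < n)%N. Proof. by have [] := rl_order_alpha alpha0 alphaN. Qed.
Let alpha_n : n%:R - 1 < cRe alpha.
Proof. by have [] := rl_order_alpha alpha0 alphaN. Qed.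
Let okna : rl_ok (n%:R - alpha).
Proof. by have [] := rl_order_alpha alpha0 alphaN. Qed.
Let ok_alpha : rl_ok alpha. Proof. by right. Qed.
Let mI : measurable I. Proof. exact: measurable_itv. Qed.

Definition represents (c : nat -> R[i]) phi z := ae_eq_on `]a, b[ z
  (fun x => rl_integral a alpha phi x + kersum a n c alpha x).

Section Represented.
Variables (c : nat -> R[i]) (phi z : R -> R[i]).
Hypothesis phii : Lab phi.

Lemma represented_cintble :
  Lab (fun x => rl_integral a alpha phi x + kersum a n c alpha x).
Proof.
by apply: cintbleD => //; [exact: rl_cintble|exact: kersum_cintble].
Qed.

Hypothesis zi : Lab z.
Hypothesis zE : represents c phi z.

Lemma represented_chain :
  ae_eq_on `]a, b[ (rl_integral a (n%:R - alpha) z) (chain a n c phi 0 n).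
Proof.
have ok0 : rl_ok (alpha - alpha) by rewrite subrr; left.
have h := rl_represented n0 alpha_n phii zi zE okna ok0.
have e : rl_integral a 0 phi = phi by apply/funext => y; rewrite rl_integral0.
by apply: (ae_imp h) => x {}h xab; rewrite h// subrr e.
Qed.

Lemma represented_Lalpha : Lalpha a b alpha z.
Proof.
split => //; exists (taylor a n c phi n); first exact: taylor_ACn.
by apply: (ae_imp represented_chain) => x h xab; rewrite h// (taylor_chain n c phi n xab).
Qed.

(** D^(alpha - k) z is the derivative of order n - k of I^(n - alpha) z, hence equals [taylor] of
    order k on ]a, b[, which is continuous up to a with value c (k - 1). *)
Lemma represented_limit k : (1 <= k <= n)%N ->
  (rl_derive a b (alpha - k%:R) z x : R[i]^o) @[x --> a^'+] --> (c k.-1 : R[i]^o).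
Proof.
move=> /andP[k0 kn].
have [_ _ _ /(_ _ kn) ok] := rl_order_alpha alpha0 alphaN.
have kk : (k.-1 < n)%N by rewrite prednK.
rewrite -(taylor_a a c phi kk) prednK//.
have := @taylor_cont _ a b n c phi phii k.-1; rewrite prednK// => ct.
apply: (cvg_at_right_continuous ab ct) => x xab.
rewrite /rl_derive ok (_ : (n - k)%:R - (alpha - k%:R) = n%:R - alpha); last first.
  by rewrite natrB//; ring.
rewrite (deriven_cont_repr ab phii represented_chain)//; last by rewrite ltn_subrL k0.
by rewrite subKn// (taylor_chain n c phi k xab).
Qed.

Lemma represented_derive beta : 0 <= cRe beta -> rl_ok (alpha - beta) ->
  ae_eq_on `]a, b[ (rl_derive a b beta z)
    (fun x => rl_integral a (alpha - beta) phi x + kersum a n c (alpha - beta) x).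
Proof. by move=> b0 hb; apply: rl_derive_represented => //; exact: rl_order_ok. Qed.

(** The kernels that remain are K_0, K_(-1), ..., all identically zero. *)
Lemma represented_derive_alpha : ae_eq_on `]a, b[ (rl_derive a b alpha z) phi.
Proof.
have ok0 : rl_ok (alpha - alpha) by rewrite subrr; left.
apply: (ae_imp (represented_derive (ltW alpha0) ok0)) => x h xab.
rewrite h// subrr rl_integral0 /kersum big1 ?addr0// => k _.
by rewrite sub0r Kr_Nnat mulr0.
Qed.

End Represented.

(** The Taylor data of the AC^n function equal to I^(n - alpha) z define a candidate with the same
    fractional integral. As (n - alpha) + alpha = n is natural, [rl_eq0] applied to the difference
    identifies z with the candidate. *)
Lemma Lalpha_represents z : Lalpha a b alpha z ->
  exists c, exists2 phi, Lab phi & represents c phi z.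
Proof.
move=> [zi [h hAC hE]]; have [phi phii hphi] := ACn_taylor ab n0 hAC.
set c := fun j => _ in hphi; exists c, phi => //.
have ri := represented_cintble c phii.
have rE : represents c phi (fun x => rl_integral a alpha phi x + kersum a n c alpha x).
  exact: aeW.
have h1 := represented_chain phii ri rE.
have h2 := rlD okna zi (cintbleZ (-1) mI ri).
have h3 := rlZ (-1) okna ri.
have : ae_eq_on `]a, b[ (rl_integral a (n%:R - alpha)
    (fun x => z x + (-1) * (rl_integral a alpha phi x + kersum a n c alpha x))) (fun=> 0).
  apply: (ae_imp2 (ae_conj h1 h2) (ae_conj h3 hE)) => x [{}h1 {}h2] [{}h3 {}hE] xab.
  rewrite h2// h3// h1// -hE// hphi; last exact: subset_itv_oo_cc.
  by rewrite (taylor_chain n c phi n xab) mulN1r subrr.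
move=> /(rl_eq0 ab okna ok_alpha (m := n)) hz.
have := hz _ (cintbleD mI zi (cintbleZ (-1) mI ri)); rewrite addrC subrK => /(_ erefl).
move=> /ae_imp; apply => x {}hz xab; apply/eqP; rewrite -subr_eq0 -mulN1r; apply/eqP; exact: hz.
Qed.

End CauchyProblem.

(** * Existence and uniqueness of solutions *)

Section Solutions.
Context {R : realType} (a b : R) (ab : a < b).
Local Notation mu := (@lebesgue_measure R).
Local Notation I := (`]a, b[%classic : set (measurableTypeR R)).
Local Notation Lab := (cintble mu I).
Variables (l : nat) (alpha : R[i]) (beta : 'I_l -> R[i]) (A : 'I_l -> R -> R[i]).
Hypothesis alpha0 : 0 < cRe alpha.
Hypothesis alphaN : ~ is_natc alpha ->
  (rl_order alpha)%:R - 1 < cRe alpha < (rl_order alpha)%:R.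
Hypothesis beta0 : forall j, 0 <= cRe (beta j).
Hypothesis beta_alpha : forall j, cRe (beta j) < cRe alpha.
Hypothesis cA : forall j, continuous_on `[a, b] (A j).
Local Notation n := (rl_order alpha).
Variables (c : nat -> R[i]) (g : R -> R[i]).
Hypothesis gi : Lab g.
(** The coefficient stays inside the integrability condition: where c k = 0 the product with the
    kernel may fail to be integrable, yet the term is 0. *)
Hypothesis ci : forall k j, (k < n)%N ->
  Lab (fun x => c k * (A j x * Kr (alpha - beta j - k%:R) (x - a))).

Let mI : measurable I. Proof. exact: measurable_itv. Qed.

Let ok_alpha : rl_ok alpha. Proof. by right. Qed.

Let gamma j : R[i] := alpha - beta j.

Let gamma0 j : 0 < cRe (gamma j). Proof. by rewrite cReB subr_gt0. Qed.

Let G x : R[i] := g x - \sum_(j < l) A j x * kersum a n c (gamma j) x.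

Let Gi : Lab G.
Proof.
apply: cintbleB => //; apply: cintble_sum => // j _.
have := @cintble_sum _ _ _ mu I 'I_n (index_enum _) xpredT
  (fun k x => c k * (A j x * Kr (gamma j - k%:R) (x - a))) mI (fun k _ => ci j (ltn_ord k)).
apply: eq_cintble => // x _; rewrite mulr_sumr; apply: eq_bigr => k _.
by rewrite mulrCA.
Qed.

Definition fde z := ae_eq_on `]a, b[
  (fun x => rl_derive a b alpha z x + \sum_(j < l) A j x * rl_derive a b (beta j) z x) g.

(** An equivalence, since existence goes from the Volterra equation to the differential one and
    uniqueness goes back. *)
Lemma represented_fde phi z : Lab phi -> Lab z -> represents a b alpha c phi z ->
  fde z <-> volterra_eq a b A gamma G phi.
Proof.
move=> phii zi zE.
have h1 := represented_derive_alpha ab alpha0 alphaN phii zi zE.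
have h2 : {ae mu, forall x, forall j, x \in `]a, b[ -> rl_derive a b (beta j) z x =
    rl_integral a (gamma j) phi x + kersum a n c (gamma j) x}.
  apply: ae_forall => j.
  exact: (represented_derive ab alpha0 alphaN phii zi zE (beta0 j) (or_intror (gamma0 j))).
have key : {ae mu, forall x, x \in `]a, b[ ->
    rl_derive a b alpha z x + \sum_(j < l) A j x * rl_derive a b (beta j) z x =
    phi x + \sum_(j < l) A j x * rl_integral a (gamma j) phi x +
    \sum_(j < l) A j x * kersum a n c (gamma j) x}.
  apply: (ae_imp2 h1 h2) => x {}h1 {}h2 xab; rewrite h1// -addrA -big_split/=; congr (_ + _).
  by apply: eq_bigr => j _; rewrite h2// mulrDr.
split=> h.
  by apply: (ae_imp2 key h) => x {}key {}h xab; rewrite /G -h// key// addrK.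
by apply: (ae_imp2 key h) => x {}key {}h xab; rewrite key// h// /G subrK.
Qed.

Definition initial z := forall k, (1 <= k <= n)%N ->
  (rl_derive a b (alpha - k%:R) z x : R[i]^o) @[x --> a^'+] --> (c k.-1 : R[i]^o).

Lemma cauchy_exists : exists z, [/\ Lalpha a b alpha z, fde z & initial z].
Proof.
have [phi phii hphi] := volterra_exists ab cA gamma0 Gi.
pose z x := rl_integral a alpha phi x + kersum a n c alpha x.
have zi : Lab z by exact: represented_cintble.
have zE : represents a b alpha c phi z by exact: aeW.
exists z; split.
- exact: (represented_Lalpha ab alpha0 alphaN phii zi zE).
- exact/(represented_fde phii zi zE).
- exact: (represented_limit ab alpha0 alphaN phii zi zE).
Qed.

(** Every element of L^alpha is represented with some coefficients, and uniqueness of limits at a+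
    makes the initial conditions determine those of index below n. *)
Lemma solution_represents z : Lalpha a b alpha z -> initial z ->
  exists2 phi, Lab phi & represents a b alpha c phi z.
Proof.
move=> zL zI; have zi : Lab z by case: zL.
have [c' [phi phii zE]] := Lalpha_represents ab alpha0 alphaN zL.
exists phi => //; have cc' k : (k < n)%N -> c' k = c k.
  move=> kn; have k1 : (1 <= k.+1 <= n)%N by [].
  have hh : hausdorff_space (R[i]^o) by apply: norm_hausdorff.
  have h1 := represented_limit ab alpha0 alphaN phii zi zE k1.
  exact: (cvg_unique hh h1 (zI _ k1)).
apply: (ae_imp zE) => x h xab; rewrite h//; congr (_ + _).
by apply: eq_bigr => k _; rewrite cc'.
Qed.

Lemma cauchy_unique y z : Lalpha a b alpha y -> fde y -> initial y ->
  Lalpha a b alpha z -> fde z -> initial z -> ae_eq_on `]a, b[ z y.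
Proof.
move=> yL yeq yI zL zeq zI.
have [yi zi] : Lab y /\ Lab z by case: yL; case: zL.
have [phi phii yE] := solution_represents yL yI.
have [psi psii zE] := solution_represents zL zI.
have h := volterra_unique ab cA gamma0 Gi psii phii
  ((represented_fde psii zi zE).1 zeq) ((represented_fde phii yi yE).1 yeq).
have h' := rl_ae ok_alpha psii phii h.
by apply: (ae_imp2 h' (ae_conj yE zE)) => x {}h [{}yE {}zE] xab; rewrite yE// zE// h.
Qed.

End Solutions.

Theorem theorem3p2 (R : realType) (a b : R) (hab : a < b)
    (l : nat) (alpha : R[i]) (alpha_ : 'I_l.+1 -> R[i])
    (halpha0 : alpha_ ord0 = 0)
    (halpha_lt : forall i j : 'I_l.+1, (i < j)%N ->
       complex.Re (alpha_ i) < complex.Re (alpha_ j))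
    (halpha_max : complex.Re (alpha_ ord_max) < complex.Re alpha)
    (n : nat) (hn : n = rl_order alpha)
    (hnalpha : ~ is_natc alpha -> n%:R - 1 < complex.Re alpha < n%:R)
    (a_ : 'I_l.+1 -> R -> R[i])
    (ha_ : forall j, continuous_on `[a, b] (a_ j))
    (g : R -> R[i]) (hg : cintegrable `]a, b[ g)
    (b_ : nat -> R[i])
    (admissible := fun k : nat => forall j : 'I_l.+1,
       cintegrable `]a, b[ (fun x =>
         a_ j x * (cpow (x - a) (alpha - alpha_ j - k%:R)
                   / Gamma (alpha - alpha_ j - k%:R + 1))))
    (k0 : nat) (hk0_range : (1 <= k0 <= n)%N) (hk0 : admissible k0)
    (hk0_max : forall k, (1 <= k <= n)%N -> admissible k -> (k <= k0)%N)
    (solution := fun y : R -> R[i] =>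
       [/\ Lalpha a b alpha y,
           ae_eq_on `]a, b[
             (fun x => rl_derive a b alpha y x +
                \sum_(j < l.+1) a_ j x * rl_derive a b (alpha_ j) y x) g
         & forall k, (1 <= k <= n)%N ->
             (rl_derive a b (alpha - k%:R) y x : R[i]^o) @[x --> a^'+] -->
             ((if (k <= k0)%N then b_ k else 0) : R[i]^o)]) :
  exists2 y, solution y &
    forall z, solution z -> ae_eq_on `]a, b[ z y.
Proof.
have beta0 j : 0 <= complex.Re (alpha_ j).
  have [->|j0] := eqVneq j ord0; first by rewrite halpha0.
  have := halpha_lt ord0 j; rewrite halpha0 lt0n => h; apply/ltW/h.
  by rewrite -[X in _ != X]/(val (@ord0 l)) (inj_eq val_inj).
have beta_alpha j : complex.Re (alpha_ j) < complex.Re alpha.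
  apply: le_lt_trans halpha_max.
  have [->//|jl] := eqVneq j ord_max; apply/ltW/halpha_lt.
  by rewrite /= ltn_neqAle -ltnS ltn_ord andbT -[X in _ != X]/(val (@ord_max l)) (inj_eq val_inj).
have alpha0 : 0 < complex.Re alpha by exact: le_lt_trans (beta_alpha ord0).
(* Indices are shifted by one: c k is the datum for k + 1 in the statement, replaced by 0 beyond
   k0. *)
subst n; pose c k := if (k.+1 <= k0)%N then b_ k.+1 else 0.
have ci k j : (k < rl_order alpha)%N -> cintegrable `]a, b[
    (fun x : R => c k * (a_ j x * Kr (alpha - alpha_ j - k%:R) (x - a))).
  move=> kn; rewrite /c; case: ifP => kk0; last first.
    by apply: eq_cintble (cintble0 _ _) => [|x _]; [exact: measurable_itv|rewrite mul0r].
  apply: cintbleZ; first exact: measurable_itv.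
  have k0k : (k <= k0.-1)%N by rewrite -ltnS prednK//; case/andP: hk0_range.
  apply: (cintble_Kr_sub hab (@ha_ j) k0k).
  apply: eq_cintble (hk0 j); first exact: measurable_itv.
  move=> x; rewrite inE /= in_itv/= => /andP[ax _].
  rewrite /Kr ker0E ?subr_gt0// [X in _ = _ * X]mulrC.
  (* Admissibility of k0 concerns K_p with p = alpha - alpha_j - k0 + 1, which is the kernel of
     index k0 - 1 in the shifted numbering. *)
  have -> : alpha - alpha_ j - k0.-1%:R = alpha - alpha_ j - k0%:R + 1.
    by rewrite -[in RHS](prednK (n := k0)) ?(andP hk0_range).1// -natr1; ring.
  by rewrite addrK.
have ini z : (forall k, (1 <= k <= rl_order alpha)%N ->
      (rl_derive a b (alpha - k%:R) z x : R[i]^o) @[x --> a^'+] -->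
      ((if (k <= k0)%N then b_ k else 0) : R[i]^o)) <-> initial a b alpha c z.
  by split=> h k k1; have := h k k1; rewrite /c prednK//; case/andP: k1.
have [y [yL yE yI]] := @cauchy_exists R a b hab l.+1 alpha alpha_ a_
  alpha0 hnalpha beta0 beta_alpha ha_ c g hg ci.
exists y; first exact: And3 yL yE ((ini y).2 yI).
move=> z [zL zE zI]; have {}zI := (ini z).1 zI.
exact: (@cauchy_unique R a b hab l.+1 alpha alpha_ a_
  alpha0 hnalpha beta0 beta_alpha ha_ c g hg ci y z yL yE yI zL zE zI).
Qed.
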